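(* A $7$-dimensional $2$-step nilpotent real Lie algebra $\mathfrak{n}$ admits purely coclosed $\mathrm{G}_2$-structures if and only if $\mathfrak{n}$ is not isomorphic to $\mathfrak{h}_3\oplus\mathbb{R}^4$, $\mathfrak{n}_{7,2,A}$ or $\mathfrak{n}_{7,2,B}$, where $\mathfrak{h}_3$ denotes the $3$-dimensional Heisenberg Lie algebra.
   Context: A Lie algebra is $2$-step nilpotent if it is non-abelian and its derived algebra is contained in its center. $\mathrm{d}$ denotes the Chevalley-Eilenberg differential on $\Lambda^\bullet\mathfrak{n}^*$ ($\mathrm{d}\alpha(x,y)=-\alpha([x,y])$ for $\alpha\in\mathfrak{n}^*$, extended as a graded derivation). A Lie algebra is described by the tuple $(\mathrm{d}f^1,\dots,\mathrm{d}f^7)$ for a basis $\{f^1,\dots,f^7\}$ of $\mathfrak{n}^*$, with $f^{ij}=f^i\wedge f^j$: $\mathfrak{h}_3\oplus\mathbb{R}^4=(0,0,0,0,0,0,f^{12})$, $\mathfrak{n}_{7,2,A}=(0,0,0,0,0,f^{12},f^{14}+f^{35})$, $\mathfrak{n}_{7,2,B}=(0,0,0,0,0,f^{12}+f^{34},f^{15}+f^{23})$. A $\mathrm{G}_2$-structure on a $7$-dimensional real vector space $V$ is a $3$-form $\varphi\in\Lambda^3V^*$ such that $(v\lrcorner\varphi)\wedge(v\lrcorner\varphi)\wedge\varphi\neq0$ for all $v\in V\smallsetminus\{0\}$. It determines a unique inner product $g_\varphi$ and orientation, with volume form $\mathrm{vol}_\varphi$, such that $g_\varphi(v,w)\mathrm{vol}_\varphi=\frac16\,(v\lrcorner\varphi)\wedge(w\lrcorner\varphi)\wedge\varphi$;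 $*_\varphi$ is the corresponding Hodge operator. A $\mathrm{G}_2$-structure $\varphi$ on $\mathfrak{n}$ is purely coclosed if $\mathrm{d}*_\varphi\varphi=0$ and $\mathrm{d}\varphi\wedge\varphi=0$. *)

(* Defs.v *)
(* Mathematical Components, with the real numbers given as a [realType]. *)
From HB Require Import structures.
From mathcomp Require Import all_boot all_order all_fingroup all_algebra.
From mathcomp Require Import reals.
From mathcomp Require Import ring.

Set Implicit Arguments.
Unset Strict Implicit.
Unset Printing Implicit Defensive.

Import Order.TTheory GRing.Theory Num.Theory.
Local Open Scope ring_scope.

Section ExteriorForms.
Context {R : realType} {V : vectType R}.

(* An arbitrary function of k vectors; it is an element of Lambda^k V* when
   [is_form] holds. All operations below are defined on arbitrary functions. *)
Definition kfun (k : nat) : Type := k.-tuple V -> R.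

Definition set_arg k (v : k.-tuple V) (i : 'I_k) (x : V) : k.-tuple V :=
  [tuple if j == i then x else tnth v j | j < k].

Definition is_form k (w : kfun k) : Prop :=
  (forall v i, scalar (fun x => w (set_arg v i x))) /\
  (forall (v : k.-tuple V) i j, i != j -> tnth v i = tnth v j -> w v = 0).

(* Normalised so that (a /\ b)(x, y) = a x * b y - a y * b x for 1-forms. *)
Definition wedge k l (a : kfun k) (b : kfun l) : kfun (k + l) := fun v =>
  (k`! * l`!)%:R^-1 * \sum_(s : 'S_(k + l)) (-1) ^+ s *
    (a [tuple tnth v (s (lshift l i)) | i < k] *
     b [tuple tnth v (s (rshift k j)) | j < l]).

Definition contract k (x : V) (a : kfun k.+1) : kfun k :=
  fun v => a [tuple of x :: v].

Definition zero_form k : kfun k := fun=> 0.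

End ExteriorForms.

Arguments kfun {R} V k.
Arguments zero_form {R V k}.

Section LieAlgebras.
Context {R : realType}.

Record lieAlgebra : Type := LieAlgebra {
  lie_sort :> vectType R;
  lie_br : lie_sort -> lie_sort -> lie_sort;
  lie_br_linearl : forall y, linear (fun x => lie_br x y);
  lie_br_linearr : forall x, linear (lie_br x);
  lie_br_alt : forall x, lie_br x x = 0;
  lie_br_jacobi : forall x y z,
    lie_br x (lie_br y z) + lie_br y (lie_br z x) + lie_br z (lie_br x y) = 0
}.

Definition lie_iso (L M : lieAlgebra) : Prop :=
  exists f : {linear L -> M},
    bijective f /\ forall x y, f (lie_br x y) = lie_br (f x) (f y).

Definition abelian (L : lieAlgebra) : Prop := forall x y : L, lie_br x y = 0.

(* Sums of brackets are already closed under scaling. *)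
Definition in_derived (L : lieAlgebra) (x : L) : Prop :=
  exists s : seq (L * L), x = \sum_(p <- s) lie_br p.1 p.2.

Definition in_center (L : lieAlgebra) (x : L) : Prop :=
  forall y : L, lie_br x y = 0.

Definition two_step_nilpotent (L : lieAlgebra) : Prop :=
  ~ abelian L /\ forall x : L, in_derived x -> in_center x.

(* Chevalley-Eilenberg differential:
     (d w)(x_0, ..., x_k) = sum_(i < j) (-1)^(i + j)
        w([x_i, x_j], x_0, ..., ^x_i, ..., ^x_j, ..., x_k).
   For i < j the index [lift j i] has value i, and [lift j \o lift i]
   enumerates increasingly the indices other than i and j. That this is the
   graded derivation extending d a (x, y) = - a [x, y] is shown below, in
   [dCE1] and [dCE_wedge]. *)
Definition dCE (L : lieAlgebra) k : kfun L k -> kfun L k.+1 :=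
  match k return kfun L k -> kfun L k.+1 with
  | 0 => fun _ _ => 0
  | k'.+1 => fun w v =>
      \sum_(j < k'.+2) \sum_(i < k'.+1 | (i < j)%N) (-1) ^+ (i + j) *
        w [tuple of lie_br (tnth v (lift j i)) (tnth v j) ::
                    [tuple tnth v (lift j (lift i r)) | r < k']]
  end.

End LieAlgebras.

Arguments lieAlgebra R : clear implicits.

Section G2Structures.
Context {R : realType}.

Definition is_G2 (V : vectType R) (phi : kfun V 3) : Prop :=
  is_form phi /\
  forall v : V, v != 0 ->
    ~ (wedge (wedge (contract v phi) (contract v phi)) phi =1 zero_form).

Definition inner_product (V : vectType R) (g : V -> V -> R) : Prop :=
  [/\ forall y, scalar (fun x => g x y),
      forall x y, g x y = g y x &
      forall x, x != 0 -> 0 < g x x].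

Definition orthonormal (V : vectType R) (g : V -> V -> R) n
    (e : n.-tuple V) : Prop :=
  forall i j, g (tnth e i) (tnth e j) = (i == j)%:R.

(* [vol] is the volume form of [g] for one of the two orientations of V;
   the choice of [vol] is the choice of the orientation. *)
Definition volume_form (V : vectType R) n (g : V -> V -> R) (vol : kfun V n)
    : Prop :=
  [/\ \dim {:V} = n, is_form vol &
      exists2 e : n.-tuple V, orthonormal g e & vol e = 1].

(* [g] and [vol] are uniquely determined by a G2-structure [phi]. *)
Definition G2_metric (V : vectType R) (phi : kfun V 3)
    (g : V -> V -> R) (vol : kfun V 7) : Prop :=
  [/\ inner_product g, volume_form g vol &
      forall v w : V,
        (fun x => g v w * vol x) =1
        (fun x => 6%:R^-1 *
           wedge (wedge (contract v phi) (contract w phi)) phi x)].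

(* Inner product induced on k-forms, computed in an orthonormal basis [e]:
   the sum over increasing multi-indices, written as 1/k! times the sum over
   all multi-indices. *)
Definition form_inner (V : vectType R) n (e : n.-tuple V) k
    (a b : kfun V k) : R :=
  (k`!)%:R^-1 * \sum_(f : {ffun 'I_k -> 'I_n})
    a [tuple tnth e (f i) | i < k] * b [tuple tnth e (f i) | i < k].

(* [c] is the Hodge dual of [b] for [g] and [vol]: a /\ c = <a, b> vol for all
   k-forms a. The choice of the orthonormal basis is immaterial. *)
Definition hodge_dual (V : vectType R) k l (g : V -> V -> R)
    (vol : kfun V (k + l)) (b : kfun V k) (c : kfun V l) : Prop :=
  is_form c /\
  exists2 e : (k + l).-tuple V, orthonormal g e &
    forall a : kfun V k, is_form a ->
      wedge a c =1 (fun x => form_inner e a b * vol x).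

Definition coclosed (L : lieAlgebra R) (phi : kfun L 3) : Prop :=
  exists (g : L -> L -> R) (vol : kfun L 7) (psi : kfun L 4),
    [/\ G2_metric phi g vol,
        hodge_dual (k := 3) (l := 4) g vol phi psi &
        dCE psi =1 zero_form].

Definition purely_coclosed_G2 (L : lieAlgebra R) (phi : kfun L 3) : Prop :=
  [/\ is_G2 phi, coclosed phi & wedge (dCE phi) phi =1 zero_form].

End G2Structures.

Section Calculus.
Context {R : realType}.
Implicit Type V : vectType R.

Lemma kfun_eq V k (w : kfun V k) (u v : k.-tuple V) :
  (forall i, tnth u i = tnth v i) -> w u = w v.
Proof. by move=> /eq_from_tnth ->. Qed.

Lemma form_swap V k (w : kfun V k) (v : k.-tuple V) i j : is_form w ->
  i != j -> w [tuple tnth v (tperm i j r) | r < k] = - w v.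
Proof.
move=> [lin alt] neq_ij.
pose W x y := w (set_arg (set_arg v i x) j y).
have W0 x : W x x = 0.
  apply: (alt _ i j) => //; rewrite !tnth_mktuple eqxx (negPf neq_ij).
  by rewrite eqxx.
have Wr x y y' : W x (y + y') = W x y + W x y'.
  by have := lin (set_arg v i x) j 1 y y'; rewrite scale1r mul1r.
have Wl x x' y : W (x + x') y = W x y + W x' y.
  have E z : W z y = w (set_arg (set_arg v j y) i z).
    apply: kfun_eq => r; rewrite !tnth_mktuple.
    by case: (eqVneq r j) => // ->; rewrite eq_sym (negPf neq_ij).
  by rewrite !E; have := lin (set_arg v j y) i 1 x x'; rewrite scale1r mul1r.
have := W0 (tnth v i + tnth v j); rewrite Wl !Wr !W0 add0r addr0 addrC => /eqP.
rewrite addr_eq0 => /eqP E.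
transitivity (W (tnth v j) (tnth v i)).
  apply: kfun_eq => r; rewrite !tnth_mktuple.
  by case: tpermP => [->|->|/eqP/negPf-> /eqP/negPf->];
    rewrite ?eqxx ?(negPf neq_ij).
rewrite E; congr (- _); apply: kfun_eq => r; rewrite !tnth_mktuple.
by case: eqP => [->//|_]; case: eqP => [->|].
Qed.

Lemma form_perm V k (w : kfun V k) (v : k.-tuple V) (s : 'S_k) : is_form w ->
  w [tuple tnth v (s r) | r < k] = (-1) ^+ s * w v.
Proof.
move=> wF; case: (prod_tpermP s) => ts -> {s} dts.
elim: ts v dts => [|t ts IH] v /=.
  move=> _; rewrite big_nil odd_perm1 expr0 mul1r.
  by apply: kfun_eq => r; rewrite tnth_mktuple perm1.
move=> /andP[dt dts]; rewrite big_cons odd_mul_tperm dt signr_addb expr1 mulN1r.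
rewrite mulNr -(IH v) //.
have dt' : t.1 != t.2 by [].
rewrite -(form_swap _ wF dt'); apply: kfun_eq => r.
by rewrite !tnth_mktuple permM.
Qed.

Lemma sum_lift_perm n (G : 'S_n.+1 -> R) :
  \sum_(s : 'S_n.+1) (-1) ^+ s * G s =
  \sum_(j < n.+1) \sum_(t : 'S_n) (-1) ^+ j * ((-1) ^+ t * G (lift_perm ord0 j t)).
Proof.
rewrite (partition_big (fun s : 'S_n.+1 => s ord0) predT) //=.
apply: eq_bigr => j _; rewrite (reindex (lift_perm ord0 j)); last first.
  pose ulsf i (s : 'S_n.+1) k := odflt k (unlift (s i) (s (lift i k))).
  have ulsfK i (s : 'S_n.+1) k: lift (s i) (ulsf i s k) = s (lift i k).
    rewrite /ulsf; have:= neq_lift i k.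
    by rewrite -(can_eq (permK s)) => /unlift_some[] ? ? ->.
  have inj_ulsf: injective (ulsf ord0 _).
    move=> s; apply: can_inj (ulsf (s ord0) s^-1%g) _ => k'.
    by rewrite {1}/ulsf ulsfK !permK liftK.
  exists (fun s => perm (inj_ulsf s)) => [s _ | s].
    by apply/permP=> k'; rewrite permE /ulsf lift_perm_lift lift_perm_id liftK.
  move/(s _ =P _) => si0; apply/permP=> k.
  case: (unliftP ord0 k) => [k'|] ->; rewrite ?lift_perm_id //.
  by rewrite lift_perm_lift -si0 permE ulsfK.
apply: eq_big => [s|s _]; first by rewrite lift_perm_id eqxx.
rewrite mulrA; congr (_ * _).
by rewrite -[in RHS]signr_odd -signr_addb odd_lift_perm.
Qed.

Lemma tnth_cons0 (T : Type) k (x : T) (v : k.-tuple T) :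
  tnth [tuple of x :: v] ord0 = x.
Proof. by []. Qed.

Lemma tnth_consS (T : Type) k (x : T) (v : k.-tuple T) i :
  tnth [tuple of x :: v] (lift ord0 i) = tnth v i.
Proof. by rewrite !(tnth_nth x). Qed.

Lemma form_wedge V k l (a : kfun V k) (b : kfun V l) :
  is_form a -> is_form b -> is_form (wedge a b).
Proof.
move=> [alin aalt] [blin balt]; split=> [v i c x y|v i j neq_ij vij].
  rewrite /wedge [c * _]mulrCA -mulrDr; congr (_ * _).
  rewrite mulr_sumr -big_split /=; apply: eq_bigr => s _.
  rewrite [c * _]mulrCA -mulrDr; congr (_ * _).
  have [p sp] : exists p, s p = i by exists (s^-1%g i); rewrite permKV.
  have Ea z (q : 'I_k) : p = lshift l q ->
    [tuple tnth (set_arg v i z) (s (lshift l r)) | r < k] =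
    set_arg [tuple tnth v (s (lshift l r)) | r < k] q z.
    move=> pq; apply: eq_from_tnth => r; rewrite !tnth_mktuple -sp.
    by rewrite (inj_eq perm_inj) pq (inj_eq (@lshift_inj _ _)).
  have Eb z (q : 'I_l) : p = rshift k q ->
    [tuple tnth (set_arg v i z) (s (rshift k r)) | r < l] =
    set_arg [tuple tnth v (s (rshift k r)) | r < l] q z.
    move=> pq; apply: eq_from_tnth => r; rewrite !tnth_mktuple -sp.
    by rewrite (inj_eq perm_inj) pq (inj_eq (@rshift_inj _ _)).
  have Na z (q : 'I_l) : p = rshift k q ->
    [tuple tnth (set_arg v i z) (s (lshift l r)) | r < k] =
    [tuple tnth v (s (lshift l r)) | r < k].
    move=> pq; apply: eq_from_tnth => r; rewrite !tnth_mktuple -sp.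
    by rewrite (inj_eq perm_inj) pq eq_lrshift.
  have Nb z (q : 'I_k) : p = lshift l q ->
    [tuple tnth (set_arg v i z) (s (rshift k r)) | r < l] =
    [tuple tnth v (s (rshift k r)) | r < l].
    move=> pq; apply: eq_from_tnth => r; rewrite !tnth_mktuple -sp.
    by rewrite (inj_eq perm_inj) pq eq_rlshift.
  case: (split_ordP p) => q pq.
    by rewrite !(Ea _ _ pq) !(Nb _ _ pq) alin mulrDl mulrA.
  by rewrite !(Eb _ _ pq) !(Na _ _ pq) blin mulrDr mulrCA.
rewrite /wedge.
pose F (s : 'S_(k + l)) := (-1) ^+ s *
    (a [tuple tnth v (s (lshift l i)) | i < k] *
     b [tuple tnth v (s (rshift k j)) | j < l]).
suff: \sum_s F s = 0 by rewrite /F => ->; rewrite mulr0.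
have E : \sum_s F s = - \sum_s F s.
  rewrite [LHS](reindex_inj (mulIg (tperm i j))) -sumrN.
  apply: eq_bigr => s _; rewrite /F odd_permM odd_tperm neq_ij addbT.
  rewrite signrN mulNr; congr (- (_ * (_ * _))).
    apply: kfun_eq => r; rewrite !tnth_mktuple permM.
    by case: tpermP => [->|->|].
  apply: kfun_eq => r; rewrite !tnth_mktuple permM.
  by case: tpermP => [->|->|].
by move/eqP: E; rewrite -addr_eq0 -mulr2n mulrn_eq0 => /eqP.
Qed.

Lemma wedge1E V l (a : kfun V 1) (b : kfun V l) (v : l.+1.-tuple V) :
  is_form b ->
  wedge a b v = \sum_(i < l.+1) (-1) ^+ i *
    (a [tuple tnth v i] * b [tuple tnth v (lift i r) | r < l]).
Proof.
move=> bF; rewrite /wedge mul1n.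
rewrite (@sum_lift_perm l (fun s => a [tuple tnth v (s (lshift l i)) | i < 1] *
     b [tuple tnth v (s (rshift 1 j)) | j < l])) mulr_sumr.
apply: eq_bigr => i _; rewrite -mulr_sumr mulrCA; congr (_ * _).
set C := (a _ * b _).
transitivity ((l`!)%:R^-1 * \sum_(t : 'S_l) C); last first.
  rewrite sumr_const card_Sn -[C *+ _]mulr_natl mulrA mulVf ?mul1r //.
  by rewrite pnatr_eq0 -lt0n fact_gt0.
congr (_ * _); apply: eq_bigr => t _.
have -> : a [tuple tnth v (lift_perm ord0 i t (lshift l i0)) | i0 < 1]
        = a [tuple tnth v i].
  apply: kfun_eq => r; rewrite tnth_mktuple (ord1 r).
  by rewrite (_ : lshift l ord0 = ord0) ?lift_perm_id //; apply: val_inj.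
have -> : b [tuple tnth v (lift_perm ord0 i t (rshift 1 j)) | j < l]
        = (-1) ^+ t * b [tuple tnth v (lift i r) | r < l].
  rewrite -form_perm //; apply: kfun_eq => r; rewrite !tnth_mktuple.
  by rewrite (_ : rshift 1 r = lift ord0 r) ?lift_perm_lift //; apply: val_inj.
by rewrite mulrCA signrMK.
Qed.

Lemma form_cons_scalar V k (w : kfun V k.+1) (v : k.-tuple V) : is_form w ->
  scalar (fun x => w [tuple of x :: v]).
Proof.
move=> [lin _] c x y; have := lin [tuple of 0 :: v] ord0 c x y.
have E z : set_arg [tuple of 0 :: v] ord0 z = [tuple of z :: v].
  apply: eq_from_tnth => r; rewrite tnth_mktuple.
  by case: (unliftP ord0 r) => [r'|] ->; rewrite ?eqxx // !tnth_consS.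
by rewrite !E.
Qed.

Lemma form_cons_perm V k (w : kfun V k.+1) x (v : k.-tuple V) (t : 'S_k) :
  is_form w ->
  w [tuple of x :: [tuple tnth v (t r) | r < k]] =
  (-1) ^+ t * w [tuple of x :: v].
Proof.
move=> wF.
have -> : (-1) ^+ t = (-1) ^+ lift_perm ord0 ord0 t :> R.
  by rewrite odd_lift_perm.
rewrite -form_perm //; apply: kfun_eq => r; rewrite tnth_mktuple.
case: (unliftP ord0 r) => [r'|] ->; rewrite ?lift_perm_id //.
by rewrite lift_perm_lift !tnth_consS tnth_mktuple.
Qed.

Lemma lie_br_anti (L : lieAlgebra R) (x y : L) : lie_br x y = - lie_br y x.
Proof.
have Dr (a b c : L) : lie_br a (b + c) = lie_br a b + lie_br a c.
  by have := lie_br_linearr a 1 b c; rewrite !scale1r.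
have Dl (a b c : L) : lie_br (b + c) a = lie_br b a + lie_br c a.
  by have := lie_br_linearl a 1 b c; rewrite !scale1r.
have := lie_br_alt (x + y).
rewrite Dl !Dr !lie_br_alt add0r addr0 => /eqP.
by rewrite addr_eq0 => /eqP.
Qed.

Lemma dCE_perm (L : lieAlgebra R) k (w : kfun L k.+1) (v : k.+2.-tuple L) :
  is_form w ->
  dCE w v = - (2 * k`!)%:R^-1 * \sum_(s : 'S_k.+2) (-1) ^+ s *
    w [tuple of lie_br (tnth v (s ord0)) (tnth v (s (lift ord0 ord0))) ::
         [tuple tnth v (s (lift ord0 (lift ord0 r))) | r < k]].
Proof.
move=> wF.
pose G (s : 'S_k.+2) :=
  w [tuple of lie_br (tnth v (s ord0)) (tnth v (s (lift ord0 ord0))) ::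
       [tuple tnth v (s (lift ord0 (lift ord0 r))) | r < k]].
pose P (s : 'S_k.+2) := (s (lift ord0 ord0) < s ord0)%N.
pose i1 : 'I_k.+2 := lift ord0 ord0.
have wN (x : L) (y : k.-tuple L) : w [tuple of - x :: y] = - w [tuple of x :: y].
  have := form_cons_scalar y wF (-1) x 0; have := form_cons_scalar y wF (-1) 0 0.
  rewrite !scaleN1r !mulN1r !addr0 oppr0 addNr => -> ->.
  by rewrite addr0.
have half : \sum_(s : 'S_k.+2) (-1) ^+ s * G s =
            2%:R * \sum_(s : 'S_k.+2 | P s) (-1) ^+ s * G s.
  rewrite (bigID P) /= mulr_natl mulr2n; congr (_ + _).
  rewrite (reindex_inj (mulgI (tperm ord0 i1))) /=.
  apply: eq_big => [s|s _].
    rewrite /P -/i1 !permM tpermL tpermR -leqNgt leq_eqVlt.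
    by rewrite (inj_eq val_inj) (inj_eq perm_inj).
  rewrite odd_mul_tperm signr_addb expr1 mulN1r.
  rewrite /G -/i1 !permM tpermL tpermR lie_br_anti wN mulrNN.
  congr (_ * _); apply: kfun_eq => r.
  case: (unliftP ord0 r) => [r'|] -> //; rewrite !tnth_consS !tnth_mktuple.
  by rewrite permM tpermD.
rewrite [X in _ = _ * X]half mulrA.
transitivity (- (k`!)%:R^-1 * \sum_(s : 'S_k.+2) (-1) ^+ s *
   (if P s then G s else 0)); last first.
  congr (_ * _).
    by rewrite natrM invfM mulNr mulrAC mulVf ?mul1r // pnatr_eq0.
  rewrite [RHS]big_mkcond; apply: eq_bigr => s _.
  by case: ifP => // _; rewrite mulr0.
rewrite sum_lift_perm mulr_sumr; apply: eq_bigr => j _.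
rewrite -mulr_sumr sum_lift_perm big_mkcond !mulr_sumr; apply: eq_bigr => i _.
rewrite -mulr_sumr.
pose C := w [tuple of lie_br (tnth v (lift j i)) (tnth v j) ::
                    [tuple tnth v (lift j (lift i r)) | r < k]].
rewrite (eq_bigr (fun=> if (i < j)%N then - C else 0)); last first.
  move=> u _; rewrite /P /G !lift_perm_lift !lift_perm_id.
  have -> : (lift j i < j)%N = (i < j)%N.
    rewrite /= /bump; case: (leqP j i) => // ji.
    by apply/negbTE; rewrite -leqNgt add1n leqW.
  case: ifP => _; last by rewrite mulr0.
  rewrite lie_br_anti wN mulrN -/C; congr (- _).
  rewrite (_ : w _ = (-1) ^+ u * C) ?signrMK //.
  rewrite -form_cons_perm //; apply: kfun_eq => r.
  case: (unliftP ord0 r) => [r'|] -> //; rewrite !tnth_consS !tnth_mktuple.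
  by rewrite !lift_perm_lift.
rewrite sumr_const card_Sn.
case: ifP => _; last by rewrite mul0rn !mulr0.
have kn0 : (k`!)%:R != 0 :> R by rewrite pnatr_eq0 -lt0n fact_gt0.
by rewrite exprD -/C -[- C *+ _]mulr_natl; field.
Qed.

Lemma dCE1 (L : lieAlgebra R) (a : kfun L 1) (x y : L) : is_form a ->
  dCE a [tuple x; y] = - a [tuple lie_br x y].
Proof.
move=> aF; rewrite /dCE big_ord_recr big_ord1 /= big_pred0 ?add0r //.
rewrite (eq_bigl predT) ?big_ord1 => [|i]; last by rewrite ltn_ord.
rewrite expr1 mulN1r; congr (- _); apply: kfun_eq => r.
by rewrite (ord1 r).
Qed.

(* [dCE] is a graded derivation: with linearity and [dCE1], the Leibniz rule
   for products with a 1-form on the left determines it. *)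
Lemma dCE_wedge (L : lieAlgebra R) l (a : kfun L 1) (b : kfun L l) :
  is_form a -> is_form b ->
  forall v, dCE (wedge a b) v = wedge (dCE a) b v - wedge a (dCE b) v.
Proof.
move=> aF bF v; have abF := form_wedge aF bF.
rewrite (dCE_perm (k := l) v abF).
have fn0 n : (n`!)%:R != 0 :> R by rewrite pnatr_eq0 -lt0n fact_gt0.
pose A (s : 'S_l.+2) :=
  a [tuple lie_br (tnth v (s ord0)) (tnth v (s (lift ord0 ord0)))] *
  b [tuple tnth v (s (lift ord0 (lift ord0 r))) | r < l].
have -> : wedge (dCE a) b v =
          - (2 * l`!)%:R^-1 * \sum_(s : 'S_l.+2) (-1) ^+ s * A s.
  rewrite /wedge mulNr -mulrN -sumrN; congr (_ * _).
  apply: eq_bigr => s _; rewrite -mulrN -mulNr; congr (_ * (_ * _)); last first.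
    apply: kfun_eq => r; rewrite !tnth_mktuple; congr (tnth v (s _)).
    exact: val_inj.
  rewrite -dCE1 //; apply: kfun_eq => r; rewrite tnth_mktuple.
  by case: (unliftP ord0 r) => [r'|] ->; rewrite ?(ord1 r') /=;
    congr (tnth v (s _)); apply: val_inj.
case: l b bF abF v @A => [|l] b bF abF v A.
  have -> : wedge a (dCE b) v = 0.
    by rewrite /wedge big1 ?mulr0 // => s _; rewrite !mulr0.
  rewrite subr0; congr (_ * _); apply: eq_bigr => s _; congr (_ * _).
  rewrite wedge1E // big_ord1 expr0 mul1r /A; congr (_ * _).
  by apply: kfun_eq => -[].
pose B (s : 'S_l.+3) := a [tuple tnth v (s ord0)] *
  b [tuple of lie_br (tnth v (s (lift ord0 ord0)))
                     (tnth v (s (lift ord0 (lift ord0 ord0)))) ::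
    [tuple tnth v (s (lift ord0 (lift ord0 (lift ord0 r)))) | r < l]].
have -> : wedge a (dCE b) v =
          - (2 * l`!)%:R^-1 * \sum_(s : 'S_l.+3) (-1) ^+ s * B s.
  rewrite /wedge mul1n.
  pose B' (t : 'S_l.+2) (s : 'S_l.+3) := B (lift_perm ord0 ord0 t * s)%g.
  transitivity ((l.+2)`!%:R^-1 * \sum_(s : 'S_l.+3) \sum_(t : 'S_l.+2)
     - (2 * l`!)%:R^-1 * ((-1) ^+ (lift_perm ord0 ord0 t * s)%g * B' t s)).
    congr (_ * _); apply: eq_bigr => s _.
    rewrite dCE_perm // -mulr_sumr.
    rewrite [a _ * _]mulrCA [LHS]mulrCA; congr (_ * _); rewrite !mulr_sumr.
    apply: eq_bigr => t _.
    rewrite odd_permM odd_lift_perm addbb addFb signr_addb /B' /B.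
    rewrite [X in _ * X = _]mulrCA [LHS]mulrCA -[RHS]mulrA; congr (_ * (_ * (_ * _))).
      apply: kfun_eq => r; rewrite tnth_mktuple (ord1 r).
      rewrite tnth_cons0 permM lift_perm_id.
      by congr (tnth v (s _)); apply: val_inj.
    apply: kfun_eq => r; case: (unliftP ord0 r) => [r'|] ->.
      rewrite !tnth_consS !tnth_mktuple permM lift_perm_lift.
      by congr (tnth v (s _)); apply: val_inj.
    rewrite !tnth_cons0 !tnth_mktuple !permM !lift_perm_lift.
    by congr (lie_br (tnth v (s _)) (tnth v (s _))); apply: val_inj.
  rewrite exchange_big /=.
  rewrite (eq_bigr (fun=> - (2 * l`!)%:R^-1 *
             \sum_(s : 'S_l.+3) (-1) ^+ s * B s)); last first.
    move=> t _; rewrite -mulr_sumr; congr (_ * _).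
    by rewrite [RHS](reindex_inj (mulgI (lift_perm ord0 ord0 t))).
  by rewrite sumr_const card_Sn -[X in _ * X]mulr_natl mulKf.
pose C (s : 'S_l.+3) := a [tuple tnth v (s (lift ord0 (lift ord0 ord0)))] *
  b [tuple of lie_br (tnth v (s ord0)) (tnth v (s (lift ord0 ord0))) ::
    [tuple tnth v (s (lift ord0 (lift ord0 (lift ord0 r)))) | r < l]].
have BC : \sum_(s : 'S_l.+3) (-1) ^+ s * B s =
          \sum_(s : 'S_l.+3) (-1) ^+ s * C s.
  pose i0 : 'I_l.+3 := ord0; pose i1 : 'I_l.+3 := lift ord0 ord0.
  pose i2 : 'I_l.+3 := lift ord0 (lift ord0 ord0).
  rewrite (reindex_inj (mulgI (tperm i0 i1 * tperm i1 i2)%g)).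
  apply: eq_bigr => s _; rewrite odd_permM odd_permM !odd_tperm /=.
  congr (_ * _); rewrite /B /C -/i0 -/i1 -/i2 !permM.
  have -> : tperm i1 i2 (tperm i0 i1 i0) = i2 by rewrite tpermL tpermL.
  have -> : tperm i1 i2 (tperm i0 i1 i1) = i0 by rewrite tpermR tpermD.
  have -> : tperm i1 i2 (tperm i0 i1 i2) = i1.
    by rewrite [tperm i0 i1 i2]tpermD // tpermR.
  congr (_ * _); apply: kfun_eq => r.
  case: (unliftP ord0 r) => [r'|] -> //; rewrite !tnth_consS !tnth_mktuple.
  by rewrite !permM !tpermD.
rewrite BC; pose c : R := - (2 * (l.+1)`!)%:R^-1.
transitivity (c * (\sum_(s : 'S_l.+3) (-1) ^+ s * A s -
                   l.+1%:R * \sum_(s : 'S_l.+3) (-1) ^+ s * C s)); last first.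
  have mn0 : l.+1%:R != 0 :> R by rewrite pnatr_eq0.
  rewrite /c factS !natrM; move: (l.+1%:R) mn0 (fn0 l) => m mn0 ln0.
  by field; apply/andP.
congr (_ * _).
pose p m : 'S_l.+3 :=
  lift_perm ord0 ord0 (lift_perm ord0 ord0 (lift_perm ord0 m 1%g)).
transitivity (\sum_(s : 'S_l.+3) (-1) ^+ s * A s - \sum_(m < l.+1)
   \sum_(s : 'S_l.+3) (-1) ^+ (p m * s)%g * C (p m * s)%g); last first.
  congr (_ - _); rewrite (eq_bigr (fun=> \sum_(s : 'S_l.+3) (-1) ^+ s * C s)).
    by rewrite sumr_const card_ord mulr_natl.
  by move=> m _; rewrite [RHS](reindex_inj (mulgI (p m))).
rewrite exchange_big -sumrB; apply: eq_bigr => s _.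
rewrite wedge1E // big_ord_recl expr0 mul1r mulrDr; congr (_ * _ + _).
  rewrite /A; congr (_ * _); apply: kfun_eq => r.
  by rewrite !tnth_mktuple tnth_consS !tnth_mktuple.
rewrite mulr_sumr -sumrN; apply: eq_bigr => m _.
have -> : (-1) ^+ (p m * s)%g = (-1) ^+ m * (-1) ^+ s :> R.
  by rewrite odd_permM signr_addb /p !odd_lift_perm odd_perm1 addbF signr_odd.
have -> : (-1) ^+ lift ord0 m = - (-1) ^+ m :> R by rewrite /= exprS mulN1r.
rewrite mulNr mulrN; congr (- _).
rewrite mulrCA mulrA /C !permM !lift_perm_lift !lift_perm_id; congr (_ * (_ * _)).
  apply: kfun_eq => r; rewrite (ord1 r) !tnth_cons0.
  by rewrite tnth_consS tnth_mktuple.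
apply: kfun_eq => r; case: (unliftP ord0 r) => [r'|] ->; last first.
  by rewrite tnth_mktuple.
rewrite tnth_consS !tnth_mktuple !permM !lift_perm_lift perm1.
rewrite (_ : lift (lift ord0 m) (lift ord0 r') = lift ord0 (lift m r')).
  by rewrite tnth_consS tnth_mktuple.
by apply: val_inj; rewrite /= /bump !add1n ltnS addnS.
Qed.

End Calculus.

Section StructureEquations.
Context {R : realType}.

(* The basis f^1, ..., f^7 of (R^7)* dual to the canonical one, numbered
   from 1. *)
Definition cof (i : nat) : kfun 'rV[R]_7 1 :=
  fun v => tnth v ord0 ord0 (inord i.-1).

Definition cof2 (i j : nat) : kfun 'rV[R]_7 2 := wedge (cof i) (cof j).

(* The bracket on R^7 for which d f^k = df_k, that is,
   df_k (x, y) = - f^k [x, y]. *)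
Definition tuple_br (df : 7.-tuple (kfun 'rV[R]_7 2)) (x y : 'rV[R]_7)
    : 'rV[R]_7 :=
  \row_k - tnth df k [tuple x; y].

Definition df_h3R4 : 7.-tuple (kfun 'rV[R]_7 2) :=
  [tuple zero_form; zero_form; zero_form; zero_form; zero_form; zero_form;
         cof2 1 2].

Definition df_n72A : 7.-tuple (kfun 'rV[R]_7 2) :=
  [tuple zero_form; zero_form; zero_form; zero_form; zero_form;
         cof2 1 2; cof2 1 4 \+ cof2 3 5].

Definition df_n72B : 7.-tuple (kfun 'rV[R]_7 2) :=
  [tuple zero_form; zero_form; zero_form; zero_form; zero_form;
         cof2 1 2 \+ cof2 3 4; cof2 1 5 \+ cof2 2 3].

Lemma cof_form i : is_form (cof i).
Proof.
split=> [v r c x y|v r s]; last by rewrite (ord1 r) (ord1 s).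
by rewrite /cof !tnth_mktuple (ord1 r) eqxx !mxE.
Qed.

Lemma cof2_form i j : is_form (cof2 i j).
Proof. by apply: (@form_wedge _ _ 1 1); apply: cof_form. Qed.

Lemma cof2E i j (x y : 'rV[R]_7) :
  cof2 i j [tuple x; y] =
  x ord0 (inord i.-1) * y ord0 (inord j.-1) -
  y ord0 (inord i.-1) * x ord0 (inord j.-1).
Proof.
rewrite /cof2 wedge1E; last exact: cof_form.
rewrite big_ord_recl big_ord1 expr0 mul1r expr1 mulN1r; congr (_ - _).
  by rewrite /cof tnth_mktuple.
by rewrite /cof tnth_mktuple.
Qed.

Lemma form0 (V : vectType R) k : is_form (@zero_form R V k).
Proof. by split=> // v i c x y; rewrite /zero_form mulr0 addr0. Qed.

Lemma formD (V : vectType R) k (a b : kfun V k) :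
  is_form a -> is_form b -> is_form (a \+ b).
Proof.
move=> [alin aalt] [blin balt]; split=> [v i c x y|v i j ij vij] /=.
  by rewrite alin blin mulrDr addrACA.
by rewrite (aalt _ i j) ?(balt _ i j) ?addr0.
Qed.

Section TupleLieAlgebra.
Variable df : 7.-tuple (kfun 'rV[R]_7 2).
Hypothesis dfF : forall k, is_form (tnth df k).
Hypothesis df2 : forall x y z, tuple_br df (tuple_br df x y) z = 0.

Let brl y : linear (fun x => tuple_br df x y).
Proof.
move=> c x z; apply/rowP => k; rewrite !mxE.
have E u : [tuple u; y] = [tuple of u :: [tuple y]] by exact: val_inj.
by rewrite !E (form_cons_scalar _ (dfF k)) opprD mulrN.
Qed.

Let bra x : tuple_br df x x = 0.
Proof.
apply/rowP => k; rewrite !mxE; have [_ alt] := dfF k.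
by rewrite (alt _ ord0 (lift ord0 ord0)) ?oppr0.
Qed.

Let brs x y : tuple_br df x y = - tuple_br df y x.
Proof.
apply/rowP => k; rewrite !mxE; congr (- _).
rewrite -(@form_swap _ _ _ _ _ ord0 (lift ord0 ord0) (dfF k)) //.
apply: kfun_eq => r; rewrite tnth_mktuple.
case: (unliftP ord0 r) => [r'|] ->; last by rewrite tpermL.
by rewrite (ord1 r') tpermR.
Qed.

Let brr x : linear (tuple_br df x).
Proof. by move=> c y z; rewrite brs brl opprD -scalerN -!brs. Qed.

Let brj x y z : tuple_br df x (tuple_br df y z) +
  tuple_br df y (tuple_br df z x) + tuple_br df z (tuple_br df x y) = 0.
Proof.
by rewrite (brs x (tuple_br df y z)) (brs y (tuple_br df z x))
  (brs z (tuple_br df x y)) !df2 !oppr0 !addr0.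
Qed.

Definition tuple_lieAlgebra : lieAlgebra R :=
  @LieAlgebra R 'rV[R]_7 (tuple_br df) brl brr bra brj.

End TupleLieAlgebra.

Lemma tuple_br_low df (x y : 'rV[R]_7) :
  (forall k : 'I_7, (k < 5)%N -> tnth df k = zero_form) ->
  forall i, (0 < i < 6)%N -> tuple_br df x y ord0 (inord i.-1) = 0.
Proof.
move=> df0 [//|i] /= i5; rewrite mxE df0 ?oppr0 //.
by rewrite inordK //; apply: leq_trans (i5 : (i < 5)%N) _.
Qed.

Lemma cof2_low i j (x y : 'rV[R]_7) :
  x ord0 (inord i.-1) = 0 -> x ord0 (inord j.-1) = 0 ->
  cof2 i j [tuple x; y] = 0.
Proof. by move=> xi xj; rewrite cof2E xi xj mul0r mulr0 subrr. Qed.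

Ltac tuple_forms :=
  let k := fresh in intros k; destruct k as [k ?];
  do 7! [destruct k as [|k];
    first by rewrite /tnth /=; repeat (apply: formD || apply: form0 || apply: cof2_form)]; by [].

Ltac tuple_2step :=
  let x := fresh in let y := fresh in let z := fresh in let k := fresh in
  intros x y z; apply/rowP; intros k; rewrite mxE [RHS]mxE; destruct k as [k ?];
  do 7! [destruct k as [|k];
    first by rewrite [tnth _ _]/tnth /= ?oppr0 // !cof2_low ?addr0 ?oppr0 //;
      apply: tuple_br_low => // -[[|[|[|[|[|?]]]]] ?]]; by [].

Lemma df_h3R4_form k : is_form (tnth df_h3R4 k).
Proof. by move: k; tuple_forms. Qed.

Lemma df_n72A_form k : is_form (tnth df_n72A k).
Proof. by move: k; tuple_forms. Qed.

Lemma df_n72B_form k : is_form (tnth df_n72B k).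
Proof. by move: k; tuple_forms. Qed.

Lemma df_h3R4_2step x y z : tuple_br df_h3R4 (tuple_br df_h3R4 x y) z = 0.
Proof. by move: x y z; tuple_2step. Qed.

Lemma df_n72A_2step x y z : tuple_br df_n72A (tuple_br df_n72A x y) z = 0.
Proof. by move: x y z; tuple_2step. Qed.

Lemma df_n72B_2step x y z : tuple_br df_n72B (tuple_br df_n72B x y) z = 0.
Proof. by move: x y z; tuple_2step. Qed.

Definition h3R4 : lieAlgebra R := tuple_lieAlgebra df_h3R4_form df_h3R4_2step.
Definition n72A : lieAlgebra R := tuple_lieAlgebra df_n72A_form df_n72A_2step.
Definition n72B : lieAlgebra R := tuple_lieAlgebra df_n72B_form df_n72B_2step.

End StructureEquations.

Arguments h3R4 R : clear implicits.
Arguments n72A R : clear implicits.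
Arguments n72B R : clear implicits.

(* Main.v *)
(* Existence. In a basis [e] adapted to [phi], the structure is the standard form
   [phi0 e]. If e_5, e_6, e_7 are central and span a space containing the
   brackets, then d*phi = 0 and dphi /\ phi = 0 say that the 3 x 3 matrix obtained
   by contracting the bracket with the self-dual 2-forms on <e_1, ..., e_4> is
   symmetric and traceless. If the derived algebra n' has dimension at least 2
   and lies in a central 3-space, a suitable choice of e_1, ..., e_4 achieves this.
   If dim n' = 1, then n is given by a skew form, whose rank is 2 (h_3 + R^4), 4
   (same construction) or 6 (an explicit basis). If dim n' = 2 is the whole
   centre, the bracket is a pencil of skew forms on a 5-space with no common
   radical, whose Kronecker normal form is that of n_{7,2,A} or n_{7,2,B}.

   Non-existence. On n_{7,2,A} and n_{7,2,B}, closedness of psi = *phi forces the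
   2-form psi(., ., e_6, e_7) to have rank at most 2, and then a contraction of
   phi has a 5-dimensional isotropic subspace, against positivity of the metric.
   On h_3 + R^4, with n' = <z>, dpsi = 0 makes phi(p, q, .) a multiple of the
   metric dual of z, where p and q span the orthogonal complement of the centre;
   then dphi /\ phi is a nonzero multiple of the Pfaffian of the contraction of
   phi with z on the remaining four directions, which cannot vanish. *)
Require Import Defs.
From HB Require Import structures.
From mathcomp Require Import all_boot all_order all_fingroup all_algebra.
From mathcomp Require Import reals.
From mathcomp Require Import ring lra.

Set Implicit Arguments.
Unset Strict Implicit.
Unset Printing Implicit Defensive.

Import Order.TTheory GRing.Theory Num.Theory.
Local Open Scope ring_scope.

(** * Wedge products as sums over shuffles *)

(** No metric is given in advance: any basis may be declared orthonormal, so a construction is only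
    a choice of basis, and the freedom in the three central vectors z is what gets used. The
    contracted brackets must equal M z with M symmetric and traceless. Such an M is diagonalisable
    with trace 0, so it has rank 0, 2 or 3 but never 1, and the contracted brackets must not span
    exactly a line. For dim n' >= 2 one therefore looks for e_1, ..., e_4 with two independent
    contractions. For dim n' = 1 all contractions must vanish, so the bracket form must be
    anti-self-dual, which is possible in rank 4 and impossible in rank 2. In rank 6 the centre is a
    line, so a 6 + 1 splitting replaces the 4 + 3 one. The wedge product is defined as a sum over
    all permutations, 5040 of them in degree 7. It is replaced by a recursive sum over shuffles that
    computes on sequences of indices, and identities between forms are then checked on the
    increasing tuples of a single basis. *)

Section Shuffles.
Context {R : realType}.

(** Signed sum over the ways to deal [s] into a word of length [k] for [A] and one of length [l] for
    [B]. An element given to [B] jumps over the [k] arguments still due to [A], whence the sign. *)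
Fixpoint shuffle (T : Type) (s : seq T) k l (A B : seq T -> R) : R :=
  match s with
  | [::] => A [::] * B [::]
  | x :: s' =>
      (if k is k'.+1 then shuffle s' k' l (fun t => A (x :: t)) B else 0) +
      (if l is l'.+1 then (-1) ^+ k * shuffle s' k l' A (fun t => B (x :: t))
       else 0)
  end.

Lemma eq_shuffle (T : Type) (s : seq T) k l A A' B B' :
  (forall t, size t = k -> A t = A' t) -> (forall t, size t = l -> B t = B' t) ->
  size s = (k + l)%N -> shuffle s k l A B = shuffle s k l A' B'.
Proof.
elim: s k l A A' B B' => [|x s IH] [|k] [|l] A A' B B' eA eB //=.
- by rewrite eA ?eB.
- by move=> [sl]; rewrite !add0r; congr (_ * _); apply: IH => // t tl; rewrite eB /= ?tl.
- by move=> [sk]; rewrite !addr0; apply: IH => // t tk; rewrite eA /= ?tk.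
move=> [skl]; congr (_ + _ * _); apply: IH; rewrite ?skl ?addSnnS // => t tk.
  by rewrite eA /= ?tk.
by rewrite eB /= ?tk.
Qed.

Lemma shuffle_map (T U : Type) (f : T -> U) (s : seq T) k l A B :
  shuffle [seq f x | x <- s] k l A B =
  shuffle s k l (fun t => A [seq f x | x <- t]) (fun t => B [seq f x | x <- t]).
Proof.
elim: s k l A B => //= x s IH k l A B.
by congr (_ + _); [case: k | case: l] => // m; rewrite IH.
Qed.

End Shuffles.

Section SequenceArguments.
Context {R : realType} {V : vectType R}.
Implicit Types (x y : V).

(** Arguments come from a plain sequence, which avoids casts between tuple lengths. Missing entries
    read as 0 and surplus ones are ignored. *)
Definition evs k (w : kfun V k) (s : seq V) : R := w [tuple nth 0 s i | i < k].

Lemma evs_tuple k (w : kfun V k) (v : k.-tuple V) : evs w v = w v.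
Proof. by apply: kfun_eq => i; rewrite tnth_mktuple (tnth_nth 0). Qed.

Lemma evs_contract k x (w : kfun V k.+1) (s : seq V) :
  evs (contract x w) s = evs w (x :: s).
Proof.
rewrite /evs /contract; apply: kfun_eq => i; rewrite tnth_mktuple.
by case: (unliftP ord0 i) => [j|] ->; rewrite ?tnth_consS ?tnth_mktuple.
Qed.

Lemma form_contract k x (w : kfun V k.+1) :
  is_form w -> is_form (contract x w).
Proof.
move=> [lin alt]; split=> [v i c y z|v i j ij vij]; rewrite /contract.
  have E t : [tuple of x :: set_arg v i t] =
             set_arg [tuple of x :: v] (lift ord0 i) t.
    apply: eq_from_tnth => r; rewrite tnth_mktuple.
    case: (unliftP ord0 r) => [r'|] ->.
      by rewrite !tnth_consS tnth_mktuple (inj_eq (@lift_inj _ _)).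
    by rewrite (negPf (neq_lift _ _)).
  by rewrite !E lin.
by rewrite (alt _ (lift ord0 i) (lift ord0 j)) ?(inj_eq (@lift_inj _ _)) //
  !tnth_consS.
Qed.

Lemma form_move_front k (w : kfun V k.+1) (v : k.+1.-tuple V) (i : 'I_k.+1) :
  is_form w ->
  w v = (-1) ^+ i *
        w [tuple of tnth v i :: [tuple tnth v (lift i r) | r < k]].
Proof.
move=> wF; pose t : 'S_k.+1 := lift_perm ord0 i 1%g.
have -> : [tuple of tnth v i :: [tuple tnth v (lift i r) | r < k]] =
          [tuple tnth v (t r) | r < k.+1].
  apply: eq_from_tnth => r; rewrite tnth_mktuple /t.
  case: (unliftP ord0 r) => [r'|] ->.
    by rewrite tnth_consS tnth_mktuple lift_perm_lift perm1.
  by rewrite lift_perm_id.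
rewrite form_perm // /t odd_lift_perm odd_perm1 addbF /= signr_odd.
by rewrite mulrA -expr2 sqrr_sign mul1r.
Qed.

(* [wedge] with the total degree [n] freed from the shape [k + l], so that
   both degrees can decrease in a recursion. *)
Definition wedge_at k l n (e : (k + l)%N = n) (a : kfun V k) (b : kfun V l) :
    kfun V n := fun v =>
  (k`! * l`!)%:R^-1 * \sum_(s : 'S_n) (-1) ^+ s *
    (a [tuple tnth v (s (cast_ord e (lshift l i))) | i < k] *
     b [tuple tnth v (s (cast_ord e (rshift k j))) | j < l]).

Lemma wedge_atE k l (a : kfun V k) (b : kfun V l) :
  wedge a b = wedge_at erefl a b.
Proof.
rewrite /wedge /wedge_at.
apply: boolp.funext => v; congr (_ * _); apply: eq_bigr => s _.
by congr (_ * (_ * _)); apply: kfun_eq => r; rewrite !tnth_mktuple cast_ord_id.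
Qed.

(** [sum_lift_perm] sorts permutations by the image of 0. Passing to inverses sorts them by the
    preimage of 0, that is, by the slot that receives the first vector. *)
Lemma sum_lift_permV n (G : 'S_n.+1 -> R) :
  \sum_(s : 'S_n.+1) (-1) ^+ s * G s =
  \sum_(j < n.+1) \sum_(t : 'S_n)
     (-1) ^+ j * ((-1) ^+ t * G (lift_perm j ord0 t)).
Proof.
rewrite (reindex_inj invg_inj) /=.
under eq_bigr do rewrite odd_permV.
rewrite (sum_lift_perm (fun s => G s^-1%g)); apply: eq_bigr => j _.
rewrite (reindex_inj invg_inj) /=; apply: eq_bigr => t _.
by rewrite odd_permV lift_permV invgK.
Qed.

Let nzf n : (n`!)%:R != 0 :> R.
Proof. by rewrite pnatr_eq0 -lt0n fact_gt0. Qed.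

Lemma wedge_at_cons k l n (e : (k + l)%N = n.+1) (a : kfun V k) (b : kfun V l)
    (v : n.-tuple V) x : is_form a -> is_form b ->
  wedge_at e a b [tuple of x :: v] =
  (k`! * l`!)%:R^-1 * \sum_(i < k) \sum_(t : 'S_n) (-1) ^+ (i + t) *
    (a [tuple tnth [tuple of x :: v] (lift_perm (cast_ord e (lshift l i)) ord0 t
          (cast_ord e (lshift l r))) | r < k] *
     b [tuple tnth [tuple of x :: v] (lift_perm (cast_ord e (lshift l i)) ord0 t
          (cast_ord e (rshift k r))) | r < l]) +
  (k`! * l`!)%:R^-1 * \sum_(i < l) \sum_(t : 'S_n) (-1) ^+ (k + i + t) *
    (a [tuple tnth [tuple of x :: v] (lift_perm (cast_ord e (rshift k i)) ord0 t
          (cast_ord e (lshift l r))) | r < k] *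
     b [tuple tnth [tuple of x :: v] (lift_perm (cast_ord e (rshift k i)) ord0 t
          (cast_ord e (rshift k r))) | r < l]).
Proof.
move=> aF bF; rewrite /wedge_at -mulrDr; congr (_ * _).
pose G s := a [tuple tnth [tuple of x :: v] (s (cast_ord e (lshift l r))) | r < k]
   * b [tuple tnth [tuple of x :: v] (s (cast_ord e (rshift k r))) | r < l].
rewrite (sum_lift_permV G).
rewrite (reindex (cast_ord e)) /=; last first.
  by apply: onW_bij; exists (cast_ord (esym e)) => i;
    rewrite ?cast_ordK ?cast_ordKV.
rewrite big_split_ord /=; congr (_ + _); apply: eq_bigr => i _;
  apply: eq_bigr => t _; by rewrite /G [in RHS]exprD -!mulrA.
Qed.

(** All slots of [a] contribute the same sum: moving [x] to the front of [a] costs [(-1) ^+ i],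
    which cancels the sign of [lift_perm]. The resulting factor k + 1 is absorbed by the
    factorial. *)
Lemma wedge_at_contractl k l n (e : (k.+1 + l)%N = n.+1)
    (e' : (k + l)%N = n) (a : kfun V k.+1) (b : kfun V l) (v : n.-tuple V) x :
  is_form a -> is_form b ->
  (k.+1`! * l`!)%:R^-1 * \sum_(i < k.+1) \sum_(t : 'S_n) (-1) ^+ (i + t) *
    (a [tuple tnth [tuple of x :: v] (lift_perm (cast_ord e (lshift l i)) ord0 t
          (cast_ord e (lshift l r))) | r < k.+1] *
     b [tuple tnth [tuple of x :: v] (lift_perm (cast_ord e (lshift l i)) ord0 t
          (cast_ord e (rshift k.+1 r))) | r < l]) =
  wedge_at e' (contract x a) b v.
Proof.
move=> aF bF; rewrite /wedge_at.
set S := \sum_(s : 'S_n) _.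
rewrite (eq_bigr (fun=> S)); last first.
  move=> i _; apply: eq_bigr => t _.
  rewrite (form_move_front _ i aF) exprD -!mulrA mulrCA; congr (_ * _).
  rewrite signrMK; congr (_ * _).
    rewrite /contract; apply: kfun_eq => r.
    case: (unliftP ord0 r) => [r'|] ->.
      rewrite !tnth_consS !tnth_mktuple.
      have -> : cast_ord e (lshift l (lift i r')) =
        lift (cast_ord e (lshift l i)) (cast_ord e' (lshift l r')).
        exact: val_inj.
      by rewrite lift_perm_lift tnth_consS.
    by rewrite !tnth_cons0 tnth_mktuple lift_perm_id.
  apply: kfun_eq => r; rewrite !tnth_mktuple.
  have -> : cast_ord e (rshift k.+1 r) =
    lift (cast_ord e (lshift l i)) (cast_ord e' (rshift k r)).
    have ik : (i <= k)%N by rewrite -ltnS.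
    by apply: val_inj; rewrite /= /bump (leq_trans ik (leq_addr _ _)).
  by rewrite lift_perm_lift tnth_consS.
rewrite sumr_const card_ord -[S *+ _]mulr_natl mulrA; congr (_ * _).
rewrite factS !natrM; move: (nzf k) (nzf l) => h1 h2.
have h3 : k.+1%:R != 0 :> R by rewrite pnatr_eq0.
by move: (k.+1%:R) h3 => m h3; field; rewrite h1 h2 h3.
Qed.

Lemma wedge_at_contractr k l n (e : (k + l.+1)%N = n.+1)
    (e' : (k + l)%N = n) (a : kfun V k) (b : kfun V l.+1) (v : n.-tuple V) x :
  is_form a -> is_form b ->
  (k`! * l.+1`!)%:R^-1 * \sum_(i < l.+1) \sum_(t : 'S_n) (-1) ^+ (k + i + t) *
    (a [tuple tnth [tuple of x :: v] (lift_perm (cast_ord e (rshift k i)) ord0 t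
          (cast_ord e (lshift l.+1 r))) | r < k] *
     b [tuple tnth [tuple of x :: v] (lift_perm (cast_ord e (rshift k i)) ord0 t
          (cast_ord e (rshift k r))) | r < l.+1]) =
  (-1) ^+ k * wedge_at e' a (contract x b) v.
Proof.
move=> aF bF; rewrite /wedge_at mulrCA.
set S := \sum_(s : 'S_n) _.
rewrite (eq_bigr (fun=> (-1) ^+ k * S)); last first.
  move=> i _; rewrite mulr_sumr; apply: eq_bigr => t _.
  rewrite (form_move_front _ i bF) !exprD -!mulrA; congr (_ * _).
  rewrite mulrCA; congr (_ * _).
  rewrite [X in _ * X]mulrCA signrMK; congr (_ * _).
    apply: kfun_eq => r; rewrite !tnth_mktuple.
    have -> : cast_ord e (lshift l.+1 r) =
      lift (cast_ord e (rshift k i)) (cast_ord e' (lshift l r)).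
      apply: val_inj; rewrite /= /bump leqNgt.
      by rewrite (leq_trans (ltn_ord r) (leq_addr _ _)).
    by rewrite lift_perm_lift tnth_consS.
  rewrite /contract; apply: kfun_eq => r.
  case: (unliftP ord0 r) => [r'|] ->.
    rewrite !tnth_consS !tnth_mktuple.
    have -> : cast_ord e (rshift k (lift i r')) =
      lift (cast_ord e (rshift k i)) (cast_ord e' (rshift k r')).
      by apply: val_inj; rewrite /= /bump leq_add2l addnCA.
    by rewrite lift_perm_lift tnth_consS.
  by rewrite !tnth_cons0 tnth_mktuple lift_perm_id.
rewrite sumr_const card_ord -[_ *+ l.+1]mulr_natl [_ * ((-1) ^+ k * S)]mulrCA.
rewrite [RHS]mulrCA [LHS]mulrCA; congr (_ * _); rewrite mulrA; congr (_ * _).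
rewrite factS !natrM; move: (nzf k) (nzf l) => h1 h2.
have h3 : l.+1%:R != 0 :> R by rewrite pnatr_eq0.
by move: (l.+1%:R) h3 => m h3; field; rewrite h1 h2 h3.
Qed.

(** Contraction with the first vector is an antiderivation, and this Leibniz rule is exactly the
    recursion of [shuffle]. *)
Lemma wedge_at_shuffle k l n (e : (k + l)%N = n) (a : kfun V k) (b : kfun V l)
    (v : n.-tuple V) : is_form a -> is_form b ->
  wedge_at e a b v = shuffle v k l (evs a) (evs b).
Proof.
elim: n k l e a b v => [|n IH] k l e a b v aF bF.
  case: k l e a b aF bF => [|//] [|//] e a b aF bF.
  rewrite (tuple0 v) /= /wedge_at mul1n fact0 invr1 mul1r.
  rewrite (bigD1 1%g) //= big1 ?addr0 => [|s]; last first.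
    by case/eqP; apply/permP => -[].
  by rewrite odd_perm1 expr0 mul1r; congr (_ * _); apply: kfun_eq => -[].
case/tupleP: v => x v; rewrite wedge_at_cons //=; congr (_ + _).
  case: k e a aF => [|k] e a aF; first by rewrite big_ord0 mulr0.
  have e' : (k + l)%N = n by case: e.
  rewrite (wedge_at_contractl e e') // IH //; last exact: form_contract.
  by apply: eq_shuffle; rewrite ?size_tuple // => t _; rewrite evs_contract.
case: l e b bF => [|l] e b bF; first by rewrite big_ord0 mulr0.
have e' : (k + l)%N = n by move: (e); rewrite addnS => -[].
rewrite (wedge_at_contractr e e') // IH //; last exact: form_contract.
congr (_ * _); apply: eq_shuffle; rewrite ?size_tuple // => t _.
exact: evs_contract.
Qed.

Lemma wedge_shuffle k l (a : kfun V k) (b : kfun V l) (s : seq V) :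
  is_form a -> is_form b -> size s = (k + l)%N ->
  evs (wedge a b) s = shuffle s k l (evs a) (evs b).
Proof.
move=> aF bF ss.
have -> : s = tval (tcast ss (in_tuple s)) by rewrite val_tcast.
by rewrite evs_tuple wedge_atE wedge_at_shuffle.
Qed.

Lemma wedge_shuffle_map (T : Type) (f : T -> V) k l (a : kfun V k)
    (b : kfun V l) A B s :
  is_form a -> is_form b ->
  (forall t, size t = k -> evs a [seq f i | i <- t] = A t) ->
  (forall t, size t = l -> evs b [seq f i | i <- t] = B t) ->
  size s = (k + l)%N -> evs (wedge a b) [seq f i | i <- s] = shuffle s k l A B.
Proof.
move=> aF bF aA bB skl; rewrite wedge_shuffle ?size_map // shuffle_map.
exact: eq_shuffle.
Qed.

Lemma wedge_shuffle_basis k l n (e : n.-tuple V) (a : kfun V k) (b : kfun V l) A B :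
  is_form a -> is_form b ->
  (forall t, size t = k -> evs a [seq e`_i | i <- t] = A t) ->
  (forall t, size t = l -> evs b [seq e`_i | i <- t] = B t) ->
  n = (k + l)%N -> evs (wedge a b) e = shuffle (iota 0 n) k l A B.
Proof.
move=> aF bF aA bB nkl.
rewrite -(wedge_shuffle_map aF bF aA bB) ?size_iota // -[n in iota 0 n](size_tuple e).
by rewrite map_nth_iota0 // take_size.
Qed.

Lemma evs_scalar k (w : kfun V k.+1) (s : seq V) :
  is_form w -> scalar (fun x => evs w (x :: s)).
Proof.
move=> wF c x y; rewrite -!evs_contract /evs /contract.
exact: form_cons_scalar.
Qed.

Section HeadArgument.
Variables (k : nat) (w : kfun V k.+1) (s : seq V).
Hypothesis wF : is_form w.

Lemma evs0 : evs w (0 :: s) = 0.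
Proof.
have /eqP := evs_scalar s wF 1 0 0; rewrite scaler0 addr0 mul1r.
by rewrite -subr_eq0 opprD addrA subrr sub0r oppr_eq0 => /eqP.
Qed.

Lemma evsD x y : evs w (x + y :: s) = evs w (x :: s) + evs w (y :: s).
Proof. by have := evs_scalar s wF 1 x y; rewrite scale1r mul1r. Qed.

Lemma evsZ c x : evs w (c *: x :: s) = c * evs w (x :: s).
Proof. by have := evs_scalar s wF c x 0; rewrite evs0 !addr0. Qed.

Lemma evsN x : evs w (- x :: s) = - evs w (x :: s).
Proof. by rewrite -scaleN1r evsZ mulN1r. Qed.

Lemma evs_sum I (r : seq I) (P : pred I) (F : I -> V) :
  evs w (\sum_(i <- r | P i) F i :: s) = \sum_(i <- r | P i) evs w (F i :: s).
Proof.
apply: (big_morph (fun x => evs w (x :: s))) => [x y|]; [exact: evsD|exact: evs0].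
Qed.

End HeadArgument.

Lemma evs_swap k (w : kfun V k.+2) x y (s : seq V) : is_form w ->
  evs w (x :: y :: s) = - evs w (y :: x :: s).
Proof.
move=> wF; rewrite -(@form_swap _ _ _ w _ ord0 (lift ord0 ord0) wF) //.
apply: kfun_eq => r; rewrite !tnth_mktuple.
case: tpermP => [->|->|] //; case: r => [[|[|r]] lt_r] // ne0 ne1.
  by case: ne0; apply: val_inj.
by case: ne1; apply: val_inj.
Qed.

Lemma evs_alt k (w : kfun V k.+2) x (s : seq V) : is_form w ->
  evs w (x :: x :: s) = 0.
Proof.
by move=> [_ alt]; rewrite /evs (alt _ ord0 (lift ord0 ord0)) // !tnth_mktuple.
Qed.

Lemma formZ k c (w : kfun V k) : is_form w -> is_form (fun v => c * w v).
Proof.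
move=> [lin alt]; split=> [v i d x y|v i j ij vij].
  by rewrite lin mulrDr mulrCA.
by rewrite (alt _ i j) // mulr0.
Qed.

(** Together with [dCE_perm] this shows that [dCE] preserves forms: [dCE w] alternates the map
    sending x_0, x_1, ... to w([x_0, x_1], x_2, ...), which is multilinear but not alternating. *)
Lemma form_alternation k (G : kfun V k) c :
  (forall v i, scalar (fun x => G (set_arg v i x))) ->
  is_form (fun v => c * \sum_(s : 'S_k) (-1) ^+ s *
                      G [tuple tnth v (s i) | i < k]).
Proof.
move=> lin; apply: formZ; split=> [v i d x y|v i j ij vij].
  rewrite mulr_sumr -big_split /=; apply: eq_bigr => s _.
  have E z : [tuple tnth (set_arg v i z) (s r) | r < k] =
             set_arg [tuple tnth v (s r) | r < k] (s^-1%g i) z.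
    apply: eq_from_tnth => r; rewrite !tnth_mktuple.
    by rewrite -(inj_eq (@perm_inj _ s) r) permKV.
  by rewrite !E lin mulrDr mulrCA.
set S := \sum_s _.
have E : S = - S.
  rewrite [LHS](reindex_inj (mulIg (tperm i j))) -sumrN.
  apply: eq_bigr => s _; rewrite odd_permM odd_tperm ij addbT.
  rewrite signrN mulNr; congr (- (_ * _)).
  apply: kfun_eq => r; rewrite !tnth_mktuple permM.
  by case: tpermP => [->|->|].
by move/eqP: E; rewrite -addr_eq0 -mulr2n mulrn_eq0 => /eqP.
Qed.

Lemma form_eq0_ext n (e : n.-tuple V) k (w : kfun V k) :
  basis_of fullv e -> is_form w ->
  (forall f : k.-tuple 'I_n, w [tuple tnth e (tnth f i) | i < k] = 0) ->
  forall v, w v = 0.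
Proof.
move=> eB; elim: k w => [|k IH] w wF w0 v.
  by rewrite -(w0 [tuple]) (tuple0 v); congr (w _); rewrite [RHS]tuple0.
case/tupleP: v => x v; rewrite -evs_tuple /=.
rewrite (coord_basis eB (memvf x)) evs_sum // big1 // => i _.
rewrite evsZ // -evs_contract evs_tuple IH ?mulr0 // => [|f].
  exact: form_contract.
rewrite -(w0 [tuple of i :: f]) /contract; apply: kfun_eq => r; rewrite tnth_mktuple.
case: (unliftP ord0 r) => [r'|] ->; last by rewrite !tnth_cons0 (tnth_nth 0).
by rewrite !tnth_consS tnth_mktuple.
Qed.

Lemma form_eq0 n (e : n.-tuple V) k (w : kfun V k) :
  basis_of fullv e -> is_form w ->
  (forall s : seq nat, sorted ltn s -> all (gtn n) s -> size s = k ->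
     evs w [seq e`_i | i <- s] = 0) ->
  forall v, w v = 0.
Proof.
move=> eB wF w0; apply: (form_eq0_ext eB wF) => f.
(* Sorting distinct indices only changes the sign; a repeated index gives 0. *)
case: (boolP (uniq f)) => [fU|].
  pose s := map_tuple val f; pose t := sort_tuple leq s.
  have st : perm_eq s t by rewrite perm_sym perm_sort.
  case/tuple_permP: st => p sp.
  have -> : [tuple tnth e (tnth f i) | i < k] =
            [tuple tnth (map_tuple (nth 0 e) t) (p i) | i < k].
    apply: eq_from_tnth => i; rewrite !tnth_mktuple tnth_map.
    have -> : tnth t (p i) = tnth s i.
      by rewrite (tnth_nth 0%N s) sp -tnth_nth tnth_mktuple.
    by rewrite tnth_map -tnth_nth.
  rewrite form_perm // -(evs_tuple w) w0 ?mulr0 ?size_tuple //.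
    rewrite ltn_sorted_uniq_leq sort_uniq sort_sorted; last exact: leq_total.
    by rewrite map_inj_uniq ?fU //; apply: val_inj.
  by rewrite all_sort all_map; apply/allP => i _ /=.
case Ef: (val f) => [//|x0 f']; rewrite -{}Ef => /(uniqPn x0)[i [j [ij]]].
rewrite size_tuple => jk eij.
have [_ alt] := wF.
apply: (alt _ (Ordinal (ltn_trans ij jk)) (Ordinal jk)).
  by rewrite -val_eqE /= ltn_eqF.
rewrite !tnth_mktuple; congr (tnth e _).
by rewrite !(tnth_nth x0).
Qed.

End SequenceArguments.

(** * The Chevalley-Eilenberg differential on explicit arguments *)

Section Differential.
Context {R : realType}.
Implicit Type L : lieAlgebra R.

Lemma lie_brDl L (x y z : L) : lie_br (x + y) z = lie_br x z + lie_br y z.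
Proof. by have := lie_br_linearl z 1 x y; rewrite !scale1r. Qed.

Lemma lie_brDr L (x y z : L) : lie_br z (x + y) = lie_br z x + lie_br z y.
Proof. by have := lie_br_linearr z 1 x y; rewrite !scale1r. Qed.

Lemma lie_br0l L (x : L) : lie_br 0 x = 0.
Proof.
by apply: (addrI (lie_br 0 x)); rewrite -lie_brDl !addr0.
Qed.

Lemma lie_br0r L (x : L) : lie_br x 0 = 0.
Proof. by rewrite lie_br_anti lie_br0l oppr0. Qed.

Lemma lie_brZl L c (x y : L) : lie_br (c *: x) y = c *: lie_br x y.
Proof. by have := lie_br_linearl y c x 0; rewrite lie_br0l !addr0. Qed.

Lemma lie_brZr L c (x y : L) : lie_br x (c *: y) = c *: lie_br x y.
Proof. by have := lie_br_linearr x c y 0; rewrite lie_br0r !addr0. Qed.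

Lemma form_dCE L k (w : kfun L k) : is_form w -> is_form (dCE w).
Proof.
case: k w => [|k] w wF; first exact: form0.
pose G (u : k.+2.-tuple L) :=
  w [tuple of lie_br (tnth u ord0) (tnth u (lift ord0 ord0)) ::
     [tuple tnth u (lift ord0 (lift ord0 r)) | r < k]].
have -> : dCE w = fun v => - (2 * k`!)%:R^-1 * \sum_(s : 'S_k.+2) (-1) ^+ s *
                      G [tuple tnth v (s i) | i < k.+2].
  apply: boolp.funext => v; rewrite dCE_perm //; congr (_ * _).
  apply: eq_bigr => s _; congr (_ * _); rewrite /G; apply: kfun_eq => r.
  case: (unliftP ord0 r) => [r'|] ->; last by rewrite !tnth_cons0 !tnth_mktuple.
  by rewrite !tnth_consS !tnth_mktuple.
apply: form_alternation => u i c x y.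
case: (unliftP ord0 i) => [j|] -> {i}; last first.
  have E z : G (set_arg u ord0 z) =
    w [tuple of lie_br z (tnth u (lift ord0 ord0)) ::
       [tuple tnth u (lift ord0 (lift ord0 r)) | r < k]].
    rewrite /G; apply: kfun_eq => r.
    case: (unliftP ord0 r) => [r'|] ->; rewrite ?tnth_cons0 ?tnth_consS.
      by rewrite !tnth_mktuple.
    by rewrite !tnth_mktuple.
  by rewrite !E lie_brDl lie_brZl (form_cons_scalar _ wF).
case: (unliftP ord0 j) => [i|] -> {j}; last first.
  have E z : G (set_arg u (lift ord0 ord0) z) =
    w [tuple of lie_br (tnth u ord0) z ::
       [tuple tnth u (lift ord0 (lift ord0 r)) | r < k]].
    rewrite /G; apply: kfun_eq => r.
    case: (unliftP ord0 r) => [r'|] ->; rewrite ?tnth_cons0 ?tnth_consS.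
      by rewrite !tnth_mktuple.
    by rewrite !tnth_mktuple.
  by rewrite !E lie_brDr lie_brZr (form_cons_scalar _ wF).
pose b := lie_br (tnth u ord0) (tnth u (lift ord0 ord0)).
have E z : G (set_arg u (lift ord0 (lift ord0 i)) z) =
  w (set_arg [tuple of b :: [tuple tnth u (lift ord0 (lift ord0 r)) | r < k]]
     (lift ord0 i) z).
  rewrite /G; apply: kfun_eq => r; rewrite tnth_mktuple.
  case: (unliftP ord0 r) => [r'|] ->; rewrite ?tnth_cons0 ?tnth_consS.
    by rewrite !(tnth_consS, tnth_mktuple) !(inj_eq (@lift_inj _ _)).
  by rewrite !tnth_mktuple.
by rewrite !E; have [lin _] := wF; rewrite lin.
Qed.

Lemma evs_dCE L k (w : kfun L k.+1) (s : seq L) :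
  evs (dCE w) s =
  \sum_(j < k.+2) \sum_(i < k.+1 | (i < j)%N) (-1) ^+ (i + j) *
    evs w (lie_br s`_(bump j i) s`_j ::
           [seq s`_(bump j (bump i r)) | r <- iota 0 k]).
Proof.
rewrite /evs /dCE; apply: eq_bigr => j _; apply: eq_bigr => i _.
congr (_ * _); apply: kfun_eq => r; rewrite tnth_mktuple.
case: (unliftP ord0 r) => [r'|] ->.
  rewrite tnth_consS !tnth_mktuple lift0 [in RHS]/=.
  by rewrite (nth_map 0%N) ?size_iota ?nth_iota.
by rewrite tnth_cons0 !tnth_mktuple.
Qed.

Lemma evs_dCE3 L (w : kfun L 3) (a b c d : L) :
  evs (dCE w) [:: a; b; c; d] =
  - evs w [:: lie_br a b; c; d] + evs w [:: lie_br a c; b; d]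
  - evs w [:: lie_br a d; b; c] - evs w [:: lie_br b c; a; d]
  + evs w [:: lie_br b d; a; c] - evs w [:: lie_br c d; a; b].
Proof.
rewrite evs_dCE; under eq_bigr do rewrite big_mkcond /=.
rewrite !big_ord_recl !big_ord0 /=.
ring.
Qed.

Lemma evs_dCE4 L (w : kfun L 4) (a b c d e : L) :
  evs (dCE w) [:: a; b; c; d; e] =
  - evs w [:: lie_br a b; c; d; e] + evs w [:: lie_br a c; b; d; e]
  - evs w [:: lie_br a d; b; c; e] + evs w [:: lie_br a e; b; c; d]
  - evs w [:: lie_br b c; a; d; e]
  + evs w [:: lie_br b d; a; c; e] - evs w [:: lie_br b e; a; c; d]
  - evs w [:: lie_br c d; a; b; e] + evs w [:: lie_br c e; a; b; d]
  - evs w [:: lie_br d e; a; b; c].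
Proof.
rewrite evs_dCE; under eq_bigr do rewrite big_mkcond /=.
rewrite !big_ord_recl !big_ord0 /=.
ring.
Qed.

End Differential.

(** * Metric duals and inner products of decomposable 3-forms *)

Section InnerProductOfForms.
Context {R : realType} {V : vectType R}.

(** The metric dual of [f] when [e] is orthonormal; see [metric_sharp]. *)
Definition sharp n (e : n.-tuple V) (f : kfun V 1) : V :=
  \sum_i evs f [:: tnth e i] *: tnth e i.

Definition wedge3 (f g h : kfun V 1) : kfun V 3 := wedge f (wedge g h).

Lemma form_wedge3 f g h :
  is_form f -> is_form g -> is_form h -> is_form (wedge3 f g h).
Proof. by move=> *; do 2! [apply: (@form_wedge _ _ 1) => //]. Qed.

Lemma evs_wedge3 f g h (x y z : V) :
  is_form f -> is_form g -> is_form h ->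
  evs (wedge3 f g h) [:: x; y; z] =
    evs f [:: x] * (evs g [:: y] * evs h [:: z] - evs g [:: z] * evs h [:: y])
  - evs f [:: y] * (evs g [:: x] * evs h [:: z] - evs g [:: z] * evs h [:: x])
  + evs f [:: z] * (evs g [:: x] * evs h [:: y] - evs g [:: y] * evs h [:: x]).
Proof.
move=> fF gF hF; have ghF : is_form (wedge g h) by apply: (@form_wedge _ _ 1).
rewrite /wedge3 (wedge_shuffle (k := 1)) //= !(wedge_shuffle (k := 1)) //=.
ring.
Qed.

Section TripleSums.
Variables (n : nat).
Implicit Type X : 'I_n -> 'I_n -> 'I_n -> R.
Definition sum3 X := \sum_i \sum_j \sum_k X i j k.

Lemma sum3_swap12 X : sum3 X = sum3 (fun i j k => X j i k).
Proof. exact: exchange_big. Qed.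

Lemma sum3_swap23 X : sum3 X = sum3 (fun i j k => X i k j).
Proof. by apply: eq_bigr => i _; apply: exchange_big. Qed.

Lemma sum3D X Y : sum3 X + sum3 Y = sum3 (fun i j k => X i j k + Y i j k).
Proof. by rewrite /sum3 -big_split; apply: eq_bigr => i _; rewrite -big_split;
  apply: eq_bigr => j _; rewrite -big_split. Qed.

Lemma eq_sum3 X Y : (forall i j k, X i j k = Y i j k) -> sum3 X = sum3 Y.
Proof.
by move=> E; apply: eq_bigr => i _; apply: eq_bigr => j _; apply: eq_bigr.
Qed.

Lemma sum_ffun3 (F : {ffun 'I_3 -> 'I_n} -> R) :
  \sum_f F f = sum3 (fun i j k => F (finfun (tnth [tuple i; j; k]))).
Proof.
pose h (p : 'I_n * 'I_n * 'I_n) : {ffun 'I_3 -> 'I_n} :=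
  finfun (tnth [tuple p.1.1; p.1.2; p.2]).
pose h' (f : {ffun 'I_3 -> 'I_n}) := (f ord0, f (lift ord0 ord0), f ord_max).
rewrite (reindex h); last first.
  apply: onW_bij; exists h' => [[[i j] k]|f]; first by rewrite /h' !ffunE.
  apply/ffunP => i; rewrite ffunE /h'.
  by case: i => [[|[|[|]]] //= lt_i]; rewrite /tnth /=; congr (f _); apply: val_inj.
rewrite /sum3 [RHS]pair_big [RHS]pair_big; apply: eq_bigr => -[[i j] k] _.
by [].
Qed.

End TripleSums.

(* Both arguments are antisymmetric, so each of the six terms of the wedge
   product contributes the same sum. *)
Lemma form_inner_wedge3 n (e : n.-tuple V) f g h (b : kfun V 3) :
  is_form f -> is_form g -> is_form h -> is_form b ->
  form_inner e (wedge3 f g h) b = evs b [:: sharp e f; sharp e g; sharp e h].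
Proof.
move=> fF gF hF bF; rewrite /form_inner sum_ffun3.
pose c (u : kfun V 1) i := evs u [:: tnth e i].
pose S i j k := evs b [:: tnth e i; tnth e j; tnth e k].
have S12 i j k : S j i k = - S i j k by rewrite /S evs_swap.
have S23 i j k : S i k j = - S i j k.
  by rewrite /S -!(evs_contract _ b) evs_swap //; apply: form_contract.
pose T := sum3 (fun i j k => c f i * c g j * c h k * S i j k).
have -> : evs b [:: sharp e f; sharp e g; sharp e h] = T.
  rewrite {1}/sharp evs_sum //; apply: eq_bigr => i _.
  have F1 : is_form (contract (tnth e i) b) by apply: form_contract.
  rewrite evsZ // -(evs_contract _ b) {1}/sharp evs_sum // mulr_sumr.
  apply: eq_bigr => j _.
  have F2 := form_contract (tnth e j) F1.
  rewrite evsZ // -(evs_contract _ (contract _ b)) /sharp evs_sum // !mulr_sumr.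
  apply: eq_bigr => k _.
  by rewrite evsZ // !evs_contract /c /S; ring.
have tupE (w : kfun V 3) i j k :
    w [tuple tnth e ([ffun r => tnth [tuple i; j; k] r] r) | r < 3] =
    evs w [:: tnth e i; tnth e j; tnth e k].
  apply: kfun_eq => r; rewrite !tnth_mktuple ffunE.
  by case: r => [[|[|[|]]]].
pose P i j k := c f i * c g j * c h k * S i j k.
rewrite (eq_sum3 (Y := fun i j k => P i j k + P i k j + P j i k + P j k i
   + P k i j + P k j i)); last first.
  move=> i j k; rewrite !tupE evs_wedge3 // -/(S i j k) /P /c.
  rewrite (S12 j k i) (S23 j i k) (S12 i k j) (S23 i j k) (S12 i j k).
  ring.
rewrite -!sum3D.
have E1 : sum3 (fun i j k => P i k j) = T by rewrite sum3_swap23.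
have E2 : sum3 (fun i j k => P j i k) = T by rewrite sum3_swap12.
have E3 : sum3 (fun i j k => P j k i) = T by rewrite sum3_swap12.
have E4 : sum3 (fun i j k => P k i j) = T by rewrite sum3_swap23.
have E5 : sum3 (fun i j k => P k j i) = T by rewrite sum3_swap12.
rewrite E1 E2 E3 E4 E5 -/T (_ : 3`! = 6%N) //.
by field.
Qed.

End InnerProductOfForms.

(** An explicit list, so that a quantifier over increasing multi-indices unfolds into finitely many
    cases. *)
Fixpoint combinations (T : Type) (l : seq T) k : seq (seq T) :=
  match l, k with
  | _, 0 => [:: [::]]
  | [::], _ => [::]
  | x :: l', k'.+1 =>
      [seq x :: s | s <- combinations l' k'] ++ combinations l' k
  end.

Lemma mem_combinations (T : eqType) (l s : seq T) :
  subseq s l -> s \in combinations l (size s).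
Proof.
elim: l s => [|x l IH] [|y s] //= sub_s.
rewrite mem_cat; case: eqP sub_s => [->|_] sub_s.
  by rewrite map_f // IH.
by rewrite (IH (y :: s)) // orbT.
Qed.

Lemma combinations_full (T : Type) (l : seq T) n :
  size l = n -> combinations l n = [:: l].
Proof.
have small (l' : seq T) k : (size l' < k)%N -> combinations l' k = [::].
  elim: l' k => [|x l' IH] [|k] //= lt_k.
  by rewrite !IH // ltnW.
by move=> <-; elim: l => //= x l ->; rewrite small.
Qed.

Lemma sorted_combinations n (s : seq nat) :
  sorted ltn s -> all (gtn n) s -> s \in combinations (iota 0 n) (size s).
Proof.
move=> sS sn; apply: mem_combinations.
rewrite (_ : s = [seq i <- iota 0 n | i \in s]) ?filter_subseq //.
apply: (irr_sorted_eq ltn_trans ltnn) => //.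
  by rewrite sorted_filter ?iota_ltn_sorted //; apply: ltn_trans.
move=> i; rewrite mem_filter mem_iota.
by case: (boolP (i \in s)) => //= /(allP sn).
Qed.

Lemma form_eq0_combinations (R : realType) (V : vectType R) n (e : n.-tuple V) k
    (w : kfun V k) : basis_of fullv e -> is_form w ->
  (forall s, s \in combinations (iota 0 n) k -> evs w [seq e`_i | i <- s] = 0) ->
  forall v, w v = 0.
Proof.
move=> eB wF w0; apply: (form_eq0 eB wF) => s sS sn sk.
by apply: w0; rewrite -sk sorted_combinations.
Qed.

Lemma top_form_eq (R : realType) (V : vectType R) n (e : n.-tuple V)
    (a b : kfun V n) : basis_of fullv e -> is_form a -> is_form b ->
  evs a e = evs b e -> forall v, a v = b v.
Proof.
move=> eB aF bF ab v; apply/eqP; rewrite -subr_eq0; apply/eqP.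
have F := Defs.formD aF (formZ (-1) bF).
suff : (a \+ (fun v => -1 * b v)) v = 0 by rewrite /= mulN1r.
apply: (form_eq0_combinations eB F) => s.
have -> : combinations (iota 0 n) n = [:: iota 0 n].
  exact: combinations_full (size_iota 0 n).
rewrite inE => /eqP->.
have -> : [seq e`_i | i <- iota 0 n] = e.
  by rewrite -{2}(size_tuple e) map_nth_iota0 // take_size.
by move: ab; rewrite /evs /= => ->; rewrite mulN1r subrr.
Qed.

(** * The standard G2-structure of a basis *)

Section StandardForms.
Context {R : realType} {V : vectType R}.
Variable e : 7.-tuple V.
Hypothesis eB : basis_of fullv e.

Definition crd (m : nat) (x : V) : R := coord e (inord m) x.

Definition coform (m : nat) : kfun V 1 := fun v => crd m (tnth v ord0).

(* For [7 <= k], both sides vanish, as then [e`_k] is the default value 0. *)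
Lemma crdE m k : (m < 7)%N -> crd m e`_k = (m == k)%:R.
Proof.
move=> m7; case: (ltnP k 7) => k7; last first.
  by rewrite nth_default ?size_tuple // /crd raddf0 ltn_eqF // (leq_trans m7).
rewrite /crd -[k in e`_k](inordK k7).
rewrite coord_free; last by case/andP: eB.
by rewrite -val_eqE /= !inordK // eq_sym.
Qed.

Lemma crd_sum x : x = \sum_(i < 7) crd i x *: e`_i.
Proof.
rewrite {1}(coord_basis eB (memvf x)); apply: eq_bigr => i _.
by rewrite /crd inord_val.
Qed.

Lemma crdD m x y : crd m (x + y) = crd m x + crd m y.
Proof. exact: raddfD. Qed.

Lemma crdZ m c x : crd m (c *: x) = c * crd m x.
Proof. exact: linearZ. Qed.

Lemma crd0 m : crd m 0 = 0.
Proof. exact: raddf0. Qed.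

Lemma form_coform m : is_form (coform m).
Proof.
split=> [v i c x y|v i j]; last by rewrite (ord1 i) (ord1 j).
by rewrite /coform !tnth_mktuple (ord1 i) eqxx crdD crdZ.
Qed.

Lemma evs_coform m x : evs (coform m) [:: x] = crd m x.
Proof. by rewrite /evs /coform tnth_mktuple. Qed.

Let w3 i j k := wedge3 (coform i) (coform j) (coform k).
Let w4 i j k l : kfun V 4 := wedge (coform i) (w3 j k l).

(** The seven triples are the oriented lines of a Fano plane. With increasing indices counted from 1
    this is e^127 + e^347 + e^567 + e^135 - e^146 - e^236 - e^245. *)
Definition phi0 : kfun V 3 :=
  w3 0 1 6 \+ (w3 2 3 6 \+ (w3 4 5 6 \+ (w3 0 2 4 \+ (w3 0 5 3 \+
    (w3 1 5 2 \+ w3 1 4 3))))).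

(** The terms are the complements of the seven lines of [phi0], ordered so that each line followed
    by its complement is an even permutation. *)
Definition psi0 : kfun V 4 :=
  w4 2 3 4 5 \+ (w4 0 1 4 5 \+ (w4 0 1 2 3 \+ (w4 1 3 6 5 \+ (w4 1 2 4 6 \+
    (w4 0 3 4 6 \+ w4 0 2 5 6))))).

Let w3F i j k : is_form (w3 i j k).
Proof. by apply: form_wedge3; apply: form_coform. Qed.

Let w4F i j k l : is_form (w4 i j k l).
Proof. by apply: (@form_wedge _ _ 1); [apply: form_coform|apply: w3F]. Qed.

Lemma form_phi0 : is_form phi0.
Proof. by do 6! [apply: Defs.formD; first exact: w3F]; apply: w3F. Qed.

Lemma form_psi0 : is_form psi0.
Proof. by do 6! [apply: Defs.formD; first exact: w4F]; apply: w4F. Qed.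

Lemma evsDf k (a b : kfun V k) s : evs (a \+ b) s = evs a s + evs b s.
Proof. by []. Qed.

Let det3 i j k x y z : R :=
  crd i x * (crd j y * crd k z - crd j z * crd k y)
  - crd i y * (crd j x * crd k z - crd j z * crd k x)
  + crd i z * (crd j x * crd k y - crd j y * crd k x).

Let w3E i j k x y z : evs (w3 i j k) [:: x; y; z] = det3 i j k x y z.
Proof.
by rewrite /w3 evs_wedge3 ?evs_coform //; apply: form_coform.
Qed.

Let w4E i j k l x y z t : evs (w4 i j k l) [:: x; y; z; t] =
  crd i x * det3 j k l y z t - crd j x * det3 i k l y z t
  + crd k x * det3 i j l y z t - crd l x * det3 i j k y z t.
Proof.
rewrite /w4 (wedge_shuffle (k := 1)) //=; last exact: form_coform.
rewrite !w3E !evs_coform /det3; ring.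
Qed.

(** The value of e^a /\ e^b /\ e^c on (x, e_j, e_k), where [f] lists the coordinates of x. The first
    argument stays general because brackets will be inserted there; [r] is the value when j and k do
    not lie on the line, which allows lines to be chained. *)
Definition line_val (l : nat * nat * nat) (f : nat -> R) j k (r : R) : R :=
  let: (a, b, c) := l in
  if (j == a) && (k == b) then f c else if (j == b) && (k == a) then - f c
  else if (j == b) && (k == c) then f a
  else if (j == c) && (k == b) then - f a
  else if (j == c) && (k == a) then f b
  else if (j == a) && (k == c) then - f b else r.

(* Each pair [j], [k] occurs in only one of the seven terms of [phi0]. *)
Definition phi0_table (f : nat -> R) j k : R :=
  foldr (fun l => line_val l f j k) 0
    [:: (0, 1, 6); (2, 3, 6); (4, 5, 6); (0, 2, 4); (0, 5, 3); (1, 5, 2);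
        (1, 4, 3)]%N.

(** Expansion of a decomposable 4-form along its first argument; [del] lists the coordinates of
    e_j. *)
Definition quad_val (q : nat * nat * nat * nat) (f : nat -> R) j k l : R :=
  let: (a, b, c, d) := q in let del m : R := (m == j)%:R in
  f a * line_val (b, c, d) del k l 0 - f b * line_val (a, c, d) del k l 0
  + f c * line_val (a, b, d) del k l 0 - f d * line_val (a, b, c) del k l 0.

Definition psi0_table (f : nat -> R) j k l : R :=
  foldr (fun q r => quad_val q f j k l + r) 0
    [:: (2, 3, 4, 5); (0, 1, 4, 5); (0, 1, 2, 3); (1, 3, 6, 5); (1, 2, 4, 6);
        (0, 3, 4, 6); (0, 2, 5, 6)]%N.

Let w3_basis a b c x j k : uniq [:: a; b; c] -> (a < 7)%N -> (b < 7)%N ->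
  (c < 7)%N ->
  evs (w3 a b c) [:: x; e`_j; e`_k] = line_val (a, b, c) (crd^~ x) j k 0.
Proof.
rewrite /= !inE negb_or andbT => /andP[/andP[ab ac] bc] a7 b7 c7.
rewrite w3E /det3 !crdE // /line_val !(eq_sym _ j) !(eq_sym _ k).
have ba := ab; have ca := ac; have cb := bc.
rewrite eq_sym in ba; rewrite eq_sym in ca; rewrite eq_sym in cb.
pose E := (negPf ab, negPf ac, negPf bc, negPf ba, negPf ca, negPf cb).
case: (eqVneq j a) => [ej|ja]; last (case: (eqVneq j b) => [ej|jb];
  last case: (eqVneq j c) => [ej|jc]);
  (case: (eqVneq k a) => [ek|ka]; last (case: (eqVneq k b) => [ek|kb];
  last case: (eqVneq k c) => [ek|kc])); rewrite ?ej ?ek ?eqxx ?E /=; ring.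
Qed.

Let det3_basis a b c i j k : uniq [:: a; b; c] -> (a < 7)%N -> (b < 7)%N ->
  (c < 7)%N ->
  det3 a b c e`_i e`_j e`_k = line_val (a, b, c) (fun m => (m == i)%:R) j k 0.
Proof.
by move=> U a7 b7 c7; rewrite -w3E w3_basis // /line_val !crdE.
Qed.

Let w4_basis a b c d x j k l : uniq [:: a; b; c; d] -> (a < 7)%N -> (b < 7)%N ->
  (c < 7)%N -> (d < 7)%N ->
  evs (w4 a b c d) [:: x; e`_j; e`_k; e`_l] = quad_val (a, b, c, d) (crd^~ x) j k l.
Proof.
rewrite /= !inE !negb_or => /and4P[/and3P[ab ac ad] /andP[bc bd] cd _] *.
by rewrite w4E !det3_basis //= !inE ?negb_or ?ab ?ac ?ad ?bc ?bd ?cd.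
Qed.

Lemma phi0_basis x j k :
  evs phi0 [:: x; e`_j; e`_k] = phi0_table (crd^~ x) j k.
Proof.
rewrite /phi0 !evsDf !w3_basis // /phi0_table.
do 7! [case: j => [|j]; first (do 7! [case: k => [|k];
  first by rewrite /= ?add0r ?addr0]; by rewrite /= ?add0r ?addr0)].
by rewrite /= !addr0.
Qed.

Lemma phi0_basis3 i j k :
  evs phi0 [:: e`_i; e`_j; e`_k] = phi0_table (fun m => (m == i)%:R) j k.
Proof. by rewrite phi0_basis /phi0_table /= !crdE. Qed.

Lemma psi0_basis x j k l :
  evs psi0 [:: x; e`_j; e`_k; e`_l] = psi0_table (crd^~ x) j k l.
Proof. by rewrite /psi0 !evsDf !w4_basis // /psi0_table /foldr addr0. Qed.

Definition coform3_seq a b c s : R :=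
  if s is [:: i; j; k] then line_val (a, b, c) (fun m => (m == i)%:R) j k 0 else 0.

Lemma evs_coform3_seq a b c s : uniq [:: a; b; c] -> (a < 7)%N -> (b < 7)%N ->
  (c < 7)%N -> size s = 3%N ->
  evs (wedge3 (coform a) (coform b) (coform c)) [seq e`_i | i <- s] =
  coform3_seq a b c s.
Proof.
move=> U a7 b7 c7; case: s => [|i [|j [|k []]]] //= _.
by rewrite w3E det3_basis.
Qed.

Definition phi0_seq s :=
  if s is [:: i; j; k] then phi0_table (fun m => (m == i)%:R) j k else 0.

Lemma evs_phi0_seq s : size s = 3%N -> evs phi0 [seq e`_i | i <- s] = phi0_seq s.
Proof. by case: s => [|i [|j [|k []]]] //= _; rewrite phi0_basis3. Qed.

Definition dot (x y : V) : R :=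
  crd 0 x * crd 0 y + crd 1 x * crd 1 y + crd 2 x * crd 2 y + crd 3 x * crd 3 y
  + crd 4 x * crd 4 y + crd 5 x * crd 5 y + crd 6 x * crd 6 y.

(** Each of the seven lines contributes the coordinate volume form once to the wedge product, whence
    the factor. *)
Definition vol0 : kfun V 7 := fun v => 7^-1 * wedge phi0 psi0 v.

Lemma form_vol0 : is_form vol0.
Proof.
exact: (formZ 7^-1 (form_wedge form_phi0 form_psi0)).
Qed.

Lemma vol0_basis : evs vol0 e = 1.
Proof.
have -> : evs vol0 e = 7^-1 * evs (wedge phi0 psi0) e by [].
(* The opaque [B] keeps simplification from unfolding the values of [psi0] before the zeros of
   [phi0] have removed most terms. *)
have [B BE] : exists B, forall s, evs psi0 [seq e`_i | i <- s] = B s by eexists.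
rewrite (wedge_shuffle_basis form_phi0 form_psi0 evs_phi0_seq (fun s _ => BE s)) //.
rewrite /phi0_seq /phi0_table /= !mul0r !mulr0 !addr0 !add0r.
rewrite -!BE !psi0_basis /psi0_table /= !crdE //=.
by field.
Qed.

Lemma wedge_contract_basis v w :
  evs (wedge (wedge (contract v phi0) (contract w phi0)) phi0) e = 6 * dot v w.
Proof.
have F x : is_form (contract x phi0) by apply: form_contract form_phi0.
pose C x s : R := if s is [:: j; k] then phi0_table (crd^~ x) j k else 0.
have CE x s : size s = 2%N -> evs (contract x phi0) [seq e`_i | i <- s] = C x s.
  by case: s => [|j [|k []]] //= _; rewrite evs_contract phi0_basis.
have AE := wedge_shuffle_map (F v) (F w) (CE v) (CE w).
rewrite (wedge_shuffle_basis (form_wedge (F v) (F w)) form_phi0 AE evs_phi0_seq) //.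
rewrite /C /phi0_seq /phi0_table /= /dot; ring.
Qed.

End StandardForms.

Section StandardStructure.
Context {R : realType} {V : vectType R}.
Variable e : 7.-tuple V.
Hypothesis eB : basis_of fullv e.

Lemma dotC x y : dot e x y = dot e y x.
Proof. by rewrite /dot; ring. Qed.

Lemma dot_scalar y : scalar (fun x => dot e x y).
Proof. by move=> c x z; rewrite /dot !crdD !crdZ; ring. Qed.

Lemma dot_gt0 x : x != 0 -> 0 < dot e x x.
Proof.
move=> x0; have dotE : dot e x x = \sum_(i < 7) crd e i x ^+ 2.
  by rewrite /dot !big_ord_recl big_ord0 /= addr0 !addrA !expr2.
rewrite lt_def dotE sumr_ge0 ?andbT => [|i _]; last exact: sqr_ge0.
apply: contra x0; rewrite psumr_eq0 => [|i _]; last exact: sqr_ge0.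
move/allP => c0; rewrite (crd_sum eB x) big1 // => i _.
have := c0 i (mem_index_enum i); rewrite sqrf_eq0 => /eqP->.
by rewrite scale0r.
Qed.

Lemma dot_basis i j : (i < 7)%N -> (j < 7)%N -> dot e e`_i e`_j = (i == j)%:R.
Proof.
move=> i7 j7; rewrite /dot !crdE //.
do 7! [case: i i7 => [|i] i7; first (
  do 7! [case: j j7 => [|j] j7; first (rewrite /=; ring)]; by [])].
by [].
Qed.

Lemma dot_orthonormal : Defs.orthonormal (dot e) e.
Proof. by move=> i j; rewrite !(tnth_nth 0) dot_basis. Qed.

Lemma form_wedge_contract v w (phi : kfun V 3) : is_form phi ->
  is_form (wedge (wedge (contract v phi) (contract w phi)) phi).
Proof. by move=> F; do 2! [apply: form_wedge => //]; apply: form_contract. Qed.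

Lemma dimv7 : \dim {:V} = 7%N.
Proof. by rewrite -(size_basis eB). Qed.

Lemma G2_metric_phi0 : G2_metric (phi0 e) (dot e) (vol0 e).
Proof.
split.
- by split; [exact: dot_scalar | exact: dotC | exact: dot_gt0].
- split; [exact: dimv7 | exact: form_vol0 |].
  exists e; first exact: dot_orthonormal.
  by rewrite -evs_tuple vol0_basis.
move=> v w; apply: (top_form_eq eB).
- exact: formZ (form_vol0 e).
- exact: formZ (form_wedge_contract v w (form_phi0 e)).
transitivity (dot e v w * evs (vol0 e) e); first by [].
rewrite vol0_basis // mulr1.
transitivity (6^-1 * evs (wedge (wedge (contract v (phi0 e))
  (contract w (phi0 e))) (phi0 e)) e); last by [].
by rewrite wedge_contract_basis //; field.
Qed.

Lemma is_G2_phi0 : is_G2 (phi0 e).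
Proof.
split; first exact: form_phi0.
move=> v /dot_gt0 v0 /(_ e); rewrite -evs_tuple wedge_contract_basis //.
by move/eqP; rewrite mulf_eq0 pnatr_eq0 /= gt_eqF.
Qed.

Lemma sharp_coform i : (i < 7)%N -> sharp e (coform e i) = e`_i.
Proof.
move=> i7; rewrite [RHS](crd_sum eB) /sharp; apply: eq_bigr => j _.
by rewrite evs_coform (tnth_nth 0) !crdE // eq_sym.
Qed.

Lemma hodge_dual_phi0 :
  hodge_dual (k := 3) (l := 4) (dot e) (vol0 e) (phi0 e) (psi0 e).
Proof.
split; first exact: form_psi0.
exists e; first exact: dot_orthonormal.
move=> a aF; apply: (top_form_eq eB).
- exact: form_wedge aF (form_psi0 e).
- exact: formZ (form_vol0 e).
transitivity (form_inner e a (phi0 e) * evs (vol0 e) e); last by [].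
rewrite vol0_basis // mulr1.
have symI b : form_inner e a b = form_inner e b a.
  by congr (_ * _); apply: eq_bigr => f _; apply: mulrC.
have addI b c : form_inner e (b \+ c) a = form_inner e b a + form_inner e c a.
  by rewrite /form_inner -mulrDr -big_split; congr (_ * _);
    apply: eq_bigr => f _; rewrite mulrDl.
have cF := form_coform e.
have wI i j k : (i < 7)%N -> (j < 7)%N -> (k < 7)%N ->
    form_inner e (wedge3 (coform e i) (coform e j) (coform e k)) a =
    evs a [:: e`_i; e`_j; e`_k].
  by move=> i7 j7 k7; rewrite form_inner_wedge3 // !sharp_coform.
rewrite symI /phi0 !addI !wI //.
rewrite (wedge_shuffle_basis aF (form_psi0 e) (fun s _ => erefl) (fun s _ => erefl)) //.
rewrite /= !psi0_basis // /psi0_table /= !crdE //=.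
have s12 i j k : evs a [:: i; j; k] = - evs a [:: j; i; k].
  by rewrite evs_swap.
have s23 i j k : evs a [:: i; j; k] = - evs a [:: i; k; j].
  by rewrite -!(evs_contract _ a) evs_swap //; apply: form_contract.
rewrite (s23 e`_0 e`_5 e`_3) (s23 e`_1 e`_5 e`_2) (s23 e`_1 e`_4 e`_3).
ring.
Qed.

End StandardStructure.

(** * Bases whose standard structure is purely coclosed *)

Section Construction.
Context {R : realType} {L : lieAlgebra R}.
Variable e : 7.-tuple L.
Hypothesis eB : basis_of fullv e.

Lemma wedge_phi0_basis (w : kfun L 4) : is_form w ->
  let W i j k l := evs w [:: e`_i; e`_j; e`_k; e`_l] in
  evs (wedge w (phi0 e)) e = W 0 1 2 3 + W 0 1 4 5 + W 0 2 5 6 + W 0 3 4 6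
    + W 1 2 4 6 - W 1 3 5 6 + W 2 3 4 5.
Proof.
move=> wF W.
have [A AE] : exists A, forall s, evs w [seq e`_i | i <- s] = A s by eexists.
rewrite (wedge_shuffle_basis wF (form_phi0 e) (fun s _ => AE s) (evs_phi0_seq eB)) //.
rewrite /phi0_seq /phi0_table /= !mulr0 !addr0 !add0r -!AE /= /W.
ring.
Qed.

Lemma purely_coclosed_phi0 :
  (forall s, s \in combinations (iota 0 7) 5 ->
     evs (dCE (psi0 e)) [seq e`_i | i <- s] = 0) ->
  evs (wedge (dCE (phi0 e)) (phi0 e)) e = 0 ->
  purely_coclosed_G2 (phi0 e).
Proof.
move=> dpsi dphi; split; first exact: is_G2_phi0.
  exists (dot e), (vol0 e), (psi0 e); split.
  - exact: G2_metric_phi0.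
  - exact: hodge_dual_phi0.
  - exact: form_eq0_combinations eB (form_dCE (form_psi0 e)) dpsi.
move=> v; have dF := form_dCE (form_phi0 e).
apply: (top_form_eq eB (form_wedge dF (form_phi0 e)) (form0 _ _)).
exact: dphi.
Qed.

(* The hypotheses say that the brackets contracted with the self-dual forms
   [e^13 - e^24], [-(e^14 + e^23)] and [e^12 + e^34] give a symmetric traceless
   matrix in the central directions [e_5], [e_6], [e_7]. *)
Lemma purely_coclosed_4_3 :
  (forall k x, (4 <= k < 7)%N -> lie_br x e`_k = 0) ->
  (forall i j m, (i < 4)%N -> (j < 4)%N -> (m < 4)%N ->
    crd e m (lie_br e`_i e`_j) = 0) ->
  let s1 := lie_br e`_0 e`_2 - lie_br e`_1 e`_3 in
  let s2 := - (lie_br e`_0 e`_3 + lie_br e`_1 e`_2) in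
  let s3 := lie_br e`_0 e`_1 + lie_br e`_2 e`_3 in
  crd e 5 s1 = crd e 4 s2 -> crd e 6 s1 = crd e 4 s3 ->
  crd e 6 s2 = crd e 5 s3 -> crd e 4 s1 + crd e 5 s2 + crd e 6 s3 = 0 ->
  purely_coclosed_G2 (phi0 e).
Proof.
move=> cen low s1 s2 s3; rewrite /s1 /s2 /s3 => {s1 s2 s3}.
have crdN m x : crd e m (- x) = - crd e m x by rewrite /crd linearN.
rewrite !(crdD, crdN) => h12 h13 h23 tr.
have cen4 x := cen 4 x isT; have cen5 x := cen 5 x isT.
have cen6 x := cen 6 x isT.
have cenl k x : (4 <= k < 7)%N -> lie_br e`_k x = 0.
  by move=> k4; rewrite lie_br_anti cen // oppr0.
have cl4 x := cenl 4 x isT; have cl5 x := cenl 5 x isT.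
have cl6 x := cenl 6 x isT.
pose cenE := (cen4, cen5, cen6, cl4, cl5, cl6).
have low0 i j i4 j4 := low i j 0 i4 j4 isT.
have low1 i j i4 j4 := low i j 1 i4 j4 isT.
have low2 i j i4 j4 := low i j 2 i4 j4 isT.
have low3 i j i4 j4 := low i j 3 i4 j4 isT.
apply: purely_coclosed_phi0 => [s|].
  rewrite [combinations _ _]/= => sI.
  have [P PE] : exists P, evs (psi0 e) =1 P by eexists.
  have P0 s' : P (0 :: s') = 0 by rewrite -PE (evs0 _ (form_psi0 e)).
  have Pb x j k l : P [:: x; e`_j; e`_k; e`_l] = psi0_table (crd e ^~ x) j k l.
    by rewrite -PE psi0_basis.
  (* Only the three subsets made of e_0, ..., e_3 and one central vector give conditions, and these
     are the symmetry of the matrix. The other 18 values vanish because no term of [psi0] contains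
     all of 4, 5, 6. *)
  do 21? [move: sI; rewrite in_cons => /orP[/eqP->|sI]] => //;
   rewrite /map evs_dCE4 !PE ?cenE ?P0 ?Pb
     /psi0_table /= ?low0 ?low1 ?low2 ?low3 //; try ring.
  - move: h23; clear; lra.
  - move: h13; clear; lra.
  - move: h12; clear; lra.
rewrite (wedge_phi0_basis (form_dCE (form_phi0 e))) !evs_dCE3 ?cenE.
rewrite !(evs0 _ (form_phi0 e)).
rewrite !(phi0_basis eB) // /phi0_table /= ?low0 ?low1 ?low2 ?low3 //.
move: tr; clear; lra.
Qed.

(** Contracting [phi0] with e_6 gives the Kaehler form e^01 + e^23 + e^45, while the bracket is the
    form e^01 + e^23 - 2 e^45. The latter is of type (1,1), which makes [psi0] closed, and
    primitive, as 1 + 1 - 2 = 0, which makes dphi /\ phi vanish. *)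
Lemma purely_coclosed_6_1 :
  let z := e`_6 in
  lie_br e`_0 e`_1 = z -> lie_br e`_2 e`_3 = z -> lie_br e`_4 e`_5 = -2 *: z ->
  (forall x, lie_br x z = 0) ->
  (forall i j, (i < j < 6)%N -> (i, j) \notin [:: (0, 1); (2, 3); (4, 5)]%N ->
     lie_br e`_i e`_j = 0) ->
  purely_coclosed_G2 (phi0 e).
Proof.
move=> z b01 b23 b45 cen nil; rewrite /z in b01 b23 b45 cen => {z}.
have cenl x : lie_br e`_6 x = 0 by rewrite lie_br_anti cen oppr0.
have b02 := nil 0 2 isT isT; have b03 := nil 0 3 isT isT.
have b04 := nil 0 4 isT isT; have b05 := nil 0 5 isT isT.
have b12 := nil 1 2 isT isT; have b13 := nil 1 3 isT isT.
have b14 := nil 1 4 isT isT; have b15 := nil 1 5 isT isT.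
have b24 := nil 2 4 isT isT; have b25 := nil 2 5 isT isT.
have b34 := nil 3 4 isT isT; have b35 := nil 3 5 isT isT.
pose E := (cen, cenl, b01, b23, b45, b02, b03, b04, b05, b12, b13, b14, b15,
  b24, b25, b34, b35).
apply: purely_coclosed_phi0 => [s|].
  rewrite [combinations _ _]/= => sI.
  have [P PE] : exists P, evs (psi0 e) =1 P by eexists.
  have P0 s' : P (0 :: s') = 0 by rewrite -PE (evs0 _ (form_psi0 e)).
  have Pb x j k l : P [:: x; e`_j; e`_k; e`_l] = psi0_table (crd e ^~ x) j k l.
    by rewrite -PE psi0_basis.
  do 21? [move: sI; rewrite in_cons => /orP[/eqP->|sI]] => //;
   rewrite /map evs_dCE4 !PE ?E ?P0 ?Pb
     /psi0_table /= ?crdZ ?(crdE eB) //=; ring.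
rewrite (wedge_phi0_basis (form_dCE (form_phi0 e))) !evs_dCE3 ?E !(evs0 _ (form_phi0 e)).
rewrite !(phi0_basis eB) // /phi0_table /= !crdZ !(crdE eB) //=.
by ring.
Qed.

End Construction.

(** * Obstructions *)

Section ThreeFormsInCoordinates.
Context {R : realType} {V : vectType R}.
Implicit Types (phi : kfun V 3) (b : 7.-tuple V).

(** Expresses all components of a 3-form through the 35 values of [T] on increasing triples, which
    [ring] then treats as independent atoms. *)
Definition increasing3 (T : nat -> nat -> nat -> R) i j k : R :=
  if [|| i == j, j == k | i == k] then 0
  else if (i < j)%N then
    if (j < k)%N then T i j k else if (i < k)%N then - T i k j else T k i j
  else if (k < j)%N then - T k j i
  else if (i < k)%N then - T j i k else T j k i.

Lemma evs_increasing3 phi (b : seq V) : is_form phi -> exists T,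
  (forall i j k, T i j k = evs phi [:: b`_i; b`_j; b`_k]) /\
  (forall i j k, evs phi [:: b`_i; b`_j; b`_k] = increasing3 T i j k).
Proof.
move=> F; pose T i j k := evs phi [:: b`_i; b`_j; b`_k].
exists T; split=> // i j k.
have s12 i' j' k' : T i' j' k' = - T j' i' k' by rewrite /T evs_swap.
have s23 i' j' k' : T i' j' k' = - T i' k' j'.
  by rewrite /T -!(evs_contract _ phi) evs_swap //; apply: form_contract.
have a12 i' k' : T i' i' k' = 0 by rewrite /T evs_alt.
rewrite -/(T i j k) /increasing3.
case: eqVneq => [->|ij]; first exact: a12.
case: eqVneq => [->|jk] /=; first by rewrite s12 s23 a12 !oppr0.
case: eqVneq => [->|ik] /=; first by rewrite s23 a12 oppr0.
case: ltnP => [_|_].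
  case: ltnP => // _; case: ltnP => _; first exact: s23.
  by rewrite s23 s12 opprK.
case: ltnP => _; first by rewrite s12 s23 s12 opprK.
by case: ltnP => _; [exact: s12 | rewrite s12 s23 opprK].
Qed.

Lemma wedge_contract_shuffle phi b T i j : is_form phi ->
  (forall i j k, evs phi [:: b`_i; b`_j; b`_k] = increasing3 T i j k) ->
  let P s := if s is [:: i; j; k] then increasing3 T i j k else 0 in
  evs (wedge (wedge (contract b`_i phi) (contract b`_j phi)) phi) b =
  shuffle (iota 0 7) 4 3
    (fun s => shuffle s 2 2 (fun t => P (i :: t)) (fun t => P (j :: t))) P.
Proof.
move=> F nT P; have Fc x : is_form (contract x phi) by apply: form_contract.
have PE s : size s = 3%N -> evs phi [seq b`_i | i <- s] = P s.
  by case: s => [|? [|? [|? []]]] //= _; apply: nT.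
have CE m s : size s = 2%N ->
    evs (contract b`_m phi) [seq b`_i | i <- s] = P (m :: s).
  by move=> s2; rewrite evs_contract -PE //= s2.
have AE := wedge_shuffle_map (Fc b`_i) (Fc b`_j) (CE i) (CE j).
exact: (wedge_shuffle_basis (form_wedge (Fc b`_i) (Fc b`_j)) F AE PE).
Qed.

(** The 2-form F does not involve the direction of b_0, so only the part b^0 /\ F of [phi]
    contributes to the last factor. What remains is F^3, which is 6 times the Pfaffian of F on the
    other six vectors. *)
Lemma wedge_contract_pfaffian phi b : is_form phi ->
  let F i j := evs phi [:: b`_0; b`_i; b`_j] in
  evs (wedge (wedge (contract b`_0 phi) (contract b`_0 phi)) phi) b =
  6 * (F 1 2 * (F 3 4 * F 5 6 - F 3 5 * F 4 6 + F 3 6 * F 4 5)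
     - F 1 3 * (F 2 4 * F 5 6 - F 2 5 * F 4 6 + F 2 6 * F 4 5)
     + F 1 4 * (F 2 3 * F 5 6 - F 2 5 * F 3 6 + F 2 6 * F 3 5)
     - F 1 5 * (F 2 3 * F 4 6 - F 2 4 * F 3 6 + F 2 6 * F 3 4)
     + F 1 6 * (F 2 3 * F 4 5 - F 2 4 * F 3 5 + F 2 5 * F 3 4)).
Proof.
move=> phiF F; have [T [_ nT]] := evs_increasing3 b phiF.
rewrite (wedge_contract_shuffle _ _ phiF nT) /F !nT /increasing3 /=; ring.
Qed.

(** * 3-forms adapted to a splitting into 3 + 4 directions *)

Section AdaptedBasis.
Variables (phi : kfun V 3) (b : 7.-tuple V) (T : nat -> nat -> nat -> R).
Hypothesis nT : forall i j k,
  evs phi [:: b`_i; b`_j; b`_k] = increasing3 T i j k.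
Hypothesis phiF : is_form phi.
Hypothesis T01 : forall k, (2 <= k < 6)%N -> T 0 1 k = 0.
Hypothesis T06 : forall k, (2 <= k < 6)%N -> T 0 k 6 = 0.
Hypothesis T16 : forall k, (2 <= k < 6)%N -> T 1 k 6 = 0.

(** The same components with the vanishing ones replaced by a literal 0, so that they disappear by
    rewriting under the shuffle sums. *)
Let T' i j k : R :=
  if [&& i == 0, j == 1 & 1 < k < 6]%N || [&& i < 2, 1 < j < 6 & k == 6]%N
  then 0 else T i j k.

Let nT' i j k : evs phi [:: b`_i; b`_j; b`_k] = increasing3 T' i j k.
Proof.
rewrite nT; congr (increasing3 _ i j k).
apply: boolp.funext => {}i; apply: boolp.funext => {}j; apply: boolp.funext => {}k.
rewrite /T'; case: ifP => // /orP[/and3P[/eqP-> /eqP-> /T01]|] //.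
case/and3P=> + j6 /eqP->; case: i => [|[|]] // _; [exact: T06 | exact: T16].
Qed.

Let B i j := evs (wedge (wedge (contract b`_i phi) (contract b`_j phi)) phi) b.

Lemma adapted66 : B 6 6 = 6 * T 0 1 6 *
  (T 2 3 6 * T 4 5 6 - T 2 4 6 * T 3 5 6 + T 2 5 6 * T 3 4 6).
Proof.
rewrite /B (wedge_contract_shuffle _ _ phiF nT') /increasing3 /T' /=; ring.
Qed.

(** Let tau be the restriction of [phi] to the span of b_2, ..., b_5 and omega the contraction of
    [phi] with b_6 there. Then [B 6 k] is 3 [T 0 1 6] times the wedge product of omega with the
    contraction of tau by b_k. The four cases k = 2, ..., 5 are four linear equations for the four
    components of tau. *)
Lemma adapted62 : B 6 2 = 3 * T 0 1 6 *
  (T 2 3 6 * T 2 4 5 - T 2 4 6 * T 2 3 5 + T 2 5 6 * T 2 3 4).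
Proof.
rewrite /B (wedge_contract_shuffle _ _ phiF nT') /increasing3 /T' /=; ring.
Qed.

Lemma adapted63 : B 6 3 = 3 * T 0 1 6 *
  (T 2 3 6 * T 3 4 5 - T 3 4 6 * T 2 3 5 + T 3 5 6 * T 2 3 4).
Proof.
rewrite /B (wedge_contract_shuffle _ _ phiF nT') /increasing3 /T' /=; ring.
Qed.

Lemma adapted64 : B 6 4 = 3 * T 0 1 6 *
  (T 2 4 6 * T 3 4 5 - T 3 4 6 * T 2 4 5 + T 4 5 6 * T 2 3 4).
Proof.
rewrite /B (wedge_contract_shuffle _ _ phiF nT') /increasing3 /T' /=; ring.
Qed.

Lemma adapted65 : B 6 5 = 3 * T 0 1 6 *
  (T 2 5 6 * T 3 4 5 - T 3 5 6 * T 2 4 5 + T 4 5 6 * T 2 3 5).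
Proof.
rewrite /B (wedge_contract_shuffle _ _ phiF nT') /increasing3 /T' /=; ring.
Qed.

Lemma adapted_orth i j : (i < 2)%N -> (2 <= j < 6)%N ->
  T 2 3 4 = 0 -> T 2 3 5 = 0 -> T 2 4 5 = 0 -> T 3 4 5 = 0 -> B i j = 0.
Proof.
move=> i2 j6 r5 r4 r3 r2.
case: i i2 => [|[|//]] _; case: j j6 => [|[|[|[|[|[|]]]]]] // _;
rewrite /B (wedge_contract_shuffle _ _ phiF nT') /increasing3 /T' /=
  r5 r4 r3 r2; ring.
Qed.

End AdaptedBasis.

End ThreeFormsInCoordinates.

(** * Metric dual bases and the components of phi that closedness of psi kills *)

Section Obstruction.
Context {R : realType} {L : lieAlgebra R}.
Variables (phi : kfun L 3) (g : L -> L -> R) (vol : kfun L 7) (psi : kfun L 4).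
Hypothesis phiG2 : is_G2 phi.
Hypothesis metric : G2_metric phi g vol.
Variables (E e : 7.-tuple L).
Hypothesis EO : Defs.orthonormal g E.
Hypothesis hodge : forall a : kfun L 3, is_form a ->
  wedge a psi =1 (fun x => form_inner E a phi * vol x).
Hypothesis psiF : is_form psi.
Hypothesis dpsi : dCE psi =1 zero_form.
Hypothesis eB : basis_of fullv e.

Let phiF : is_form phi. Proof. by case: phiG2. Qed.

Lemma metric_scalarl y : scalar (fun x => g x y).
Proof. by case: metric => -[]. Qed.

Lemma metricC x y : g x y = g y x.
Proof. by case: metric => -[]. Qed.

Lemma metric_gt0 x : x != 0 -> 0 < g x x.
Proof. by case: metric => -[_ _ h _ _]; apply: h. Qed.

Lemma metric0l y : g 0 y = 0.
Proof.
have /eqP := metric_scalarl y 1 0 0; rewrite scaler0 addr0 mul1r.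
by rewrite -subr_eq0 opprD addrA subrr sub0r oppr_eq0 => /eqP.
Qed.

Lemma metricDl x y z : g (x + y) z = g x z + g y z.
Proof. by have := metric_scalarl z 1 x y; rewrite scale1r mul1r. Qed.

Lemma metricZl c x z : g (c *: x) z = c * g x z.
Proof. by have := metric_scalarl z c x 0; rewrite metric0l !addr0. Qed.

Lemma metric_suml I (r : seq I) (P : pred I) (F : I -> L) z :
  g (\sum_(i <- r | P i) F i) z = \sum_(i <- r | P i) g (F i) z.
Proof.
apply: (big_morph (g^~ z)) => [x y|]; [exact: metricDl | exact: metric0l].
Qed.

Lemma metric_eq0 x : g x x = 0 -> x = 0.
Proof.
by move=> gx; apply/eqP; apply: contraT => /metric_gt0; rewrite gx ltxx.
Qed.

Lemma dimL : \dim {:L} = 7%N.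
Proof. by rewrite -(size_basis eB). Qed.

Lemma orthonormal_basis : basis_of fullv E.
Proof.
rewrite basisEfree dimL size_tuple leqnn subvf !andbT.
apply/freeP => k k0 j.
have : g (\sum_i k i *: E`_i) (tnth E j) = 0 by rewrite k0 metric0l.
rewrite metric_suml (bigD1 j) //= big1 => [|i ij].
  by rewrite addr0 metricZl -tnth_nth EO eqxx mulr1.
by rewrite metricZl -tnth_nth EO (negPf ij) mulr0.
Qed.

Lemma metric_sharp f x : is_form f -> g (sharp E f) x = evs f [:: x].
Proof.
move=> fF; rewrite /sharp metric_suml [x in RHS](coord_basis orthonormal_basis (memvf x)).
rewrite evs_sum //; apply: eq_bigr => i _.
rewrite metricZl evsZ // mulrC -!(tnth_nth 0); congr (_ * _).
rewrite [x in LHS](coord_basis orthonormal_basis (memvf x)) metricC metric_suml.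
rewrite (bigD1 i) //= big1 => [|j ji].
  by rewrite addr0 metricZl -tnth_nth EO eqxx mulr1.
by rewrite metricZl -tnth_nth EO (negPf ji) mulr0.
Qed.

Definition dual_vector i : L := sharp E (coform e i).

Lemma metric_dual_vector i x : g (dual_vector i) x = crd e i x.
Proof.
by rewrite metric_sharp ?evs_coform //; apply: form_coform.
Qed.

(** The first [m] vectors span the orthogonal complement of the remaining ones, which is why the two
    families together form a basis. *)
Definition partial_dual m : 7.-tuple L :=
  [tuple if (i < m)%N then dual_vector i else tnth e i | i < 7].

Lemma partial_dual_basis m : basis_of fullv (partial_dual m).
Proof.
rewrite basisEfree dimL size_tuple leqnn subvf !andbT.
apply/freeP => k; under eq_bigr => i _ do rewrite -tnth_nth tnth_mktuple.
move=> k0.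
pose P := \sum_(i < 7 | (i < m)%N) k i *: dual_vector i.
pose Q := \sum_(i < 7 | ~~ (i < m)%N) k i *: tnth e i.
have PQ : P + Q = 0.
  rewrite -k0 [RHS](bigID (fun i : 'I_7 => (i < m)%N)) /=.
  by congr (_ + _); apply: eq_bigr => i; [move=> -> | move/negPf->].
have crde (i j : 'I_7) : crd e i (tnth e j) = (i == j)%:R.
  by rewrite (tnth_nth 0) crdE.
have gP x : g P x = \sum_(i < 7 | (i < m)%N) k i * crd e i x.
  rewrite metric_suml; apply: eq_bigr => i _.
  by rewrite metricZl metric_dual_vector.
have P0 : P = 0.
  apply: metric_eq0; have {2}-> : P = - Q by apply/eqP; rewrite -addr_eq0 PQ.
  rewrite -scaleN1r metricC metricZl metric_suml big1 ?mulr0 // => j jm.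
  rewrite metricZl metricC gP big1 ?mulr0 // => i im.
  rewrite crde; case: eqVneq => [ij|_]; last by rewrite mulr0.
  by rewrite ij (negPf jm) in im.
have Q0 : Q = 0 by rewrite P0 add0r in PQ.
move=> j; case: (boolP (j < m)%N) => jm.
  have := gP (tnth e j); rewrite P0 metric0l (bigD1 j) //= big1 => [|i].
    by rewrite crde eqxx mulr1 addr0.
  by case/andP=> _ ij; rewrite crde (negPf ij) mulr0.
have : crd e j Q = 0 by rewrite Q0 crd0.
rewrite /crd linear_sum (bigD1 j) //= big1 => [|i].
  by rewrite linearZ -/(crd e j _) /= -/(crd e j _) crde eqxx addr0 => /eqP;
    rewrite mulf_eq0 oner_eq0 orbF => /eqP.
case/andP=> _ ij; rewrite linearZ /= -/(crd e j _) crde eq_sym (negPf ij).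
exact: mulr0.
Qed.

Lemma vol_basis_neq0 : evs vol e != 0.
Proof.
have [_ [_ volF [e' _ vol1]] _] := metric.
apply/eqP => vol0; have := top_form_eq eB volF (form0 _ _) vol0 e'.
by rewrite vol1 => /eqP; rewrite oner_eq0.
Qed.

(** As psi is the Hodge dual of phi, e^ijk /\ psi is the volume form times the inner product of
    e^ijk with phi, that is, times phi on the dual vectors. So components of psi on [e] are, up to a
    nonzero factor, components of phi on dual vectors with complementary indices. *)
Lemma phi_dual_vectors i j k : uniq [:: i; j; k] ->
  (i < 7)%N -> (j < 7)%N -> (k < 7)%N ->
  shuffle (iota 0 7) 3 4 (coform3_seq i j k)
    (fun s => evs psi [seq e`_m | m <- s]) = 0 ->
  evs phi [:: dual_vector i; dual_vector j; dual_vector k] = 0.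
Proof.
move=> U i7 j7 k7.
have cF := form_coform e; have pF := phiF.
have aF := form_wedge3 (cF i) (cF j) (cF k).
rewrite -form_inner_wedge3 //.
rewrite -(wedge_shuffle_basis aF psiF
  (fun s => evs_coform3_seq eB U i7 j7 k7) (fun s _ => erefl)) //.
have -> : evs (wedge (wedge3 (coform e i) (coform e j) (coform e k)) psi) e
  = form_inner E (wedge3 (coform e i) (coform e j) (coform e k)) phi * evs vol e.
  by rewrite {1}/evs hodge.
by move/eqP; rewrite mulf_eq0 (negPf vol_basis_neq0) orbF => /eqP.
Qed.

Lemma nondegenerate (b : 7.-tuple L) v : basis_of fullv b -> v != 0 ->
  evs (wedge (wedge (contract v phi) (contract v phi)) phi) b <> 0.
Proof.
move=> bB v0 Bv0; have [_ /(_ v v0)] := phiG2; apply=> x.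
exact: (top_form_eq bB (form_wedge_contract v v phiF) (form0 _ _) Bv0).
Qed.

Lemma basis_neq0 (b : 7.-tuple L) i : basis_of fullv b -> (i < 7)%N -> b`_i != 0.
Proof.
move=> bB i7; apply: contraTneq (basis_free bB) => bi0.
apply/negP => /(free_not0) /(_ (mem_nth 0 _)); rewrite size_tuple => /(_ i i7).
by rewrite bi0 eqxx.
Qed.

(* The 2-form [psi (., ., e_5, e_6)] has rank at most 2, so the contraction of
   [phi] with [dual_vector 0] vanishes on the span of the first five dual vectors
   and is degenerate. *)
Lemma no_G2_of_rank2 :
  (forall k l, (0 < k < l)%N -> (l < 5)%N ->
     evs psi [:: e`_k; e`_l; e`_5; e`_6] = 0) -> False.
Proof.
move=> psi0.
have phi0 i j : (0 < i < j)%N -> (j < 5)%N ->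
    evs phi [:: dual_vector 0; dual_vector i; dual_vector j] = 0.
  have [P PE] : exists P, (fun s => evs psi [seq e`_m | m <- s]) = P by eexists.
  have [[p12 p13] p14] := (psi0 1 2 isT isT, psi0 1 3 isT isT, psi0 1 4 isT isT).
  have [[p23 p24] p34] := (psi0 2 3 isT isT, psi0 2 4 isT isT, psi0 3 4 isT isT).
  by case: i j => [|[|[|[|i]]]] [|[|[|[|[|j]]]]] // _ _;
    apply: phi_dual_vectors;
    rewrite // PE /coform3_seq /= !mul0r !mulr0 !addr0 !add0r -PE /= ?p12 ?p13 ?p14
      ?p23 ?p24 ?p34; ring.
have bB := partial_dual_basis 5.
have bE k : (k < 5)%N -> (partial_dual 5)`_k = dual_vector k.
  move=> k5; have k7 : (k < 7)%N by apply: leq_trans k5 _.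
  by rewrite -(tnth_nth 0 _ (Ordinal k7)) tnth_mktuple /= k5.
have b0 := basis_neq0 bB (isT : (0 < 7)%N).
apply: (nondegenerate bB b0).
rewrite (wedge_contract_pfaffian _ phiF) !(bE 0, bE 1, bE 2, bE 3, bE 4)//.
rewrite !phi0 //; ring.
Qed.

Section DerivedLine.
Variable c0 : R.
Hypothesis c0_neq0 : c0 != 0.
Hypothesis br01 : lie_br e`_0 e`_1 = c0 *: e`_6.
Hypothesis br_else : forall i j, (i < 7)%N -> (1 < j < 7)%N ->
  lie_br e`_i e`_j = 0.
Hypothesis trace : wedge (dCE phi) phi =1 zero_form.

Let brE x y : lie_br x y =
  (c0 * (crd e 0 x * crd e 1 y - crd e 1 x * crd e 0 y)) *: e`_6.
Proof.
have zr i (u : L) : (1 < i < 7)%N -> lie_br u e`_i = 0.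
  move=> i7; rewrite [u](crd_sum eB).
  rewrite (big_morph (fun v => lie_br v e`_i) (id1 := 0) (op1 := +%R)); first last.
  - exact: lie_br0l.
  - by move=> v w; apply: lie_brDl.
  by rewrite big1 // => j _; rewrite lie_brZl br_else ?scaler0.
have zl i (u : L) : (1 < i < 7)%N -> lie_br e`_i u = 0.
  by move=> i7; rewrite lie_br_anti zr ?oppr0.
have sumE (z : L) : exists2 r : L, z = crd e 0 z *: e`_0 + (crd e 1 z *: e`_1 + r) &
    (forall u, lie_br r u = 0).
  exists (\sum_(i < 5) crd e i.+2 z *: e`_i.+2).
    rewrite {1}[z](crd_sum eB) 2!big_ord_recl /=; congr (_ + (_ + _)).
  move=> u; rewrite (big_morph (fun v => lie_br v u) (id1 := 0) (op1 := +%R)); first last.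
  - exact: lie_br0l.
  - by move=> v w; apply: lie_brDl.
  by rewrite big1 // => i _; rewrite lie_brZl zl ?scaler0 //; apply: (ltn_ord i).
have [r Ex r0] := sumE x; have [s Ey s0] := sumE y.
rewrite {1}Ex {1}Ey !(lie_brDl, lie_brDr, lie_brZl, lie_brZr) !r0.
rewrite !(lie_br_anti _ s) !s0 !lie_br_alt (lie_br_anti e`_1) br01.
rewrite !(oppr0, scaler0, addr0, add0r) -!scaleNr !scalerA -scalerDl.
by congr (_ *: _); ring.
Qed.

Lemma no_purely_coclosed_of_line : False.
Proof.
have pF := phiF.
have psi0 i j k : (1 < i < j)%N -> (j < k < 6)%N ->
    evs psi [:: e`_i; e`_j; e`_k; e`_6] = 0.
  move=> /andP[i1 ij] /andP[jk k6].
  have [j1 k1] : (1 < j)%N /\ (1 < k)%N.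
    by split; [apply: ltn_trans ij | apply: ltn_trans jk; apply: ltn_trans ij].
  have [i7 j7 k7] : [/\ (i < 7), (j < 7) & (k < 7)]%N.
    by split; do ?[exact: (ltn_trans k6) | apply: (ltn_trans ij) | apply: (ltn_trans jk)].
  (* The only nonzero bracket among these arguments is that of e_0 and e_1, so d psi reduces to one
     value of psi. *)
  have := dpsi [tuple e`_0; e`_1; e`_i; e`_j; e`_k].
  rewrite -evs_tuple /= evs_dCE4 br01 !br_else ?i1 ?j1 ?k1 //.
  rewrite !(evs0 _ psiF) evsZ // => /eqP.
  rewrite !(oppr0, addr0, subr0) oppr_eq0 mulf_eq0 (negPf c0_neq0) /= => /eqP.
  rewrite evs_swap // -(evs_contract e`_i psi) evs_swap; last exact: form_contract.
  rewrite evs_contract opprK -(evs_contract _ psi) -(evs_contract _ (contract _ psi)).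
  rewrite evs_swap; last by do 2! apply: form_contract.
  by rewrite !evs_contract => /eqP; rewrite oppr_eq0 => /eqP.
have p2345 := (psi0 2 3 4 isT isT, psi0 2 3 5 isT isT, psi0 2 4 5 isT isT,
  psi0 3 4 5 isT isT).
pose p := dual_vector; pose z := e`_6.
(* The complement of 0, 1, m consists of 6 and three of the indices 2, ..., 5. *)
have ppp m : (1 < m < 6)%N -> evs phi [:: p 0%N; p 1%N; p m] = 0.
  have [P PE] : exists P, (fun s => evs psi [seq e`_m | m <- s]) = P by eexists.
  by case: m => [|[|[|[|[|[|m]]]]]] // _; apply: phi_dual_vectors;
    rewrite // PE /coform3_seq /= !mul0r !mulr0 !addr0 !add0r -PE /= ?p2345; ring.
have bB := partial_dual_basis 6.
have bE k : (k < 6)%N -> (partial_dual 6)`_k = p k.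
  move=> k6; have k7 : (k < 7)%N by apply: leq_trans k6 _.
  by rewrite -(tnth_nth 0 _ (Ordinal k7)) tnth_mktuple /= k6.
have bE6 : (partial_dual 6)`_6 = z.
  by rewrite -(tnth_nth 0 _ (Ordinal (isT : 6 < 7)%N)) tnth_mktuple /= (tnth_nth 0).
pose c := evs phi [:: p 0%N; p 1%N; z].
(* Otherwise p_1 would lie in the kernel of the contraction of phi with p_0. *)
have c0' : c != 0.
  apply/eqP => c00; have b0 := basis_neq0 bB (isT : (0 < 7)%N).
  apply: (nondegenerate bB b0); rewrite (wedge_contract_pfaffian _ phiF) bE6.
  rewrite !(bE 0, bE 1, bE 2, bE 3, bE 4, bE 5)//.
  by rewrite !ppp // -/c c00; ring.
have alt3 x y : evs phi [:: x; y; y] = 0.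
  by rewrite -(evs_contract _ phi) evs_alt //; apply: (form_contract _ phiF).
(* The correction along p_0 and p_1 is the one that makes phi(p_0, w_m, z) and phi(p_1, w_m, z)
   vanish. *)
pose w m := p m + (evs phi [:: p 1%N; p m; z] / c *: p 0%N -
                   evs phi [:: p 0%N; p m; z] / c *: p 1%N).
have evsR x (u v t : L) a d : evs phi [:: x; u + (a *: v - d *: t); z] =
    evs phi [:: x; u; z] + (a * evs phi [:: x; v; z] - d * evs phi [:: x; t; z]).
  have F1 : is_form (contract x phi) by apply: (form_contract _ phiF).
  by rewrite -!(evs_contract _ phi) !(evsD, evsN, evsZ).
pose b := [tuple p 0%N; p 1%N; w 2; w 3; w 4; w 5; z].
have bB' : basis_of fullv b.
  rewrite basisEdim dimL size_tuple leqnn andbT -(span_basis bB).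
  have pb m : (m < 7)%N -> b`_m \in <<b>>%VS.
    by move=> m7; apply/memv_span/mem_nth; rewrite size_tuple.
  have wp m : (1 < m < 6)%N -> p m = w m + (- (evs phi [:: p 1%N; p m; z] / c) *: p 0%N +
                   (evs phi [:: p 0%N; p m; z] / c) *: p 1%N).
    move=> _; rewrite /w scaleNr -addrA addrACA subrr addNr !addr0. by [].
  have wb m : (1 < m < 6)%N -> w m \in <<b>>%VS.
    by case: m => [|[|[|[|[|[|m]]]]]] // _;
       [exact: (pb 2)|exact: (pb 3)|exact: (pb 4)|exact: (pb 5)].
  apply/span_subvP => x /(nthP 0)[m]; rewrite size_tuple => m7 <-.
  case: (ltnP m 6) => m6; last first.
    have -> : m = 6%N by apply/eqP; rewrite eqn_leq m6 -ltnS m7.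
    rewrite bE6; exact: (pb 6).
  rewrite bE //; case: m m6 {m7} => [|[|m]] m6.
  - exact: (pb 0).
  - exact: (pb 1).
  rewrite wp //; apply: memvD; first exact: wb.
  by apply: memvD; apply: memvZ; [apply: (pb 0) | apply: (pb 1)].
have [T [TE nT]] := evs_increasing3 b phiF.
have Tw k : (2 <= k < 6)%N -> b`_k = w k.
  by case: k => [|[|[|[|[|[|k]]]]]].
have T01 k : (2 <= k < 6)%N -> T 0 1 k = 0.
  move=> k6; rewrite TE (Tw k k6); change (evs phi [:: p 0%N; p 1%N; w k] = 0).
  rewrite /w.
  have F1 : is_form (contract (p 0%N) phi) by apply: (form_contract _ phiF).
  have F2 : is_form (contract (p 1%N) (contract (p 0%N) phi)) by apply: form_contract.
  rewrite -(evs_contract _ phi) -(evs_contract _ (contract _ phi)).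
  rewrite !(evsD, evsN, evsZ) // !evs_contract ppp // alt3.
  by rewrite [evs phi [:: p 0%N; p 1%N; p 0%N]]evs_swap // alt3; ring.
have T06 k : (2 <= k < 6)%N -> T 0 k 6 = 0.
  move=> k6; rewrite TE (Tw k k6); change (evs phi [:: p 0%N; w k; z] = 0).
  rewrite evsR evs_alt // -/c; field.
  exact: c0'.
have T16 k : (2 <= k < 6)%N -> T 1 k 6 = 0.
  move=> k6; rewrite TE (Tw k k6); change (evs phi [:: p 1%N; w k; z] = 0).
  rewrite evsR evs_alt // [evs phi [:: p 1%N; p 0%N; z]]evs_swap // -/c; field.
  exact: c0'.
have cE : T 0 1 6 = c by rewrite TE.
have volB i j : evs (wedge (wedge (contract b`_i phi) (contract b`_j phi)) phi) b
    = 6 * (g b`_i b`_j * evs vol b).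
  by case: metric => _ _ /(_ b`_i b`_j b) E6; rewrite !evs_tuple E6; field.
have pf0 : T 2 3 6 * T 4 5 6 - T 2 4 6 * T 3 5 6 + T 2 5 6 * T 3 4 6 != 0.
  apply/eqP => pf; apply: (nondegenerate bB' (basis_neq0 bB' (isT : 6 < 7)%N)).
  by rewrite (adapted66 nT phiF T01 T06 T16) pf mulr0.
(* z = e_6 is orthogonal to p_0, ..., p_5, and w_k is a combination of these. *)
have gwz k : (2 <= k < 6)%N -> g b`_6 b`_k = 0.
  move=> k6; rewrite metricC (Tw k k6); change (g (w k) z = 0).
  have k7 : (k < 7)%N by case/andP: k6 => _ /ltn_trans->.
  rewrite /w -scaleNr !metricDl !metricZl !metric_dual_vector /z !(crdE eB) //.
  by case: k k6 k7 => [|[|[|[|[|[|k]]]]]] //= _ _; ring.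
have B6 k : (2 <= k < 6)%N ->
    evs (wedge (wedge (contract b`_6 phi) (contract b`_k phi)) phi) b = 0.
  by move=> k6; rewrite volB gwz // mul0r mulr0.
have c3 : 3 * T 0 1 6 != 0 by rewrite mulf_neq0 ?pnatr_eq0 ?cE.
have := B6 2 isT; rewrite (adapted62 nT phiF T01 T06 T16) => /eqP.
rewrite mulf_eq0 (negPf c3) /= => /eqP e2.
have := B6 3 isT; rewrite (adapted63 nT phiF T01 T06 T16) => /eqP.
rewrite mulf_eq0 (negPf c3) /= => /eqP e3.
have := B6 4 isT; rewrite (adapted64 nT phiF T01 T06 T16) => /eqP.
rewrite mulf_eq0 (negPf c3) /= => /eqP e4.
have := B6 5 isT; rewrite (adapted65 nT phiF T01 T06 T16) => /eqP.
rewrite mulf_eq0 (negPf c3) /= => /eqP e5.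
(* Up to signs of the unknowns, [e2], ..., [e5] form a linear system whose matrix is the skew matrix
   of the [T i j 6]. Combining three of the equations leaves the Pfaffian times one unknown. *)
have r2 : T 3 4 5 = 0.
  apply: (mulfI pf0); rewrite mulr0.
  transitivity (T 4 5 6 * 0 - T 3 5 6 * 0 + T 3 4 6 * 0 : R); last by ring.
  by rewrite -{1}e3 -{1}e4 -e5; ring.
have r3 : T 2 4 5 = 0.
  apply: (mulfI pf0); rewrite mulr0.
  transitivity (T 4 5 6 * 0 - T 2 5 6 * 0 + T 2 4 6 * 0 : R); last by ring.
  by rewrite -{1}e2 -{1}e4 -e5; ring.
have r4 : T 2 3 5 = 0.
  apply: (mulfI pf0); rewrite mulr0.
  transitivity (T 3 5 6 * 0 - T 2 5 6 * 0 + T 2 3 6 * 0 : R); last by ring.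
  by rewrite -{1}e2 -{1}e3 -e5; ring.
have r5 : T 2 3 4 = 0.
  apply: (mulfI pf0); rewrite mulr0.
  transitivity (T 3 4 6 * 0 - T 2 4 6 * 0 + T 2 3 6 * 0 : R); last by ring.
  by rewrite -{1}e2 -{1}e3 -e4; ring.
have volb : evs vol b != 0.
  have [_ [_ volF [e' _ vol1]] _] := metric.
  apply/eqP => vol0; have := top_form_eq bB' volF (form0 _ _) vol0 e'.
  by rewrite vol1 => /eqP; rewrite oner_eq0.
(* Since phi vanishes on triples of the w_k, each w_k is orthogonal to p_0 and p_1. Its first two
   coordinates are then 0, so it is central. *)
have crdw i k : (i < 2)%N -> (2 <= k < 6)%N -> crd e i (w k) = 0.
  move=> i2 k6; have := volB i k.
  rewrite (adapted_orth nT phiF T01 T06 T16) // (Tw k k6) => /esym/eqP.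
  rewrite !mulf_eq0 (negPf volb) pnatr_eq0 orbF /= => /eqP.
  by case: i i2 => [|[|]] //= _; rewrite metric_dual_vector.
have crdz i : (i < 2)%N -> crd e i z = 0.
  by move=> i2; rewrite crdE //; case: i i2 => [|[|]].
(* The Gram determinant of p_0 and p_1: the i-th coordinate of p_j is their inner product with
   p_i. *)
pose kap := crd e 0 (p 0%N) * crd e 1 (p 1%N) - crd e 1 (p 0%N) * crd e 0 (p 1%N).
have kap0 : kap != 0.
  apply/eqP => k0.
  pose v := crd e 1 (p 1%N) *: p 0%N - crd e 1 (p 0%N) *: p 1%N.
  have v0 : v = 0.
    apply: metric_eq0; rewrite {1}/v -scaleNr metricDl !metricZl.
    rewrite !metric_dual_vector /v -scaleNr !crdD !crdZ.
    have -> : crd e 1 (p 0%N) = crd e 0 (p 1%N).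
      by rewrite -!metric_dual_vector metricC.
    move: k0; rewrite /kap.
    have -> : crd e 1 (p 0%N) = crd e 0 (p 1%N).
      by rewrite -!metric_dual_vector metricC.
    move=> k0; transitivity (crd e 1 (p 1%N) * 0 : R); last exact: mulr0.
    by rewrite -k0; ring.
  have : g v e`_0 = 0 by rewrite v0 metric0l.
  rewrite /v -scaleNr metricDl !metricZl !metric_dual_vector !(crdE eB) //=.
  rewrite mulr1 mulr0 addr0 -(metric_dual_vector 1) => /metric_eq0 p10.
  by have := basis_neq0 bB (isT : (1 < 7)%N); rewrite bE // -/p /p p10 eqxx.
have b6 : b`_6 = z by [].
have [b0 b1] : b`_0 = p 0%N /\ b`_1 = p 1%N by [].
clearbody b.
have := trace b; rewrite -evs_tuple.
rewrite (wedge_shuffle_basis (form_dCE phiF) phiF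
  (fun s _ => erefl) (fun s _ => erefl)) //.
have brb k x : (2 <= k < 7)%N -> lie_br x b`_k = 0.
  move=> /andP[k2 k7]; rewrite brE; have [k6|k6] := ltnP k 6.
    by rewrite (Tw k) ?k2 // !crdw ?k2 // !mulr0 subrr mulr0 scale0r.
  have -> : b`_k = z by have -> // : k = 6%N by apply/eqP; rewrite eqn_leq k6 -ltnS k7.
  by rewrite !crdz // !mulr0 subrr mulr0 scale0r.
have br01b : lie_br b`_0 b`_1 = (c0 * kap) *: b`_6.
  by rewrite b6 brE b0 b1.
rewrite [LHS]/= !evs_dCE3 !(brb 2 _ isT, brb 3 _ isT, brb 4 _ isT, brb 5 _ isT,
  brb 6 _ isT) br01b.
rewrite !(evs0 _ pF) !(evsZ _ pF) !nT /increasing3 /=.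
move=> tr0.
have : c0 * kap * (T 2 3 6 * T 4 5 6 - T 2 4 6 * T 3 5 6 + T 2 5 6 * T 3 4 6) = 0.
  apply: (mulfI (x := -2)); first by rewrite oppr_eq0 pnatr_eq0.
  by rewrite mulr0 -[RHS]tr0; ring.
by move/eqP; rewrite !mulf_eq0 (negPf c0_neq0) (negPf kap0) (negPf pf0).
Qed.

End DerivedLine.

End Obstruction.

(** * Isomorphism with the three algebras as existence of a basis *)

Section StructureConstants.
Context {R : realType}.

Definition coords (V : vectType R) (e : 7.-tuple V) (u : V) : 'rV[R]_7 :=
  \row_i crd e i u.

Lemma lie_iso_tuple (n : lieAlgebra R) df
    (dfF : forall k, is_form (tnth df k))
    (df2 : forall x y z, tuple_br df (tuple_br df x y) z = 0) :
  \dim {:n} = 7%N ->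
  lie_iso n (tuple_lieAlgebra dfF df2) <->
  exists2 e : 7.-tuple n, basis_of fullv e &
    forall u v (k : 'I_7),
      crd e k (lie_br u v) = - tnth df k [tuple coords e u; coords e v].
Proof.
move=> dim_n; split=> [[f [[f' fK f'K] fbr]]|[e eB ebr]].
  pose e := [tuple f' (delta_mx 0 i) | i < 7].
  have fe (i : 'I_7) : f (e`_i) = delta_mx 0 i.
    by rewrite -tnth_nth tnth_mktuple f'K.
  have fsum (c : 'I_7 -> R) : f (\sum_i c i *: e`_i) = \row_i c i.
    rewrite linear_sum [RHS]row_sum_delta; apply: eq_bigr => i _.
    by rewrite linearZ /= fe mxE.
  have eB : basis_of fullv e.
    rewrite basisEfree dim_n size_tuple leqnn subvf !andbT.
    apply/freeP => c c0 i.
    by have /rowP/(_ i) := fsum c; rewrite c0 linear0 !mxE.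
  have fE u : f u = coords e u.
    rewrite {1}(crd_sum eB u) fsum.
    by apply/rowP => i; rewrite !mxE.
  exists e => // u v k.
  have /rowP/(_ k) := fbr u v; rewrite !fE /= /tuple_br !mxE => ->.
  by [].
have lin : linear (coords e).
  by move=> c x y; apply/rowP => i; rewrite !mxE crdD crdZ.
pose F := GRing.isLinear.Build R n (tuple_lieAlgebra dfF df2) *:%R (coords e) lin.
pose f : {linear n -> tuple_lieAlgebra dfF df2} := HB.pack (coords e) F.
exists f; split.
  exists (fun x : 'rV[R]_7 => \sum_i x 0 i *: e`_i) => [u|x] /=.
    rewrite [RHS](crd_sum eB u); apply: eq_bigr => i _.
    by rewrite mxE.
  apply/rowP => i; rewrite mxE /crd linear_sum (bigD1 i) //= big1 => [|j ji].
    by rewrite linearZ /= -/(crd e i _) crdE // eqxx mulr1 addr0.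
  rewrite linearZ /= -/(crd e i _) crdE // (_ : (_ == _) = false) ?mulr0 //.
  by rewrite eq_sym; apply: negbTE.
by move=> u v; apply/rowP => k; rewrite /= !mxE ebr.
Qed.

Lemma cof2_coords (V : vectType R) (e : 7.-tuple V) i j u v :
  (0 < i <= 7)%N -> (0 < j <= 7)%N ->
  cof2 i j [tuple coords e u; coords e v] =
  crd e i.-1 u * crd e j.-1 v - crd e i.-1 v * crd e j.-1 u.
Proof.
case: i j => [//|i] [//|j] /= i7 j7.
by rewrite cof2E !mxE !inordK.
Qed.

Section Brackets.
Variables (n : lieAlgebra R).
Hypothesis dim_n : \dim {:n} = 7%N.

Let minor (e : 7.-tuple n) i j u v := crd e i u * crd e j v - crd e i v * crd e j u.

Lemma iso_h3R4P : lie_iso n (h3R4 R) <->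
  exists2 e : 7.-tuple n, basis_of fullv e &
    forall u v, lie_br u v = - minor e 0 1 u v *: e`_6.
Proof.
rewrite /h3R4 (lie_iso_tuple _ _ dim_n); split=> -[e eB ebr]; exists e => // u v.
  rewrite [LHS](crd_sum eB); under eq_bigr do rewrite ebr.
  rewrite !big_ord_recl big_ord0 /tnth /= !cof2_coords //.
  by rewrite /zero_form !(oppr0, scale0r, add0r, addr0).
case=> k k7; rewrite ebr crdZ [val _]/= /tnth.
do 7! [case: k k7 => [|k] k7; first by
  rewrite /= crdE //= ?cof2_coords // /zero_form ?mulr0 ?oppr0 ?mulr1].
by [].
Qed.

Lemma iso_n72AP : lie_iso n (n72A R) <->
  exists2 e : 7.-tuple n, basis_of fullv e &
    forall u v, lie_br u v = - minor e 0 1 u v *: e`_5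
                             - (minor e 0 3 u v + minor e 2 4 u v) *: e`_6.
Proof.
rewrite /n72A (lie_iso_tuple _ _ dim_n); split=> -[e eB ebr]; exists e => // u v.
  rewrite [LHS](crd_sum eB); under eq_bigr do rewrite ebr.
  rewrite !big_ord_recl big_ord0 /tnth /= !cof2_coords //.
  by rewrite /zero_form !(oppr0, scale0r, add0r, addr0) -scaleNr.
case=> k k7; rewrite ebr -[X in _ + X]scaleNr crdD !crdZ [val _]/= /tnth.
do 7! [case: k k7 => [|k] k7; first by
  rewrite /= !crdE //= ?cof2_coords // /zero_form ?mulr0 ?oppr0 ?mulr1
    ?add0r ?addr0].
by [].
Qed.

Lemma iso_n72BP : lie_iso n (n72B R) <->
  exists2 e : 7.-tuple n, basis_of fullv e &
    forall u v, lie_br u v = - (minor e 0 1 u v + minor e 2 3 u v) *: e`_5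
                             - (minor e 0 4 u v + minor e 1 2 u v) *: e`_6.
Proof.
rewrite /n72B (lie_iso_tuple _ _ dim_n); split=> -[e eB ebr]; exists e => // u v.
  rewrite [LHS](crd_sum eB); under eq_bigr do rewrite ebr.
  rewrite !big_ord_recl big_ord0 /tnth /= !cof2_coords //.
  by rewrite /zero_form !(oppr0, scale0r, add0r, addr0) -scaleNr.
case=> k k7; rewrite ebr -[X in _ + X]scaleNr crdD !crdZ [val _]/= /tnth.
do 7! [case: k k7 => [|k] k7; first by
  rewrite /= !crdE //= ?cof2_coords // /zero_form ?mulr0 ?oppr0 ?mulr1
    ?add0r ?addr0].
by [].
Qed.

End Brackets.

End StructureConstants.

(** * The three algebras without purely coclosed structures *)

Section NonExistence.
Context {R : realType}.
Variable n : lieAlgebra R.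
Hypothesis dim_n : \dim {:n} = 7%N.

Lemma form4_cycle (w : kfun n 4) a b c d : is_form w ->
  evs w [:: a; b; c; d] = evs w [:: b; c; a; d].
Proof.
move=> F; rewrite evs_swap // -!(evs_contract _ w) evs_swap ?opprK //.
exact: form_contract.
Qed.

Lemma form4_swap_last (w : kfun n 4) a b c d : is_form w ->
  evs w [:: a; b; c; d] = - evs w [:: a; b; d; c].
Proof.
move=> F; have F1 := form_contract a F; have F2 := form_contract b F1.
by rewrite -!(evs_contract _ w) -!(evs_contract _ (contract _ w)) evs_swap.
Qed.

Lemma form4_alt_ends (w : kfun n 4) a b c : is_form w ->
  evs w [:: a; b; c; a] = 0.
Proof.
move=> F; rewrite form4_cycle //.
have F1 := form_contract b F; have F2 := form_contract c F1.
by rewrite -!(evs_contract _ w) -!(evs_contract _ (contract _ w)) evs_alt.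
Qed.

Lemma h3R4_no_purely_coclosed (phi : kfun n 3) :
  lie_iso n (h3R4 R) -> ~ purely_coclosed_G2 phi.
Proof.
case/(iso_h3R4P dim_n) => e eB brE [G2 [g [vol [psi [M [psiF [E EO H]] dpsi]]]] tr].
apply: (no_purely_coclosed_of_line G2 M EO H psiF dpsi eB (c0 := -1)) => //.
- by rewrite oppr_eq0 oner_eq0.
- by rewrite brE !(crdE eB) //= mulr1 mulr0 subr0.
move=> i j i7 /andP[j1 j7]; rewrite brE !(crdE eB) //.
by case: j j1 j7 => [|[|j]] // _ _; rewrite mulr0 mul0r subrr oppr0 scale0r.
Qed.

Section DerivedPlane.
Variables (e : 7.-tuple n) (psi : kfun n 4) (al be : nat -> nat -> R).
Hypothesis psiF : is_form psi.
Hypothesis dpsi : dCE psi =1 zero_form.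
Hypothesis brE : forall i j, (i < 7)%N -> (j < 7)%N ->
  lie_br e`_i e`_j = al i j *: e`_5 + be i j *: e`_6.
Hypothesis cen : forall i j, (i < 7)%N -> (4 < j < 7)%N -> lie_br e`_i e`_j = 0.

Let t k l := evs psi [:: e`_k; e`_l; e`_5; e`_6].

(** Inserting the central vector e_h in d psi removes the e_h component of every bracket, because
    psi is alternating. What is left says that the 2-form [t] satisfies al /\ t = 0 (h = 6) and be
    /\ t = 0 (h = 5). *)
Lemma closed_relation ga h : (ga = al) /\ (h = 6%N) \/ (ga = be) /\ (h = 5%N) ->
  forall a b c d, (a < 5)%N -> (b < 5)%N -> (c < 5)%N -> (d < 5)%N ->
  ga a b * t c d - ga a c * t b d + ga a d * t b c
  + ga b c * t a d - ga b d * t a c + ga c d * t a b = 0.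
Proof.
move=> gah a b c d a5 b5 c5 d5.
have lt7 i : (i < 5)%N -> (i < 7)%N by move=> i5; apply: leq_trans i5 _.
have [a7 b7 c7 d7] : [/\ (a < 7), (b < 7), (c < 7) & (d < 7)]%N by rewrite !lt7.
have t5 k l : evs psi [:: e`_5; e`_k; e`_l; e`_6] = t k l.
  by rewrite form4_cycle.
have t6 k l : evs psi [:: e`_6; e`_k; e`_l; e`_5] = - t k l.
  by rewrite form4_cycle // form4_swap_last.
have h7 : (4 < h < 7)%N by case: gah => -[_ ->].
have d0 : dCE psi [tuple e`_a; e`_b; e`_c; e`_d; e`_h] = 0 by exact: dpsi.
rewrite -evs_tuple evs_dCE4 !(cen _ h7) // !(evs0 _ psiF) !brE // in d0.
rewrite !(evsD _ psiF, evsZ _ psiF) in d0.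
case: gah d0 {h7} => -[-> ->]; rewrite ?t5 ?t6 !(form4_alt_ends _ _ _ psiF) => d0.
  by apply: oppr_inj; rewrite oppr0 -[RHS]d0; ring.
by rewrite -[RHS]d0; ring.
Qed.

End DerivedPlane.

Lemma n72A_no_purely_coclosed (phi : kfun n 3) :
  lie_iso n (n72A R) -> ~ purely_coclosed_G2 phi.
Proof.
case/(iso_n72AP dim_n) => e eB brE [G2 [g [vol [psi [M [psiF [E EO H]] dpsi]]]] _].
pose d i j : R := (i == j :> nat)%:R.
pose al i j : R := - (d 0 i * d 1 j - d 0 j * d 1 i).
pose be i j : R := - (d 0 i * d 3 j - d 0 j * d 3 i + (d 2 i * d 4 j - d 2 j * d 4 i)).
have br i j : (i < 7)%N -> (j < 7)%N ->
    lie_br e`_i e`_j = al i j *: e`_5 + be i j *: e`_6.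
  by move=> i7 j7; rewrite brE !(crdE eB) // [be i j *: _]scaleNr.
have cen i j : (i < 7)%N -> (4 < j < 7)%N -> lie_br e`_i e`_j = 0.
  move=> i7 /andP[j4 j7]; rewrite br //.
  case: j j4 j7 => [|[|[|[|[|j]]]]] // _ _.
  by rewrite /al /be /d /= !(mulr0, mul0r, subr0, addr0, oppr0, scale0r).
have Ral := closed_relation psiF dpsi br cen (or_introl (conj erefl erefl)).
have Rbe := closed_relation psiF dpsi br cen (or_intror (conj erefl erefl)).
apply: (no_G2_of_rank2 G2 M EO H psiF eB).
(* Each of these six relations contains a single [t k l] with 0 < k < l, so [t] is divisible by
   e^0. *)
have := (Ral 0 1 2 3 isT isT isT isT, Ral 0 1 2 4 isT isT isT isT,
  Ral 0 1 3 4 isT isT isT isT, Rbe 0 1 2 3 isT isT isT isT,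
  Rbe 0 1 3 4 isT isT isT isT, Rbe 1 2 3 4 isT isT isT isT).
rewrite /al /be /d /= => -[[[[[r1 r2] r3] r4] r5] r6] k l.
case: k l => [|[|[|[|k]]]] // [|[|[|[|[|l]]]]] // _ _.
- by apply: oppr_inj; rewrite oppr0 -[RHS]r4; ring.
- by rewrite -[RHS]r6; ring.
- by rewrite -[RHS]r5; ring.
- by apply: oppr_inj; rewrite oppr0 -[RHS]r1; ring.
- by apply: oppr_inj; rewrite oppr0 -[RHS]r2; ring.
by apply: oppr_inj; rewrite oppr0 -[RHS]r3; ring.
Qed.

Lemma n72B_no_purely_coclosed (phi : kfun n 3) :
  lie_iso n (n72B R) -> ~ purely_coclosed_G2 phi.
Proof.
case/(iso_n72BP dim_n) => e eB brE [G2 [g [vol [psi [M [psiF [E EO H]] dpsi]]]] _].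
pose d i j : R := (i == j :> nat)%:R.
pose al i j : R := - (d 0 i * d 1 j - d 0 j * d 1 i + (d 2 i * d 3 j - d 2 j * d 3 i)).
pose be i j : R := - (d 0 i * d 4 j - d 0 j * d 4 i + (d 1 i * d 2 j - d 1 j * d 2 i)).
have br i j : (i < 7)%N -> (j < 7)%N ->
    lie_br e`_i e`_j = al i j *: e`_5 + be i j *: e`_6.
  by move=> i7 j7; rewrite brE !(crdE eB) // [be i j *: _]scaleNr.
have cen i j : (i < 7)%N -> (4 < j < 7)%N -> lie_br e`_i e`_j = 0.
  move=> i7 /andP[j4 j7]; rewrite br //.
  case: j j4 j7 => [|[|[|[|[|j]]]]] // _ _.
  by rewrite /al /be /d /= !(mulr0, mul0r, subr0, addr0, oppr0, scale0r).
have Ral := closed_relation psiF dpsi br cen (or_introl (conj erefl erefl)).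
have Rbe := closed_relation psiF dpsi br cen (or_intror (conj erefl erefl)).
apply: (no_G2_of_rank2 G2 M EO H psiF eB).
have := (Ral 0 1 2 4 isT isT isT isT, Ral 0 2 3 4 isT isT isT isT,
  Ral 1 2 3 4 isT isT isT isT, Rbe 0 1 2 4 isT isT isT isT,
  Rbe 0 1 3 4 isT isT isT isT, Rbe 0 2 3 4 isT isT isT isT,
  Rbe 1 2 3 4 isT isT isT isT).
rewrite /al /be /d /= => -[[[[[[r1 r2] r3] r4] r5] r6] r7] k l.
case: k l => [|[|[|[|k]]]] // [|[|[|[|[|l]]]]] // _ _.
(* The relation [r4] only gives t 1 2 + t 0 4 = 0, and [r2] gives t 0 4 = 0. *)
- by rewrite -[RHS](subr0 0) -{1}r2 -r4; ring.
- by apply: oppr_inj; rewrite oppr0 -[RHS]r5; ring.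
- by apply: oppr_inj; rewrite oppr0 -[RHS]r3; ring.
- by apply: oppr_inj; rewrite oppr0 -[RHS]r6; ring.
- by apply: oppr_inj; rewrite oppr0 -[RHS]r1; ring.
by apply: oppr_inj; rewrite oppr0 -[RHS]r7; ring.
Qed.

End NonExistence.

(** * Derived algebra of dimension one *)

Section SkewForms.
Context {R : realType} {V : vectType R}.

Definition skew (al : V -> V -> R) : Prop :=
  (forall y, scalar (fun x => al x y)) /\ (forall x y, al x y = - al y x).

Lemma span_ind (P : V -> Prop) (s : seq V) :
  P 0 -> (forall c x y, P x -> P y -> P (c *: x + y)) ->
  (forall x, x \in s -> P x) -> forall x, x \in <<s>>%VS -> P x.
Proof.
move=> P0 Plin Ps x; rewrite -(in_tupleE s) => /coord_span ->.
elim/big_rec: _ => // i y _ Py; apply: Plin => //.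
by apply: Ps; rewrite mem_nth.
Qed.

Lemma exists_span (U : {vspace V}) : exists s : (\dim U).-tuple V, U = <<s>>%VS.
Proof. by exists (vbasis U); rewrite (span_basis (vbasisP U)). Qed.

Section Fixed.
Variable al : V -> V -> R.
Hypothesis alS : skew al.

Lemma skew0l y : al 0 y = 0.
Proof.
have [lin _] := alS; have /eqP := lin y 1 0 0; rewrite scaler0 addr0 mul1r.
by rewrite -subr_eq0 opprD addrA subrr sub0r oppr_eq0 => /eqP.
Qed.

Lemma skewDl x y z : al (x + y) z = al x z + al y z.
Proof. by have [lin _] := alS; have := lin z 1 x y; rewrite scale1r mul1r. Qed.

Lemma skewZl c x z : al (c *: x) z = c * al x z.
Proof. by have [lin _] := alS; have := lin z c x 0; rewrite skew0l !addr0. Qed.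

Lemma skewC x y : al x y = - al y x. Proof. by case: alS. Qed.

Lemma skew_alt x : al x x = 0.
Proof. by have /eqP := skewC x x; rewrite -addr_eq0 -mulr2n mulrn_eq0 => /eqP. Qed.

Lemma skew0r y : al y 0 = 0. Proof. by rewrite skewC skew0l oppr0. Qed.

Lemma skewDr x y z : al z (x + y) = al z x + al z y.
Proof. by rewrite skewC skewDl opprD -!(skewC z). Qed.

Lemma skewZr c x z : al z (c *: x) = c * al z x.
Proof. by rewrite skewC skewZl -mulrN -skewC. Qed.

Lemma skewNl x z : al (- x) z = - al x z.
Proof. by rewrite -scaleN1r skewZl mulN1r. Qed.

Lemma skewNr x z : al z (- x) = - al z x.
Proof. by rewrite -scaleN1r skewZr mulN1r. Qed.

Definition skewE := (skewDl, skewDr, skewNl, skewNr, skewZl, skewZr, skew0l,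
  skew0r, skew_alt).

Lemma skew_span (s : seq V) y :
  (forall x, x \in s -> al x y = 0) -> forall x, x \in <<s>>%VS -> al x y = 0.
Proof.
move=> h; apply: span_ind => //; first exact: skew0l.
by move=> c x z hx hz; rewrite skewDl skewZl hx hz mulr0 addr0.
Qed.

(** One step of symplectic Gram-Schmidt. Iterated, it yields a Darboux basis, and the stage at which
    it stops is the rank. *)
Lemma symplectic_step (U : {vspace V}) :
  (forall x y, x \in U -> y \in U -> al x y = 0) \/
  exists x y U', [/\ x \in U, y \in U & al x y = 1] /\
    [/\ (U' <= U)%VS, forall u, u \in U' -> al x u = 0 /\ al y u = 0,
        U = (<<[:: x; y]>> + U')%VS & \dim U = (\dim U').+2].
Proof.
have [h|/boolp.existsNP[x /boolp.existsNP[y /boolp.not_implyP[xU]]]] :=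
    boolp.EM (forall x y, x \in U -> y \in U -> al x y = 0); first by left.
move=> /boolp.not_implyP[yU /eqP xy0]; right.
pose x' := (al x y)^-1 *: x.
have x'U : x' \in U by apply: memvZ.
have xy1 : al x' y = 1 by rewrite skewZl mulVf.
have yx1 : al y x' = -1 by rewrite skewC xy1.
move: x' x'U xy1 yx1 => {xy0} {x xU} x xU xy1 yx1.
(* Projection along the plane of [x] and [y] onto its [al]-orthogonal. *)
pose p u := u + (al y u *: x - al x u *: y).
have pP u : al x (p u) = 0 /\ al y (p u) = 0.
  by rewrite /p !skewE xy1 yx1; split; ring.
have pU u : u \in U -> p u \in U.
  by move=> uU; rewrite memvD // memvB // memvZ.
pose U' := <<map p (vbasis U)>>%VS.
have U'P u : u \in U' -> al x u = 0 /\ al y u = 0.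
  rewrite ![al _ u]skewC => uU'; split; apply/eqP; rewrite oppr_eq0; apply/eqP.
    by apply: skew_span uU' => _ /mapP[v _ ->]; rewrite skewC (pP v).1 oppr0.
  by apply: skew_span uU' => _ /mapP[v _ ->]; rewrite skewC (pP v).2 oppr0.
have U'U : (U' <= U)%VS.
  by apply/span_subvP => _ /mapP[v vU ->]; apply: pU; apply: vbasis_mem.
have eU : U = (<<[:: x; y]>> + U')%VS.
  apply/eqP; rewrite eqEsubv subv_add U'U andbT; apply/andP; split; last first.
    by apply/span_subvP => v; rewrite !inE => /orP[]/eqP->.
  rewrite -{1}(span_basis (vbasisP U)); apply/span_subvP => v vU.
  have -> : v = (al x v *: y - al y v *: x) + p v.
    by rewrite /p -(opprB (al x v *: y)) addrCA subrr addr0.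
  apply: memv_add; last by apply: memv_span; apply: map_f.
  by apply: memvB; apply: memvZ; apply: memv_span; rewrite !inE eqxx ?orbT.
exists x, y, U'; split=> //; split=> //.
have fxy : free [:: x; y].
  rewrite free_cons span_seq1 free_cons span_nil memv0 nil_free andbT.
  apply/andP; split; last by apply: contra_eq_neq xy1 => ->; rewrite skew0r eq_sym oner_neq0.
  apply: contra_eqN xy1 => /vlineP[k ->]; rewrite skewZl skew_alt mulr0.
  by rewrite eq_sym oner_neq0.
rewrite {1}eU dimv_disjoint_sum; first by move: fxy; rewrite /free => /eqP->.
apply/eqP; rewrite -subv0; apply/subvP => v /memv_capP[].
rewrite span_cons span_seq1 => /memv_addP[_ /vlineP[a ->] [_ /vlineP[b ->] ->]].
move=> /U'P[]; rewrite !skewE xy1 yx1 => h1 h2.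
have -> : b = 0 by rewrite -h1; ring.
have -> : a = 0 by apply: oppr_inj; rewrite oppr0 -h2; ring.
by rewrite !scale0r addr0 mem0v.
Qed.

End Fixed.

End SkewForms.

(** * The derived algebra as a subspace *)

Section DerivedAlgebra.
Context {R : realType}.
Variable n : lieAlgebra R.
Implicit Types x y z : n.

Definition derived : {vspace n} :=
  <<[seq lie_br x y | x <- vbasis {:n}, y <- vbasis {:n}]>>%VS.

Lemma lie_br_in_span (s t : seq n) (U : {vspace n}) :
  (forall x y, x \in s -> y \in t -> lie_br x y \in U) ->
  forall x y, x \in <<s>>%VS -> y \in <<t>>%VS -> lie_br x y \in U.
Proof.
move=> h x y xs; move: y.
apply: span_ind; first by rewrite lie_br0r mem0v.
  by move=> c y z hy hz; rewrite lie_brDr lie_brZr memvD // memvZ.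
move=> y yt; move: x xs; apply: span_ind; first by rewrite lie_br0l mem0v.
  by move=> c x z hx hz; rewrite lie_brDl lie_brZl memvD // memvZ.
by move=> x xs; apply: h.
Qed.

Lemma lie_br_derived x y : lie_br x y \in derived.
Proof.
have eb : <<vbasis {:n}>>%VS = fullv := span_basis (vbasisP _).
apply: (@lie_br_in_span (vbasis {:n}) (vbasis {:n})); rewrite ?eb ?memvf //.
by move=> u v ub vb; apply: memv_span; apply: allpairs_f.
Qed.

Hypothesis n2 : two_step_nilpotent n.

Lemma derived_central z x : z \in derived -> lie_br x z = 0.
Proof.
rewrite /derived; move: z; apply: span_ind; first exact: lie_br0r.
  by move=> c y z hy hz; rewrite lie_brDr lie_brZr hy hz scaler0 addr0.
move=> _ /allpairsP[[u v] /= [_ _ ->]]; rewrite lie_br_anti.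
have [_ cen] := n2; rewrite cen ?oppr0 //.
by exists [:: (u, v)]; rewrite big_seq1.
Qed.

Lemma derived_neq0 : \dim derived != 0%N.
Proof.
rewrite dimv_eq0; apply/eqP => d0; have [ab _] := n2; apply: ab => x y.
by have := lie_br_derived x y; rewrite d0 memv0 => /eqP.
Qed.

End DerivedAlgebra.

Section BracketsOnABasis.
Context {R : realType}.
Variable n : lieAlgebra R.
Hypothesis dim_n : \dim {:n} = 7%N.

Lemma basis_of_span (s : seq n) : size s = 7%N -> (fullv <= <<s>>)%VS ->
  exists e : 7.-tuple n, s = e /\ basis_of fullv e.
Proof.
move=> s7 full; exists (tcast s7 (in_tuple s)).
by rewrite val_tcast; split=> //; rewrite basisEdim full dim_n /= s7.
Qed.

Lemma skewD (V : vectType R) (f g : V -> V -> R) :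
  skew f -> skew g -> skew (fun u v => f u v + g u v).
Proof.
move=> [fl fa] [gl ga]; split=> [y c x z|x y].
  by rewrite fl gl mulrDr addrACA.
by rewrite fa ga opprD.
Qed.

Lemma skewZ (V : vectType R) c (f : V -> V -> R) :
  skew f -> skew (fun u v => c * f u v).
Proof.
move=> [fl fa]; split=> [y d x z|x y]; first by rewrite fl mulrDr mulrCA.
by rewrite fa mulrN.
Qed.

Lemma skew_minor (V : vectType R) (e : 7.-tuple V) i j :
  skew (fun u v => crd e i u * crd e j v - crd e i v * crd e j u).
Proof.
by split=> [y c x z|x y]; rewrite ?crdD ?crdZ; ring.
Qed.

Lemma lie_br_ext (e : 7.-tuple n) (f g : n -> n -> R) (w w' : n) :
  basis_of fullv e -> skew f -> skew g ->
  (forall i j, (i < j < 7)%N ->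
     lie_br e`_i e`_j = f e`_i e`_j *: w + g e`_i e`_j *: w') ->
  forall u v, lie_br u v = f u v *: w + g u v *: w'.
Proof.
move=> eB fS gS h u v.
have all_ij i j : (i < 7)%N -> (j < 7)%N ->
    lie_br e`_i e`_j = f e`_i e`_j *: w + g e`_i e`_j *: w'.
  move=> i7 j7; case: (ltngtP i j) => [ij|ji|->]; first by rewrite h ?ij.
    by rewrite lie_br_anti h ?ji // (skewC fS e`_i) (skewC gS e`_i) !scaleNr opprD.
  by rewrite lie_br_alt !skew_alt // !scale0r addr0.
have eF : <<e>>%VS = fullv := span_basis eB.
have : v \in <<e>>%VS by rewrite eF memvf.
move: v; apply: span_ind; first by rewrite lie_br0r !skew0r // !scale0r addr0.
  move=> c x y hx hy; rewrite lie_brDr lie_brZr hx hy !skewDr // !skewZr //.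
  by rewrite scalerDr !scalerA addrACA -!scalerDl.
move=> x /(nthP 0)[j]; rewrite size_tuple => j7 <- {x}.
have : u \in <<e>>%VS by rewrite eF memvf.
move: u; apply: span_ind; first by rewrite lie_br0l !skew0l // !scale0r addr0.
  move=> c x y hx hy; rewrite lie_brDl lie_brZl hx hy !skewDl // !skewZl //.
  by rewrite scalerDr !scalerA addrACA -!scalerDl.
by move=> x /(nthP 0)[i]; rewrite size_tuple => i7 <-; apply: all_ij.
Qed.

(* [M] is the symmetric traceless matrix with diagonal [m11], [m22],
   [- (m11 + m22)]. *)
Lemma purely_coclosed_of_matrix (v1 v2 v3 v4 z1 z2 z3 : n)
    (m11 m12 m13 m22 m23 : R) :
  (fullv <= <<[:: v1; v2; v3; v4; z1; z2; z3]>>)%VS ->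
  (forall x z, z \in [:: z1; z2; z3] -> lie_br x z = 0) ->
  (forall x y, lie_br x y \in <<[:: z1; z2; z3]>>%VS) ->
  lie_br v1 v3 - lie_br v2 v4 = m11 *: z1 + m12 *: z2 + m13 *: z3 ->
  - (lie_br v1 v4 + lie_br v2 v3) = m12 *: z1 + m22 *: z2 + m23 *: z3 ->
  lie_br v1 v2 + lie_br v3 v4 = m13 *: z1 + m23 *: z2 + (- m11 - m22) *: z3 ->
  exists phi : kfun n 3, purely_coclosed_G2 phi.
Proof.
move=> /basis_of_span -/(_ erefl)[e [es eB]] cen low s1 s2 s3.
exists (phi0 e).
have ei i : e`_i = [:: v1; v2; v3; v4; z1; z2; z3]`_i by rewrite es.
have [e0 e1 e2 e3] : [/\ e`_0 = v1, e`_1 = v2, e`_2 = v3 & e`_3 = v4].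
  by rewrite !ei.
have [e4 e5 e6] : [/\ e`_4 = z1, e`_5 = z2 & e`_6 = z3] by rewrite !ei.
apply: (purely_coclosed_4_3 eB).
- move=> k x; rewrite ei => /andP[k4 k7]; apply: cen.
  by case: k k4 k7 => [|[|[|[|[|[|[|k]]]]]]] // _ _; rewrite !inE eqxx ?orbT.
- move=> i j m i4 j4 m4; apply: (@span_ind _ _ (fun x => crd e m x = 0)
    [:: z1; z2; z3]); last exact: low.
  + exact: crd0.
  + by move=> c x y hx hy; rewrite crdD crdZ hx hy mulr0 addr0.
  + have m7 : (m < 7)%N by apply: ltn_trans m4 _.
    move=> x; rewrite -e4 -e5 -e6 !inE => /or3P[]/eqP->; rewrite crdE //;
    by case: m m4 {m7} => [|[|[|[|m]]]].
all: rewrite e0 e1 e2 e3 ?s1 ?s2 ?s3 -?e4 -?e5 -?e6 !crdD !crdZ !(crdE eB) //=; ring.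
Qed.

End BracketsOnABasis.

Section DerivedLine.
Context {R : realType}.
Variable n : lieAlgebra R.
Hypothesis dim_n : \dim {:n} = 7%N.
Hypothesis n2 : two_step_nilpotent n.
Variable z : n.
Hypothesis z0 : z != 0.
Hypothesis dz : derived n = <[z]>%VS.

Lemma lie_br_line : exists2 al, skew al & forall x y, lie_br x y = al x y *: z.
Proof.
pose al x y := coord [tuple z] 0 (lie_br x y).
have alE x y : lie_br x y = al x y *: z.
  have : lie_br x y \in <<[tuple z]>>%VS by rewrite span_seq1 -dz lie_br_derived.
  by move/coord_span; rewrite big_ord1.
exists al => //; split=> [y c u v|x y].
  by rewrite /al lie_brDl lie_brZl linearD linearZ.
by rewrite /al lie_br_anti linearN.
Qed.

Lemma span_line_compl (U : {vspace n}) k : z \in U -> \dim U = k.+1 ->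
  exists s : seq n, size s = k /\ U = (<<s>> + <[z]>)%VS.
Proof.
move=> zU dU; have zUs : (<[z]> <= U)%VS by rewrite -memvE.
have [s es] := exists_span (U :\: <[z]>).
exists s; rewrite -es size_tuple; split.
  apply/eqP; rewrite -(eqn_add2l 1); apply/eqP.
  have := dimv_cap_compl U <[z]>; rewrite (capv_idPr zUs) dim_vline z0 dU.
  by [].
by rewrite addv_diff; apply/esym/addv_idPl.
Qed.

Lemma classification_line :
  lie_iso n (h3R4 R) \/ exists phi : kfun n 3, purely_coclosed_G2 phi.
Proof.
have [al alS brE] := lie_br_line.
have cz x : lie_br x z = 0.
  by apply: (derived_central n2); rewrite dz memv_line.
have alz x : al x z = 0.
  by have /eqP := cz x; rewrite brE scaler_eq0 (negPf z0) orbF => /eqP.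
(* [z] lies in the radical, so pairing it with [x] and [y] shows that it has no component in the
   hyperbolic plane and survives every splitting. *)
have zin (U U' : {vspace n}) x y : z \in U -> al x y = 1 ->
    (forall u, u \in U' -> al x u = 0 /\ al y u = 0) ->
    U = (<<[:: x; y]>> + U')%VS -> z \in U'.
  move=> + xy al' eU; rewrite eU span_cons span_seq1.
  case/memv_addP=> _ /memv_addP[_ /vlineP[a ->] [_ /vlineP[b ->] ->]] [u uU' ez].
  have [xu yu] := al' u uU'; have yx : al y x = -1 by rewrite skewC // xy.
  have := alz x; rewrite ez !skewE // xu xy => h1.
  have := alz y; rewrite ez !skewE // yu yx => h2.
  have b0 : b = 0 by rewrite -h1; ring.
  have a0 : a = 0 by apply: oppr_inj; rewrite oppr0 -h2; ring.
  by rewrite a0 b0 !scale0r !add0r.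
have [al0|[x1 [y1 [U1 [[_ _ xy1] [_ al1 eU1 dU1]]]]]] := symplectic_step alS fullv.
  have [ab _] := n2; case: ab => x y.
  by rewrite brE al0 ?memvf // scale0r.
have zU1 := zin _ _ _ _ (memvf z) xy1 al1 eU1.
have d1 : \dim U1 = 5%N by move: dU1; rewrite dim_n => -[].
have alN x y : al x y = - al y x by apply: skewC.
have [al0|[x2 [y2 [U2 [[x2U y2U xy2] [sU2 al2 eU2 dU2]]]]]] := symplectic_step alS U1.
  left; apply/iso_h3R4P => //.
  have [s [s4 es]] := span_line_compl zU1 d1.
  case: s s4 es => [|s0 [|s1 [|s2 [|s3 [|]]]]] // _ es.
  (* The sign of the last vector comes from the convention d f(x, y) = - f([x, y]). *)
  pose l := [:: x1; y1; s0; s1; s2; s3; - z].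
  have full : (fullv <= <<l>>)%VS.
    rewrite eU1 es !subv_add !sub_span /=.
    - by rewrite -memvE -memvN memv_span // !inE eqxx !orbT.
    - by apply/allP; rewrite /= !inE !eqxx !orbT.
    - by apply/allP; rewrite /= !inE !eqxx !orbT.
  have [e [ee eB]] := basis_of_span (s := l) dim_n erefl full.
  have ei i : e`_i = l`_i by rewrite ee.
  have e6 : e`_6 = - z by rewrite ei.
  have sU1 u : u \in [:: s0; s1; s2; s3; - z] -> u \in U1.
    rewrite -[[:: _; _; _; _; _]]/([:: s0; s1; s2; s3] ++ [:: - z]) mem_cat mem_seq1.
    case/orP=> [us|/eqP->]; last by rewrite memvN.
    by rewrite es; apply: (subvP (addvSl _ _)); apply: memv_span.
  have eU j : (1 < j < 7)%N -> e`_j \in U1.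
    by rewrite ei => /andP[j1 j7]; apply: sU1;
      case: j j1 j7 => [|[|[|[|[|[|[|j]]]]]]] // _ _; rewrite !inE eqxx ?orbT.
  have fS := skewZ (-1) (skew_minor e 0 1).
  exists e => // u v; rewrite (lie_br_ext eB fS fS (w := e`_6) (w' := 0)).
    by rewrite scaler0 addr0 mulN1r.
  move=> i j /andP[ij j7]; rewrite scaler0 addr0 brE.
  have i7 := ltn_trans ij j7; rewrite !(crdE eB) // e6 scalerN -scaleNr.
  congr (_ *: _); case: i ij i7 => [|[|i]] ij i7.
  - have [->|j1] := eqVneq j 1%N; first by rewrite !ei xy1 /=; ring.
    have j2 : (1 < j < 7)%N by rewrite j7 andbT ltn_neqAle eq_sym j1.
    have [-> _] : al e`_0 e`_j = 0 /\ True.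
      by split=> //; rewrite (ei 0%N); have [] := al1 _ (eU _ j2).
    by case: j j1 j2 {ij j7} => [|[|j]] //= _ _; ring.
  - have j2 : (1 < j < 7)%N by rewrite j7 ij.
    have -> : al e`_1 e`_j = 0 by rewrite (ei 1%N); have [] := al1 _ (eU _ j2).
    by case: j j2 {ij j7} => [|[|j]] //= _; ring.
  rewrite al0 ?eU ?i7 ?j7 ?andbT // ?(leq_trans _ ij) //=; ring.
right.
have d2 : \dim U2 = 3%N by move: dU2; rewrite d1 => -[].
have zU2 := zin _ _ _ _ zU1 xy2 al2 eU2.
have x1_U1 u : u \in U1 -> al x1 u = 0 by move=> /al1[].
have y1_U1 u : u \in U1 -> al y1 u = 0 by move=> /al1[].
have [al0|[x3 [y3 [U3 [[x3U y3U xy3] [sU3 al3 eU3 dU3]]]]]] := symplectic_step alS U2.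
  have [s es] := exists_span U2.
  have s3 : size s = 3%N by rewrite size_tuple d2.
  case: {s} (val s) s3 es => [|s0 [|s1 [|s2 [|]]]] // _ es.
  have full : (fullv <= <<[:: x1; y1; y2; x2; s0; s1; s2]>>)%VS.
    rewrite eU1 eU2 es !subv_add !sub_span //.
    - by apply/allP; rewrite /= !inE !eqxx !orbT.
    - by apply/allP; rewrite /= !inE !eqxx !orbT.
    - by apply/allP; rewrite /= !inE !eqxx !orbT.
  have sU2' u : u \in [:: s0; s1; s2] -> u \in U2.
    by rewrite es; apply: memv_span.
  (* Reversing the second pair turns the bracket form into e^12 - e^34, which is anti-self-dual. All
     contracted brackets vanish and M = 0 serves. *)
  apply: (@purely_coclosed_of_matrix _ n dim_n x1 y1 y2 x2 s0 s1 s2 0 0 0 0 0 full).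
  - move=> x u /sU2' uU2; have uU1 := subvP sU2 _ uU2.
    rewrite brE (_ : al x u = 0) ?scale0r //.
    apply: (skew_span alS _ (subvP full x (memvf x))) => v.
    rewrite -[[:: _; _; _; _; _; _; _]]/([:: x1; y1; y2; x2] ++ [:: s0; s1; s2]).
    rewrite mem_cat => /orP[|/sU2' vU]; last exact: al0.
    have [xu yu] := al2 u uU2.
    by rewrite !inE => /or4P[] /eqP-> //; [apply: x1_U1|apply: y1_U1].
  - by move=> x y; rewrite -es brE memvZ.
  - by rewrite !brE x1_U1 // y1_U1 // !scale0r !addr0 subr0.
  - by rewrite !brE x1_U1 // y1_U1 // !scale0r !addr0 oppr0.
  by rewrite !brE xy1 (alN y2) xy2 subr0 oppr0 !scale0r !addr0 scale1r scaleN1r subrr.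
have d3 : \dim U3 = 1%N by move: dU3; rewrite d2 => -[].
have zU3 := zin _ _ _ _ zU2 xy3 al3 eU3.
have eU3z : U3 = <[z]>%VS.
  by apply/esym/eqP; rewrite eqEdim -memvE zU3 d3 dim_vline z0.
(* Rescaling [y3] makes the form primitive, as [purely_coclosed_6_1] requires. *)
pose l := [:: x1; y1; x2; y2; x3; -2 *: y3; z].
have full : (fullv <= <<l>>)%VS.
  have l1 : (<<[:: x1; y1]>> <= <<l>>)%VS.
    by apply/sub_span/allP; rewrite /= !inE !eqxx !orbT.
  have l2 : (<<[:: x2; y2]>> <= <<l>>)%VS.
    by apply/sub_span/allP; rewrite /= !inE !eqxx !orbT.
  have lz : (<[z]> <= <<l>>)%VS.
    by rewrite -memvE memv_span // !inE eqxx !orbT.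
  have l3 : (<<[:: x3; y3]>> <= <<l>>)%VS.
    apply/span_subvP => u; rewrite !inE => /orP[]/eqP->.
      by rewrite memv_span // !inE eqxx !orbT.
    have -> : y3 = (-2)^-1 *: (-2 *: y3).
      by rewrite scalerA mulVf ?scale1r // oppr_eq0 pnatr_eq0.
    by rewrite memvZ // memv_span // !inE eqxx !orbT.
  by rewrite eU1 eU2 eU3 eU3z !subv_add l1 l2 l3 lz.
have [e [ee eB]] := basis_of_span (s := l) dim_n erefl full.
have ei i : e`_i = l`_i by rewrite ee.
exists (phi0 e); apply: (purely_coclosed_6_1 eB).
- by rewrite !ei brE xy1 scale1r.
- by rewrite !ei brE xy2 scale1r.
- by rewrite !ei brE skewZr // xy3 mulr1.
- by move=> x; rewrite ei; apply: cz.
move=> i j /andP[ij j6]; rewrite !ei brE.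
have x2U1 := x2U; have x3U1 := subvP sU2 _ x3U; have y3U1 := subvP sU2 _ y3U.
have x3U2 := x3U.
case: i j ij j6 => [|[|[|[|[|[|i]]]]]] [|[|[|[|[|[|j]]]]]] // _ _; rewrite ?inE //= => _;
  rewrite ?skewZr // ?x1_U1 ?y1_U1 ?(al2 _ x3U).1 ?(al2 _ x3U).2 ?(al2 _ y3U).1
    ?(al2 _ y3U).2 ?mulr0 ?scale0r //.
Qed.

End DerivedLine.

(** * Derived algebra in a central 3-space *)

Section CentralThreeSpace.
Context {R : realType}.
Variable n : lieAlgebra R.
Hypothesis dim_n : \dim {:n} = 7%N.
Hypothesis n2 : two_step_nilpotent n.

Lemma exists_basis : exists e : 7.-tuple n, basis_of fullv e.
Proof.
have [s es] := exists_span {:n}.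
have s7 : size s = 7%N by rewrite size_tuple dim_n.
by have [|e [_ eB]] := basis_of_span dim_n s7; [rewrite -es | exists e].
Qed.

(* If every [lie_br x] had rank at most 1, the 4-linear form
   [m (lie_br x y) (lie_br u w)] would be alternating in all pairs of arguments
   and at the same time change sign under [(x, y) <-> (u, w)]. *)
Lemma exists_nonparallel (e : 7.-tuple n) : basis_of fullv e ->
  (1 < \dim (derived n))%N ->
  exists x y w i j, crd e i (lie_br x y) * crd e j (lie_br x w)
                    - crd e i (lie_br x w) * crd e j (lie_br x y) != 0.
Proof.
move=> eB d2; apply: boolp.contrapT => H.
have H0 x y w i j : crd e i (lie_br x y) * crd e j (lie_br x w)
                    - crd e i (lie_br x w) * crd e j (lie_br x y) = 0.
  apply/eqP; apply: boolp.contrapT => /negP h; apply: H.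
  by exists x, y, w, i, j.
pose f i j x y u w := crd e i (lie_br x y) * crd e j (lie_br u w)
                    - crd e i (lie_br u w) * crd e j (lie_br x y).
have f13 i j x y u w : f i j x y u w = - f i j u y x w.
  (* Polarisation in the first argument exchanges the slots of [x] and [u]. *)
  have := H0 (x + u) y w i j; rewrite !lie_brDl !crdD.
  have := H0 x y w i j; have := H0 u y w i j; rewrite /f => h1 h2 h3.
  by apply/eqP; rewrite -addr_eq0; apply/eqP; rewrite -[RHS]h3 -[LHS]addr0 -{1}h1
    -[LHS]addr0 -{1}h2; ring.
have crdN m x : crd e m (- x) = - crd e m x by rewrite /crd linearN.
have fsw i j x y u w : f i j x y u w = f i j y x w u.
  by rewrite /f (lie_br_anti x) (lie_br_anti u) !crdN; ring.
have f24 i j x y u w : f i j x y u w = - f i j x w u y.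
  by rewrite fsw f13 fsw.
have f0 i j x y u w : f i j x y u w = 0.
  have E : f i j x y u w = - f i j x y u w.
    by rewrite {1}f13 f24 opprK /f; ring.
  by move/eqP: E; rewrite -addr_eq0 -mulr2n mulrn_eq0 => /eqP.
have [a [b ab0]] : exists a b : n, lie_br a b != 0.
  apply: boolp.contrapT => h; have [ab _] := n2; apply: ab => x y; apply/eqP.
  by apply: boolp.contrapT => /negP h'; apply: h; exists x, y.
have [i i0] : exists i : 'I_7, crd e i (lie_br a b) != 0.
  apply: boolp.contrapT => h; case/eqP: ab0.
  rewrite [LHS](crd_sum eB) big1 // => i _.
  suff -> : crd e i (lie_br a b) = 0 by rewrite scale0r.
  by apply/eqP; apply: boolp.contrapT => /negP h'; apply: h; exists i.
have : (derived n <= <[lie_br a b]>)%VS.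
  apply/span_subvP => uw /allpairsP[[u w] /= [_ _ ->]] {uw}.
  apply/vlineP; exists (crd e i (lie_br u w) / crd e i (lie_br a b)).
  set k := _ / _; rewrite [LHS](crd_sum eB) [lie_br a b](crd_sum eB) scaler_sumr.
  apply: eq_bigr => j _; rewrite scalerA /k; congr (_ *: _).
  apply: (mulfI i0); have := f0 i j a b u w; rewrite /f => /subr0_eq ->.
  by field.
move/dimvS; rewrite dim_vline ab0 => d1.
by have := leq_trans d2 d1.
Qed.

Variable Z : {vspace n}.
Hypothesis dZ : \dim Z = 3%N.
Hypothesis derZ : (derived n <= Z)%VS.
Hypothesis cenZ : forall x z, z \in Z -> lie_br x z = 0.

Lemma lie_br_inZ x y : lie_br x y \in Z.
Proof. exact/(subvP derZ)/lie_br_derived. Qed.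

Lemma matrix_in_Z (v1 v2 v3 v4 z1 z2 z3 : n) (m11 m12 m13 m22 m23 : R) :
  (fullv <= <<[:: v1; v2; v3; v4]>> + Z)%VS ->
  (Z <= <<[:: z1; z2; z3]>>)%VS -> {subset [:: z1; z2; z3] <= Z} ->
  lie_br v1 v3 - lie_br v2 v4 = m11 *: z1 + m12 *: z2 + m13 *: z3 ->
  - (lie_br v1 v4 + lie_br v2 v3) = m12 *: z1 + m22 *: z2 + m23 *: z3 ->
  lie_br v1 v2 + lie_br v3 v4 = m13 *: z1 + m23 *: z2 + (- m11 - m22) *: z3 ->
  exists phi : kfun n 3, purely_coclosed_G2 phi.
Proof.
move=> full Zz zZ; apply: purely_coclosed_of_matrix => //.
- apply: subv_trans full _.
  rewrite -[[:: _; _; _; _; _; _; _]]/([:: v1; v2; v3; v4] ++ [:: z1; z2; z3]).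
  by rewrite span_cat addvS.
- by move=> x z /zZ; apply: cenZ.
by move=> x y; apply/(subvP Zz)/lie_br_inZ.
Qed.

Lemma free_full (s : seq n) : free s -> size s = 7%N -> (fullv <= <<s>>)%VS.
Proof.
by rewrite /free => /eqP ds s7; rewrite -(geq_leqif (dimv_leqif_sup (subvf _)))
  dim_n ds s7.
Qed.

Lemma classification_central : (1 < \dim (derived n))%N ->
  exists phi : kfun n 3, purely_coclosed_G2 phi.
Proof.
move=> d2; have [e eB] := exists_basis.
have [x [y [w [i [j]]]]] := exists_nonparallel eB d2.
(* A nonzero value of this skew form certifies linear independence. *)
pose m u v := crd e i u * crd e j v - crd e i v * crd e j u.
have mS : skew m by apply: skew_minor.
rewrite -[X in X != 0]/(m (lie_br x y) (lie_br x w)) => mxy.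
have [s es] := exists_span Z.
have s3 : size s = 3%N by rewrite size_tuple dZ.
have sF : free s by rewrite /free -es size_tuple.
move: (val s) s3 sF es => {}s s3 sF es.
have wZ : w \notin Z.
  by apply: contra mxy => /cenZ ->; rewrite skew0r.
have yZ : y \notin <<w :: s>>%VS.
  rewrite span_cons -es; apply: contra mxy.
  case/memv_addP=> _ /vlineP[k ->] [z zZ ->].
  by rewrite lie_brDr lie_brZr (cenZ _ zZ) addr0 !skewE // mulr0.
have xZ : x \notin <<y :: w :: s>>%VS.
  rewrite !span_cons -es; apply: contra mxy.
  case/memv_addP=> _ /vlineP[a ->] [_ /memv_addP[_ /vlineP[b ->] [z zZ ->]] ->].
  rewrite !lie_brDl !lie_brZl !lie_br_alt !(lie_br_anti z) !(cenZ _ zZ).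
  rewrite (lie_br_anti w) !(oppr0, addr0, scaler0, add0r).
  by rewrite !skewE // ?(oppr0, mulr0).
have xywF : free [:: x, y, w & s] by rewrite !free_cons xZ yZ -es wZ sF.
have [v vZ] : exists v, v \notin <<[:: x, y, w & s]>>%VS.
  apply: boolp.contrapT => h.
  have : (fullv <= <<[:: x, y, w & s]>>)%VS.
    apply/subvP => u _; apply: boolp.contrapT => /negP hu.
    by apply: h; exists u.
  by move/dimvS; rewrite dim_n => /leq_trans/(_ (dim_span _)) /=; rewrite s3.
have full0 : (fullv <= <<[:: x; y; w; v]>> + Z)%VS.
  apply: subv_trans (free_full (s := [:: v, x, y, w & s]) _ _) _.
  - by rewrite free_cons vZ.
  - by rewrite /= s3.
  rewrite es -span_cat; apply: sub_span => u; rewrite !inE.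
  by case/or4P => [->|->|->|/orP[]->]; rewrite ?orbT.
(* The contracted brackets of the basis x, y, w, t v; the scale t remains free. *)
pose S3 t := lie_br x y + lie_br w (t *: v).
pose S1 t := lie_br x w - lie_br y (t *: v).
pose S2 t := - (lie_br x (t *: v) + lie_br y w).
(* The value is a polynomial in t of degree at most 2 with nonzero constant term, so it cannot
   vanish at 1, -1 and 2 simultaneously. *)
have [t t0 mt] : exists2 t : R, t != 0 & m (S3 t) (S1 t) != 0.
  have mt t : m (S3 t) (S1 t) = m (lie_br x y) (lie_br x w) +
     t * (m (lie_br w v) (lie_br x w) - m (lie_br x y) (lie_br y v))
     - t * (t * m (lie_br w v) (lie_br y v)).
    by rewrite /S3 /S1 !lie_brZr !skewE //; ring.
  apply: boolp.contrapT => h.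
  have m0 t : t != 0 -> m (S3 t) (S1 t) = 0.
    by move=> t0; apply/eqP; apply: boolp.contrapT => /negP h'; apply: h; exists t.
  have := m0 1 (oner_neq0 _); have := m0 (-1); have := m0 2.
  rewrite oppr_eq0 oner_neq0 pnatr_eq0 !mt => /(_ isT) h1 /(_ isT) h2 h3.
  move/eqP: mxy; apply; move: h1 h2 h3; clear.
  by lra.
have full : (fullv <= <<[:: x; y; w; t *: v]>> + Z)%VS.
  apply: subv_trans full0 _; rewrite addvS //; apply/span_subvP => u.
  rewrite !inE => /or4P[]/eqP->; try by rewrite memv_span // !inE eqxx ?orbT.
  rewrite -[X in X \in _](scalerK t0).
  by rewrite memvZ // memv_span // !inE eqxx !orbT.
have [S1Z S2Z S3Z] : [/\ S1 t \in Z, S2 t \in Z & S3 t \in Z].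
  by rewrite /S1 /S2 /S3 memvN memvB ?memvD ?lie_br_inZ.
have SF : free [:: S1 t; S3 t].
  rewrite free_cons span_seq1 free_cons span_nil memv0 nil_free andbT.
  apply/andP; split; apply: contra mt.
    by case/vlineP=> k ->; rewrite (skewZr mS) (skew_alt mS) mulr0.
  by move/eqP->; rewrite (skew0l mS).
have spanZ r : r \in Z -> r \notin <<[:: S1 t; S3 t]>>%VS ->
    (Z <= <<[:: r; S1 t; S3 t]>>)%VS.
  move=> rZ rN; have rF : free [:: r; S1 t; S3 t] by rewrite free_cons rN SF.
  have sub : (<<[:: r; S1 t; S3 t]>> <= Z)%VS.
    by apply/span_subvP => u; rewrite !inE => /or3P[]/eqP->.
  by rewrite -(geq_leqif (dimv_leqif_sup sub)) dZ; move: rF; rewrite /free => /eqP->.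
have [S2N|] := boolP (S2 t \notin <<[:: S1 t; S3 t]>>%VS).
  (* Three independent contractions: after scaling they are diag(1, 1, -2) applied to a basis. *)
  apply: (matrix_in_Z (z1 := S1 t) (z2 := S2 t) (z3 := (-2)^-1 *: S3 t)
    (m11 := 1) (m12 := 0) (m13 := 0) (m22 := 1) (m23 := 0) full).
  - apply: subv_trans (spanZ _ S2Z S2N) _; apply/span_subvP => u.
    rewrite !inE => /or3P[]/eqP->; try by rewrite memv_span // !inE eqxx ?orbT.
    have m2 : (-2 : R) != 0 by rewrite oppr_eq0 pnatr_eq0.
    rewrite -[X in X \in _](scalerKV m2).
    by rewrite memvZ // memv_span // !inE eqxx !orbT.
  - by move=> u; rewrite !inE => /or3P[]/eqP-> //; apply: memvZ.
  - by rewrite scale1r !scale0r !addr0.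
  - by rewrite scale1r !scale0r addr0 add0r.
  rewrite !scale0r !add0r scalerA (_ : (- 1 - 1) * (-2)^-1 = 1 :> R) ?scale1r //.
  by field.
rewrite negbK span_cons span_seq1.
case/memv_addP=> _ /vlineP[a ->] [_ /vlineP[b ->] eS2].
have [r rZ rN] : exists2 r, r \in Z & r \notin <<[:: S1 t; S3 t]>>%VS.
  apply: boolp.contrapT => h.
  have : (Z <= <<[:: S1 t; S3 t]>>)%VS.
    apply/subvP => u uZ; apply: boolp.contrapT => /negP hu.
    by apply: h; exists u.
  by move/dimvS; rewrite dZ => /leq_trans/(_ (dim_span _)).
(* [M = u k^T + k u^T] with [u = (1, a, 0)] and [k = (- a b, b, a^2 + 1)], both
   orthogonal to the kernel [(a, -1, b)] of [(s1, s2, s3)]. *)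
pose q := a ^+ 2 + 1.
have q0 : q != 0 by rewrite gt_eqF // ltr_wpDl ?ltr01 ?sqr_ge0.
(* For z = (z1, r, z3) put zu = u.z and zk = k.z. The equation S = M z reads S = zk u + zu k; its
   third entry determines zu and its first zk, and then z1 and z3 follow, with [r] free. *)
pose zu := q^-1 *: S3 t; pose zk := S1 t + (a * b) *: zu.
pose z1 := zu - a *: r; pose z3 := q^-1 *: (zk + (a * b) *: z1 - b *: r).
have cancel (X A B : n) : X = - A + B + (X + A - B).
  by rewrite [RHS]addrC -(addrA X) -addrA addrACA subrr addNr !addr0.
have zuE : zu = z1 + a *: r by rewrite subrK.
have zkE : zk = - (a * b) *: z1 + b *: r + q *: z3.
  rewrite scalerA mulfV // scale1r scaleNr.
  exact: cancel.
have S3E : S3 t = q *: zu by rewrite scalerA mulfV // scale1r.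
have S1E : S1 t = zk - (a * b) *: zu by rewrite addrK.
have zuZ : zu \in Z by apply: memvZ.
have z1Z : z1 \in Z by apply: memvB => //; apply: memvZ.
have z3Z : z3 \in Z.
  apply/memvZ/memvB; last exact: memvZ.
  by apply: memvD; [apply: memvD => //; apply: memvZ | apply: memvZ].
pose lin c1 c2 c3 := c1 *: z1 + c2 *: r + c3 *: z3.
have linD c1 c2 c3 d1 d2' d3 :
    lin c1 c2 c3 + lin d1 d2' d3 = lin (c1 + d1) (c2 + d2') (c3 + d3).
  by rewrite /lin !scalerDl addrACA [X in X + _ = _]addrACA.
have linZ c c1 c2 c3 : c *: lin c1 c2 c3 = lin (c * c1) (c * c2) (c * c3).
  by rewrite /lin !scalerDr !scalerA.
have zuL : zu = lin 1 a 0 by rewrite /lin scale1r scale0r addr0 zuE.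
have S3L : S3 t = lin q (a * q) 0.
  by rewrite S3E zuL linZ mulr1 mulr0 [q * a]mulrC.
have S1L : S1 t = lin (-2 * a * b) (b - a ^+ 2 * b) q.
  rewrite S1E -scaleNr [X in X + _]zkE zuL linZ -/(lin _ _ _) linD.
  by congr lin; ring.
have S2L : S2 t = lin (b - a ^+ 2 * b) (2 * a * b) (a * q).
  by rewrite eS2 S1L S3L !linZ linD; congr lin; rewrite /q; ring.
apply: (matrix_in_Z (z1 := z1) (z2 := r) (z3 := z3) (m11 := -2 * a * b)
  (m12 := b - a ^+ 2 * b) (m13 := q) (m22 := 2 * a * b) (m23 := a * q) full).
- apply: subv_trans (spanZ _ rZ rN) _.
  have [m1 m2 m3] : [/\ z1 \in <<[:: z1; r; z3]>>%VS, r \in <<[:: z1; r; z3]>>%VS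
      & z3 \in <<[:: z1; r; z3]>>%VS].
    by split; apply: memv_span; rewrite !inE eqxx ?orbT.
  have mu : zu \in <<[:: z1; r; z3]>>%VS by rewrite zuE memvD // memvZ.
  apply/span_subvP => u; rewrite !inE => /or3P[]/eqP-> //.
    rewrite S1E; apply: memvB; last exact: memvZ.
    rewrite zkE; apply: memvD; last exact: memvZ.
    by apply: memvD; apply: memvZ.
  by rewrite S3E memvZ.
- by move=> u; rewrite !inE => /or3P[]/eqP->.
- exact: S1L.
- exact: S2L.
transitivity (lin q (a * q) 0); first exact: S3L.
by congr (_ + _ *: _); ring.
Qed.

End CentralThreeSpace.

(** * Pencils of skew forms on a 5-space *)

Section Pencils.
Context {R : realType} {V : vectType R}.
Hypothesis dimV : \dim {:V} = 5%N.

Definition radical (al : V -> V -> R) (x : V) : Prop := forall y, al x y = 0.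

Definition gram5 (al : V -> V -> R) (a b c d e : V) : seq R :=
  [:: al a b; al a c; al a d; al a e; al b c; al b d; al b e; al c d; al c e;
      al d e].

(** The pairs (f^12, f^14 + f^35) and (f^12 + f^34, f^15 + f^23) of the structure equations,
    recorded by their Gram entries. *)
Definition pencil_normal_form (al be : V -> V -> R) (a b c d e : V) : Prop :=
  (gram5 al a b c d e = [:: 1; 0; 0; 0; 0; 0; 0; 0; 0; 0] /\
   gram5 be a b c d e = [:: 0; 0; 1; 0; 0; 0; 0; 0; 1; 0]) \/
  (gram5 al a b c d e = [:: 1; 0; 0; 0; 0; 0; 0; 1; 0; 0] /\
   gram5 be a b c d e = [:: 0; 0; 0; 1; 1; 0; 0; 0; 0; 0]).

Lemma kernel_step (U : {vspace V}) (f : V -> R) : scalar f ->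
  exists U' : {vspace V}, [/\ (U' <= U)%VS, (\dim U <= (\dim U').+1)%N,
    forall u, u \in U' -> f u = 0 & forall u, u \in U -> f u = 0 -> u \in U'].
Proof.
move=> lin.
have f0 : f 0 = 0.
  have /eqP := lin 1 0 0; rewrite scaler0 addr0 mul1r.
  by rewrite -subr_eq0 opprD addrA subrr sub0r oppr_eq0 => /eqP.
have [h|/boolp.existsNP[u /boolp.not_implyP[uU /eqP fu]]] :=
    boolp.EM (forall u, u \in U -> f u = 0); first by exists U.
pose p v := - (f v / f u) *: u + v.
have fp v : f (p v) = 0 by rewrite lin; field.
pose U' := <<map p (vbasis U)>>%VS.
have fU' v : v \in U' -> f v = 0.
  move: v; apply: span_ind => // [c x y hx hy|x /mapP[v _ ->]]; last exact: fp.
  by rewrite lin hx hy mulr0 addr0.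
have UU' : (U <= <[u]> + U')%VS.
  rewrite -{1}(span_basis (vbasisP U)); apply/span_subvP => v vU.
  have -> : v = (f v / f u) *: u + p v by rewrite /p scaleNr addNKr.
  apply: memv_add; first exact/memvZ/memv_line.
  exact/memv_span/map_f.
exists U'; split=> //.
- apply/span_subvP => _ /mapP[v /vbasis_mem vU ->].
  by apply: memvD => //; apply: memvZ.
- apply: leq_trans (dimvS UU') _; apply: leq_trans (dimv_add_leqif _ _) _.
  by rewrite dim_vline; case: (u != 0) => //=; rewrite add0n ltnW.
move=> v vU fv; have /memv_addP[_ /vlineP[k ->] [u' u'U' ev]] := subvP UU' v vU.
have := fv; rewrite ev lin (fU' _ u'U') addr0 => /eqP.
by rewrite mulf_eq0 (negPf fu) orbF => /eqP ->; rewrite scale0r add0r.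
Qed.

Section OneForm.
Variable al : V -> V -> R.
Hypothesis alS : skew al.

Definition rank2_data : Prop := exists x y U, [/\ al x y = 1,
  fullv = (<<[:: x; y]>> + U)%VS, \dim U = 3%N & forall u, u \in U -> radical al u].

(** The form is nondegenerate modulo its radical, so every functional that kills [a] is represented
    by a vector. This clause is what prolongs a chain in the Kronecker reduction. *)
Definition rank4_data (a : V) : Prop := [/\ a != 0, radical al a,
  forall v, radical al v -> v \in <[a]>%VS &
  forall f : V -> R, scalar f -> f a = 0 -> exists w, forall y, al w y = f y].

Lemma radical_of_span (s : seq V) v : (fullv <= <<s>>)%VS ->
  (forall x, x \in s -> al x v = 0) -> radical al v.
Proof.
move=> full h y; rewrite (skewC alS) (skew_span alS h) ?oppr0 //.
exact: (subvP full _ (memvf y)).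
Qed.

(** The rank is even; in rank 4 two hyperbolic planes leave a line, which is the radical. *)
Lemma skew5_cases :
  [\/ forall x y, al x y = 0, rank2_data | exists a, rank4_data a].
Proof.
have [h|[x1 [y1 [U1 [[_ _ xy1] [_ al1 eU1 dU1]]]]]] := symplectic_step alS fullv.
  by apply: Or31 => x y; apply: h; apply: memvf.
have d1 : \dim U1 = 3%N by move: dU1; rewrite dimV => -[].
have [h|[x2 [y2 [U2 [[x2U y2U xy2] [sU2 al2 eU2 dU2]]]]]] := symplectic_step alS U1.
  apply: Or32; exists x1, y1, U1; split=> // u uU1.
  have [s es] := exists_span U1.
  apply: (@radical_of_span ([:: x1; y1] ++ s)); first by rewrite span_cat -es eU1.
  move=> x; rewrite mem_cat !inE -orbA => /or3P[/eqP->|/eqP->|xs].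
  - exact: (al1 u uU1).1.
  - exact: (al1 u uU1).2.
  by apply: h => //; rewrite es; apply: memv_span.
have d2 : \dim U2 = 1%N by move: dU2; rewrite d1 => -[].
have [s es] := exists_span U2.
have s1 : size s = 1%N by rewrite size_tuple d2.
move: (val s) s1 es => {}s; case: s => [|a [|]] // _; rewrite span_seq1 => es.
have aU2 : a \in U2 by rewrite es memv_line.
have aU1 := subvP sU2 _ aU2.
have [[x1a y1a] [x2a y2a]] := (al1 a aU1, al2 a aU2).
have [[x1x2 y1x2] [x1y2 y1y2]] := (al1 _ x2U, al1 _ y2U).
have full : (fullv <= <<[:: x1; y1; x2; y2; a]>>)%VS.
  rewrite eU1 eU2 es -span_seq1 -!span_cat; exact: subvv.
have y1x1 : al y1 x1 = -1 by rewrite skewC // xy1.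
have y2x2 : al y2 x2 = -1 by rewrite skewC // xy2.
have [x2x1 x2y1] : al x2 x1 = 0 /\ al x2 y1 = 0.
  by rewrite !(skewC alS x2) x1x2 y1x2 oppr0.
have [y2x1 y2y1] : al y2 x1 = 0 /\ al y2 y1 = 0.
  by rewrite !(skewC alS y2) x1y2 y1y2 oppr0.
have [[ax1 ay1] [ax2 ay2]] :
    (al a x1 = 0 /\ al a y1 = 0) /\ (al a x2 = 0 /\ al a y2 = 0).
  by rewrite !(skewC alS a) x1a y1a x2a y2a oppr0.
pose E := (xy1, xy2, y1x1, y2x2, x1x2, y1x2, x1y2, y1y2, x2x1, x2y1, y2x1, y2y1,
  ax1, ay1, ax2, ay2, x1a, y1a, x2a, y2a).
apply: Or33; exists a; split.
- by apply: contra_eq_neq d2 => a0; rewrite es a0 dim_vline eqxx.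
- apply: radical_of_span full _ => x; rewrite !inE.
  by case/or4P => [/eqP->|/eqP->|/eqP->|/orP[/eqP->|/eqP->]] //; apply: skew_alt.
- move=> v rv.
  have : v \in <<[:: x1; y1; x2; y2; a]>>%VS by apply: (subvP full); apply: memvf.
  rewrite !span_cons span_nil addv0.
  case/memv_addP=> _ /vlineP[c1 ->] [_ /memv_addP[_ /vlineP[c2 ->]
    [_ /memv_addP[_ /vlineP[c3 ->] [_ /memv_addP[_ /vlineP[c4 ->]
    [z za ->]] ->]] ->]] ev].
  have [c5 ez] := vlineP _ _ za.
  have cs t : al v t = 0 by apply: rv.
  have := cs x1; have := cs y1; have := cs x2; have := cs y2.
  rewrite ev ez !skewE // !E => h3 h4 h1 h2.
  have -> : c1 = 0 by rewrite -h1; ring.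
  have -> : c2 = 0 by apply: oppr_inj; rewrite oppr0 -h2; ring.
  have -> : c3 = 0 by rewrite -h3; ring.
  have -> : c4 = 0 by apply: oppr_inj; rewrite oppr0 -h4; ring.
  by rewrite !scale0r !add0r memvZ ?memv_line.
move=> f lin fa.
(* The vector representing [f], read off from the Darboux basis. *)
pose w := f y1 *: x1 - f x1 *: y1 + (f y2 *: x2 - f x2 *: y2); exists w => y.
apply: (@span_ind _ _ (fun u => al w u = f u) [:: x1; y1; x2; y2; a]);
  last exact: (subvP full _ (memvf y)).
- have /eqP := lin 1 0 0; rewrite scaler0 addr0 mul1r skew0r //.
  by rewrite -subr_eq0 opprD addrA subrr sub0r oppr_eq0 => /eqP.
- by move=> c u v hu hv; rewrite skewDr // skewZr // hu hv lin.
move=> u; rewrite !inE.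
by rewrite /w; case/or4P => [/eqP->|/eqP->|/eqP->|/orP[/eqP->|/eqP->]];
  rewrite !skewE // !E ?fa; ring.
Qed.

(** For v outside U, the vectors u of U with al u v = 0 form a space of dimension at least 3 inside
    the radical, which is only a line. *)
Lemma rank4_no_isotropic4 a (U : {vspace V}) : rank4_data a ->
  (forall u v, u \in U -> v \in U -> al u v = 0) -> \dim U = 4%N -> False.
Proof.
move=> [_ _ rad _] iso d4.
have [v vU] : exists v, v \notin U.
  apply: boolp.contrapT => h.
  have : (fullv <= U)%VS.
    by apply/subvP => u _; apply: boolp.contrapT => /negP hu; apply: h; exists u.
  by move/dimvS; rewrite d4 dimV.
have lin : scalar (fun u => al u v) by case: alS.
have [W [sW dW W0 _]] := kernel_step U lin.
have full : fullv = (<[v]> + U)%VS.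
  apply/esym/eqP; rewrite eqEdim subvf dimV dimv_disjoint_sum.
    by rewrite dim_vline d4 (contraNneq _ vU) // => ->; apply: mem0v.
  apply/eqP; rewrite -subv0; apply/subvP => u /memv_capP[/vlineP[k ->] kU].
  rewrite memv0 scaler_eq0; apply: contraNT vU; rewrite negb_or => /andP[k0 _].
  by rewrite -(scalerK k0 v) memvZ.
have : (W <= <[a]>)%VS.
  apply/subvP => u uW; apply: rad => y.
  have : y \in fullv by apply: memvf.
  rewrite full => /memv_addP[_ /vlineP[k ->] [u' u'U ->]].
  by rewrite !skewE // (W0 _ uW) iso ?mulr0 ?addr0 // (subvP sW).
move/dimvS; rewrite dim_vline => dW1.
by move: (leq_trans dW1 (leq_b1 _)) dW; rewrite d4; case: (\dim W) => [|[|]].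
Qed.

Lemma nonzero_radical : exists2 r, r != 0 & radical al r.
Proof.
have [h|[x [y [U [_ _ dU rad]]]]|[a [a0 ra _ _]]] := skew5_cases; last by exists a.
  have : fullv != 0%VS :> {vspace V} by rewrite -dimv_eq0 dimV.
  by rewrite -vpick0 => p0; exists (vpick (fullv : {vspace V})) => // y; apply: h.
have U0 : U != 0%VS by rewrite -dimv_eq0 dU.
by exists (vpick U); rewrite ?vpick0 //; apply/rad/memv_pick.
Qed.

End OneForm.

End Pencils.

Section PencilNormalForms.
Context {R : realType} {V : vectType R}.
Hypothesis dimV : \dim {:V} = 5%N.
Variables al be : V -> V -> R.
Hypotheses (alS : skew al) (beS : skew be).

Lemma normal_form_full a b c d e : pencil_normal_form al be a b c d e ->
  (fullv <= <<[:: a; b; c; d; e]>>)%VS.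
Proof.
move=> nf; have fr : free [tuple a; b; c; d; e].
  apply/freeP => k; rewrite !big_ord_recl big_ord0 /=.
  set k0 := k _; set k1 := k _; set k2 := k _; set k3 := k _; set k4 := k _ => ev.
  have all0 : [/\ k0 = 0, k1 = 0, k2 = 0, k3 = 0 & k4 = 0].
    have a0 t : al (k0 *: a + (k1 *: b + (k2 *: c + (k3 *: d + (k4 *: e + 0))))) t = 0.
      by rewrite ev skew0l.
    have b0 t : be (k0 *: a + (k1 *: b + (k2 *: c + (k3 *: d + (k4 *: e + 0))))) t = 0.
      by rewrite ev skew0l.
    have := (a0 a, a0 b, a0 c, a0 d, b0 a, b0 c, b0 e).
    rewrite !skewE // (skewC alS b a) (skewC alS c a) (skewC alS d a) (skewC alS e a)
      (skewC alS c b) (skewC alS d b) (skewC alS e b) (skewC alS d c) (skewC alS e c)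
      (skewC alS e d) (skewC beS b a) (skewC beS c a) (skewC beS d a) (skewC beS e a)
      (skewC beS d c) (skewC beS e c).
    case: nf => -[[g1 g2 g3 g4 g5 g6 g7 g8 g9 g10] [f1 f2 f3 f4 f5 f6 f7 f8 f9 f10]];
      rewrite ?g1 ?g2 ?g3 ?g4 ?g5 ?g6 ?g7 ?g8 ?g9 ?g10 ?f1 ?f2 ?f3 ?f4 ?f5 ?f6 ?f7
        ?f8 ?f9 ?f10 => -[[[[[[h1 h2] h3] h4] h5] h6] h7]; split; lra.
  have [z0 z1 z2 z3 z4] := all0.
  case=> [[|[|[|[|[|]]]]] i5] //.
  - by rewrite -z0; congr k; apply: val_inj.
  - by rewrite -z1; congr k; apply: val_inj.
  - by rewrite -z2; congr k; apply: val_inj.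
  - by rewrite -z3; congr k; apply: val_inj.
  - by rewrite -z4; congr k; apply: val_inj.
by rewrite -(geq_leqif (dimv_leqif_sup (subvf _))) dimV; move/eqP: fr => ->.
Qed.

Hypothesis no_common_radical : forall x, radical al x -> radical be x -> x = 0.

(** On the 3-dimensional radical U of [al], [be] is not 0: otherwise the two conditions of being
    [be]-orthogonal to x and y would leave a common radical vector. So [be] splits U into a plane
    (e3, e5) and a line (e4). A radical vector r of [be] is not radical for [al], which yields a
    partner x' with al x' r = 1. *)
Lemma rank2_normal_form : rank2_data al ->
  exists a b c d e, pencil_normal_form al be a b c d e.
Proof.
move=> [x [y [U [xy full dU radU]]]].
have [be0|[e3 [e5 [U' [[e3U e5U e35] [sU' be' eU dU']]]]]] := symplectic_step beS U.
  have lin t : scalar (fun u => be u t) by case: beS.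
  have [U1 [sU1 dU1 U10 _]] := kernel_step U (lin x).
  have [U2 [sU2 dU2 U20 _]] := kernel_step U1 (lin y).
  have U2n : U2 != 0%VS.
    rewrite -dimv_eq0; move: dU1 dU2; rewrite dU.
    by case: (\dim U2) (\dim U1) => [|?] [|[|?]].
  have pU2 := memv_pick U2; have pU1 := subvP sU2 _ pU2.
  have pU := subvP sU1 _ pU1.
  move: U2n; rewrite -vpick0 => /eqP[]; apply: no_common_radical; first exact: radU.
  move=> t; have : t \in fullv by apply: memvf.
  rewrite full span_cons span_seq1.
  case/memv_addP=> _ /memv_addP[_ /vlineP[k ->] [_ /vlineP[l ->] ->]] [u uU ->].
  by rewrite !skewE // U10 // U20 // be0 //; ring.
have d1 : \dim U' = 1%N by move: dU'; rewrite dU => -[].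
pose e4 := vpick U'.
have e4U' : e4 \in U' := memv_pick U'.
have e4n : e4 != 0 by rewrite vpick0 -dimv_eq0 d1.
have e4U := subvP sU' _ e4U'.
have [e34 e54] := be' _ e4U'.
have U'e4 : U' = <[e4]>%VS.
  by apply/esym/eqP; rewrite eqEdim -memvE e4U' d1 dim_vline e4n.
have [r rn rr] := nonzero_radical dimV beS.
have [x' x'r] : exists x', al x' r = 1.
  apply: boolp.contrapT => h; case/eqP: rn; apply: no_common_radical => // t.
  apply/eqP; apply: boolp.contrapT => /negP rt; apply: h.
  exists ((al t r)^-1 *: t); rewrite skewZl // mulVf //.
  by rewrite skewC // oppr_eq0.
have fullr : fullv = (<<[:: x'; r]>> + U)%VS.
  have xr0 : (<<[:: x'; r]>> :&: U = 0)%VS.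
    apply/eqP; rewrite -subv0; apply/subvP => v /memv_capP[].
    rewrite span_cons span_seq1 => /memv_addP[_ /vlineP[k ->] [_ /vlineP[l ->] ->]].
    move=> /radU h; have := h r; have := h x'; rewrite !skewE // x'r.
    rewrite (skewC alS r) x'r => h1 h2.
    have -> : k = 0 by rewrite -h2; ring.
    have -> : l = 0 by apply: oppr_inj; rewrite oppr0 -h1; ring.
    by rewrite !scale0r addr0 mem0v.
  have fxr : free [:: x'; r].
    rewrite free_cons span_seq1 free_cons span_nil memv0 nil_free andbT rn andbT.
    apply: contra_eqN x'r => /vlineP[k ->]; rewrite skewZl // skew_alt // mulr0.
    by rewrite eq_sym oner_neq0.
  apply/esym/eqP; rewrite eqEdim subvf dimV dimv_disjoint_sum // dU.
  by move/eqP: fxr => ->.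
have x'e4 : be x' e4 != 0.
  apply/eqP => h; case/eqP: e4n; apply: no_common_radical; first exact: radU.
  move=> t; have : t \in fullv by apply: memvf.
  rewrite fullr eU U'e4 !span_cons !span_nil !addv0.
  case/memv_addP=> _ /memv_addP[_ /vlineP[k ->] [_ /vlineP[l ->] ->]]
    [_ /memv_addP[_ /memv_addP[_ /vlineP[p ->] [_ /vlineP[q ->] ->]]
    [_ /vlineP[s ->] ->]] ->].
  rewrite (skewC beS) !skewE // h rr e34 e54; ring.
pose e4' := (be x' e4)^-1 *: e4.
(* Adding vectors of the radical of [al] leaves [al] unchanged and makes e1 [be]-orthogonal to e3
   and e5. *)
pose e1 := x' - be x' e5 *: e3 + be x' e3 *: e5.
have e4'U : e4' \in U by apply: memvZ.
have a3 := radU _ e3U; have a4 := radU _ e4'U; have a5 := radU _ e5U.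
have a3' t : al t e3 = 0 by rewrite skewC // a3 oppr0.
have a4' t : al t e4' = 0 by rewrite skewC // a4 oppr0.
have a5' t : al t e5 = 0 by rewrite skewC // a5 oppr0.
have r' t : be t r = 0 by rewrite skewC // rr oppr0.
exists e1, r, e3, e4', e5; left; rewrite /gram5 !a3 !a4 !a3' !a4' !a5' !rr !r'.
have e53 : be e5 e3 = -1 by rewrite skewC // e35.
have e43 : be e4 e3 = 0 by rewrite skewC // e34 oppr0.
have e45 : be e4 e5 = 0 by rewrite skewC // e54 oppr0.
split.
  by congr (_ :: _); rewrite /e1 !skewE // x'r a3 a5; ring.
rewrite /e1 /e4' !skewE // e34 e54 e35 e53 e45 !mulr0.
by congr [:: _; _; _; _; _; _; _; _; _; _]; field.
Qed.

Lemma skew_comb p q : skew (fun x y => p * al x y + q * be x y).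
Proof. by apply: skewD; apply: skewZ. Qed.

Hypothesis rank4_all : forall p q, (p, q) != (0, 0) ->
  exists a, rank4_data (fun x y => p * al x y + q * be x y) a.

Let rank4_al : exists a, rank4_data al a.
Proof.
have [|a [a0 ra rad sur]] := rank4_all (p := 1) (q := 0).
  by rewrite xpair_eqE oner_eq0.
have E x y : 1 * al x y + 0 * be x y = al x y by ring.
exists a; split=> // [y|v rv|f lin fa].
- by rewrite -E; apply: ra.
- by apply: rad => y; rewrite E.
by have [w hw] := sur f lin fa; exists w => y; rewrite -E.
Qed.

(* A chain [al a = 0], [al w = - be a], [be w = 0] forces some form of the pencil
   to vanish on the hyperplane [ker (be a)]. *)
Lemma no_short_chain a w : a != 0 -> w \notin <[a]>%VS -> radical al a ->
  (forall y, al w y = - be a y) -> radical be w -> False.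
Proof.
move=> a0 wa ra alw rw.
have lin : scalar (be a).
  by move=> c u v; rewrite skewDr // skewZr.
have [U [_ dU U0 Umax]] := kernel_step fullv lin.
have aU : a \in U by rewrite Umax ?memvf ?skew_alt.
have wU : w \in U by rewrite Umax ?memvf // (skewC beS) rw oppr0.
have dU4 : \dim U = 4%N.
  apply/eqP; rewrite eqn_leq andbC -ltnS -dimV dU /=.
  have : (\dim U <= \dim {:V})%N by apply/dimvS/subvf.
  rewrite dimV leq_eqVlt => /orP[/eqP d5|]; last by [].
  have Uf : U = fullv by apply/eqP; rewrite eqEdim subvf dimV d5.
  case/eqP: a0; apply: no_common_radical => // y.
  by apply: U0; rewrite Uf memvf.
have faw : free [:: w; a].
  by rewrite free_cons span_seq1 wa free_cons span_nil memv0 a0 nil_free.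
have sub : (<<[:: w; a]>> <= U)%VS.
  by apply/span_subvP => u; rewrite !inE => /orP[]/eqP->.
have [s es] := exists_span (U :\: <<[:: w; a]>>).
have s2 : size s = 2%N.
  rewrite size_tuple; have := dimv_cap_compl U <<[:: w; a]>>.
  by rewrite (capv_idPr sub) dU4; move/eqP: faw => -> /= [].
have eU : U = <<[:: w; a] ++ s>>%VS.
  by rewrite span_cat -es addvC addv_diff; apply/esym/addv_idPl.
case: {s} (val s) s2 es eU => [|u [|v []]] // _ _ eU.
have [uU vU] : u \in U /\ v \in U by rewrite eU !memv_span // !inE eqxx !orbT.
have iso p q : p * al u v + q * be u v = 0 -> forall x y, x \in U -> y \in U ->
    p * al x y + q * be x y = 0.
  move=> uv0; have cS := skew_comb p q.
  have aX y : y \in U -> p * al a y + q * be a y = 0.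
    by move=> yU; rewrite ra U0 // !mulr0 addr0.
  have wX y : y \in U -> p * al w y + q * be w y = 0.
    by move=> yU; rewrite alw U0 // rw oppr0 !mulr0 addr0.
  have gen x y : x \in [:: w; a; u; v] -> y \in [:: w; a; u; v] ->
      p * al x y + q * be x y = 0.
    have inU x' : x' \in [:: w; a; u; v] -> x' \in U.
      by rewrite eU; apply: memv_span.
    move=> xs ys; move: (xs); rewrite !inE => /or4P[]/eqP->.
    - by apply/wX/inU.
    - by apply/aX/inU.
    - move: ys; rewrite !inE => /or4P[]/eqP->; rewrite ?uv0 ?skew_alt //.
      + by rewrite (skewC cS) /= wX ?oppr0.
      + by rewrite (skewC cS) /= aX ?oppr0.
      + by rewrite !mulr0 addr0.
    move: ys; rewrite !inE => /or4P[]/eqP->; rewrite ?skew_alt //.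
    + by rewrite (skewC cS) /= wX ?oppr0.
    + by rewrite (skewC cS) /= aX ?oppr0.
    + by rewrite (skewC cS) /= uv0 oppr0.
    by rewrite !mulr0 addr0.
  move=> x y; rewrite eU => xU yU.
  apply: (skew_span cS (s := [:: w; a; u; v])) xU => x' x's.
  rewrite (skewC cS); apply/eqP; rewrite oppr_eq0; apply/eqP.
  apply: (skew_span cS (s := [:: w; a; u; v])) yU => y' y's.
  exact: gen.
(* The pair u, v carries the only entry on U that is not automatically 0, and these coefficients
   cancel it. If both are 0, the form [al] itself vanishes on U. *)
have [pq0|pq] := eqVneq (be u v, - al u v) (0, 0).
  have n10 : (1, 0) != (0, 0) :> R * R by rewrite xpair_eqE oner_eq0.
  have [b' bd] := rank4_all n10.
  apply: (rank4_no_isotropic4 dimV (skew_comb 1 0) bd (iso 1 0 _) dU4).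
  by case: pq0 => -> /eqP; rewrite oppr_eq0 => /eqP->; rewrite !mulr0 addr0.
have [b' bd] := rank4_all pq.
apply: (rank4_no_isotropic4 dimV (skew_comb _ _) bd (iso _ _ _) dU4); ring.
Qed.

(** A pencil of skew forms in odd dimension is singular: al + X be has a polynomial kernel vector,
    here a + X w + X^2 b. Its coefficients form a chain al a = 0, al w = - be a, al b = - be w, be b
    = 0, and vectors dual to w and b complete the basis. *)
Lemma rank4_normal_form :
  exists a b c d e, pencil_normal_form al be a b c d e.
Proof.
have [a [a0 ra rad sur]] := rank4_al.
have blin x : scalar (fun y => - be x y).
  by move=> c u v; rewrite skewDr // skewZr //; ring.
have [w hw] := sur _ (blin a) (etrans (congr1 _ (skew_alt beS a)) (oppr0 _)).
have ra' y : al y a = 0 by rewrite skewC // ra oppr0.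
have bwa : be w a = 0 by rewrite skewC // -hw skew_alt.
have [b' hb'] := sur _ (blin w) (etrans (congr1 _ bwa) (oppr0 _)).
have bww : be w w = 0 by apply: skew_alt.
have alwb : al w b' = 0 by rewrite skewC // hb' bww !oppr0.
have bb'a : be b' a = 0 by rewrite skewC // -hw alwb.
have [c hc] := sur _ (blin b') (etrans (congr1 _ bb'a) (oppr0 _)).
have bb'w : be b' w = 0.
  by rewrite skewC // -hb' skew_alt.
have alcw : al c w = 0 by rewrite hc bb'w oppr0.
have alcb : al c b' = 0 by rewrite hc skew_alt // oppr0.
have wa : w \notin <[a]>%VS.
  apply/negP => /vlineP[k ek]; case/eqP: a0; apply: no_common_radical => // y.
  by apply: oppr_inj; rewrite -hw ek skewZl // ra mulr0 oppr0.
have b'wa : b' \notin <<[:: w; a]>>%VS.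
  apply/negP; rewrite span_cons span_seq1.
  case/memv_addP=> _ /vlineP[k ->] [_ /vlineP[l ->] eb'].
  apply: (@no_short_chain a (w - k *: a)) => //.
  - apply: contra wa => h; rewrite -(subrK (k *: a) w) memvD // memvZ //.
    exact: memv_line.
  - by move=> y; rewrite !skewE // ra hw; ring.
  move=> y; rewrite !skewE //; apply: oppr_inj; rewrite oppr0 opprB.
  have := hb' y; rewrite eb' !skewE // ra hw => h.
  by rewrite -[RHS](subrr (- be w y)) -{1}h; ring.
have fwab : free [:: b'; w; a].
  by rewrite free_cons b'wa free_cons span_seq1 wa free_cons span_nil memv0 a0 nil_free.
(* The chain a, w, b', c is isotropic for [al], so it cannot span a 4-space. *)
have : c \in <<[:: b'; w; a]>>%VS.
  apply: boolp.contrapT => /negP cN.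
  have f4 : free [:: c; b'; w; a] by rewrite free_cons cN.
  apply: (rank4_no_isotropic4 dimV alS (U := <<[:: c; b'; w; a]>>%VS) (a := a)).
  - by split.
  - move=> x y xU yU.
    apply: (skew_span alS (s := [:: c; b'; w; a])) xU => x' x's.
    rewrite (skewC alS); apply/eqP; rewrite oppr_eq0; apply/eqP.
    apply: (skew_span alS (s := [:: c; b'; w; a])) yU => y' y's.
    have [albc alwc albw] : [/\ al b' c = 0, al w c = 0 & al b' w = 0].
      by rewrite !(skewC alS b') (skewC alS w c) alcb alcw alwb oppr0.
    by move: x's y's; rewrite !inE => /or4P[]/eqP-> /or4P[]/eqP->;
      rewrite ?ra ?ra' ?skew_alt.
  by move/eqP: f4.
rewrite !span_cons span_nil addv0.
case/memv_addP=> _ /vlineP[z ->] [_ /memv_addP[_ /vlineP[y ->] [_ /vlineP[x ->] ->]] ec].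
(* The dependency of c is absorbed here: w1 and b still continue the chain from a, and now be b =
   0. *)
pose b := b' - y *: a - z *: w; pose w1 := w - z *: a.
have rb : radical be b.
  move=> t; have h := hc t; rewrite ec !skewE // hb' hw ra in h.
  rewrite /b !(skewDl beS, skewNl beS, skewZl beS); apply: oppr_inj; rewrite oppr0.
  by rewrite -[RHS](subrr (- be b' t)) -{2}h; ring.
have hw1 t : al w1 t = - be a t by rewrite /w1 !skewE // ra hw; ring.
have hb t : al b t = - be w1 t.
  by rewrite /b /w1 !skewE // ra hw hb'; ring.
have rb' t : be t b = 0 by rewrite skewC // rb oppr0.
have fX : free [tuple w1; b; a].
  have w1a : w1 \notin <[a]>%VS.
    apply: contra wa => h; rewrite -(subrK (z *: a) w) memvD // memvZ //.
    exact: memv_line.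
  have bw1a : b \notin <<[:: w1; a]>>%VS.
    apply: contra b'wa => h.
    have sub : (<<[:: w1; a]>> <= <<[:: w; a]>>)%VS.
      apply/span_subvP => u; rewrite !inE => /orP[]/eqP->.
        by rewrite memvB ?memvZ // memv_span // !inE eqxx ?orbT.
      by rewrite memv_span // !inE eqxx ?orbT.
    have -> : b' = b + (z *: w + y *: a) by rewrite /b addrA !subrK.
    apply: memvD; first exact: (subvP sub).
    by apply: memvD; apply: memvZ; apply: memv_span; rewrite !inE eqxx ?orbT.
  have : free [:: b; w1; a].
    by rewrite free_cons bw1a free_cons span_seq1 w1a free_cons span_nil memv0 a0 nil_free.
  by rewrite (perm_free (Y := [:: w1; b; a])) // (perm_catCA [:: b] [:: w1] [:: a]).
(* The coordinates of a free family are functionals on the whole space; the first two vanish on [a],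
   hence are represented through [al]. *)
have clin i : scalar (coord [tuple w1; b; a] i) by move=> k u v; rewrite linearP.
have cE (i j : 'I_3) : coord [tuple w1; b; a] i [tuple w1; b; a]`_j = (j == i)%:R.
  exact: coord_free.
pose i0 : 'I_3 := Ordinal (isT : (0 < 3)%N); pose i1 : 'I_3 := Ordinal (isT : (1 < 3)%N).
pose i2 : 'I_3 := Ordinal (isT : (2 < 3)%N).
have [E1 hE1] := sur _ (clin i0) (cE i0 i2).
have [E3 hE3] := sur _ (clin i1) (cE i1 i2).
have E1w : al E1 w1 = 1 := etrans (hE1 w1) (cE i0 i0).
have E1b : al E1 b = 0 := etrans (hE1 b) (cE i0 i1).
have E3w : al E3 w1 = 0 := etrans (hE3 w1) (cE i1 i0).
have E3b : al E3 b = 1 := etrans (hE3 b) (cE i1 i1).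
have baE1 : be a E1 = 1 by apply: oppr_inj; rewrite -hw1 skewC // E1w.
have baE3 : be a E3 = 0 by apply: oppr_inj; rewrite -hw1 skewC // E3w.
have bwE3 : be w1 E3 = 1 by apply: oppr_inj; rewrite -hb skewC // E3b.
have bwE1 : be w1 E1 = 0 by apply: oppr_inj; rewrite -hb skewC // E1b.
have bwa1 : be w1 a = 0 by rewrite skewC // -hw1 skew_alt.
have alwb1 : al w1 b = 0 by rewrite hw1 rb' oppr0.
(* The multiples of b and a added below cancel these two remaining entries. *)
pose k := al E1 E3; pose l := be E1 E3.
exists (E1 + k *: b), w1, (E3 + l *: a), b, (- a); right; rewrite /gram5.
have [albE1 albE3] : al b E1 = 0 /\ al b E3 = -1.
  by rewrite !(skewC alS b) E1b E3b oppr0.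
have albw : al b w1 = 0 by rewrite skewC // alwb1 oppr0.
have [bE1a bE3a] : be E1 a = -1 /\ be E3 a = 0.
  by rewrite !(skewC beS _ a) baE1 baE3 oppr0.
have [bE1w bE3w] : be E1 w1 = 0 /\ be E3 w1 = -1.
  by rewrite !(skewC beS _ w1) bwE1 bwE3 oppr0.
have alw1E3 : al w1 E3 = 0 by rewrite skewC // E3w oppr0.
clearbody b w1; split.
  rewrite !(skewDl alS, skewDr alS, skewNl alS, skewNr alS, skewZl alS, skewZr alS,
    skew_alt alS) !ra !ra' E1w E1b E3b albE3 albw alw1E3 alwb1 -/k.
  by congr [:: _; _; _; _; _; _; _; _; _; _]; ring.
rewrite !(skewDl beS, skewDr beS, skewNl beS, skewNr beS, skewZl beS, skewZr beS,
  skew_alt beS) !rb !rb' bE1a bE3a bE1w bwE3 bwa1 -/l.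
by congr [:: _; _; _; _; _; _; _; _; _; _]; ring.
Qed.

End PencilNormalForms.

Section PencilClassification.
Context {R : realType} {V : vectType R}.
Hypothesis dimV : \dim {:V} = 5%N.
Variables al be : V -> V -> R.
Hypotheses (alS : skew al) (beS : skew be).
Hypothesis no_common_radical : forall x, radical al x -> radical be x -> x = 0.

(** Either some member of the pencil has rank 2 and is taken as first form, or all nonzero members
    have rank 4. *)
Lemma pencil_classification : exists p q r s : R, p * s - q * r != 0 /\
  exists a b c d e, pencil_normal_form (fun x y => p * al x y + q * be x y)
                      (fun x y => r * al x y + s * be x y) a b c d e.
Proof.
(* The second form is taken with coefficients (- q, p), so that the determinant is p^2 + q^2,
   nonzero over the reals. *)
have det0 p q : (p, q) != (0, 0) :> R * R -> p * p - q * - q != 0.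
  apply: contra_neq => h; have h2 : p ^+ 2 + q ^+ 2 = 0 by rewrite -h; ring.
  have := h2; move/eqP; rewrite paddr_eq0 ?sqr_ge0 // !sqrf_eq0.
  by case/andP=> /eqP-> /eqP->.
have common p q x : (p, q) != (0, 0) :> R * R ->
    radical (fun x y => p * al x y + q * be x y) x ->
    radical (fun x y => - q * al x y + p * be x y) x -> x = 0.
  move=> pq r1 r2; have D0 := det0 _ _ pq.
  have e1 y : p * al x y + q * be x y = 0 by exact: r1.
  have e2 y : - q * al x y + p * be x y = 0 by exact: r2.
  apply: no_common_radical => y; apply: (mulfI D0); rewrite mulr0.
    transitivity (p * 0 - q * 0 : R); last by ring.
    by rewrite -{1}(e1 y) -(e2 y); ring.
  transitivity (q * 0 + p * 0 : R); last by ring.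
  by rewrite -{1}(e1 y) -(e2 y); ring.
have [[p [q [pq r2]]]|no2] := boolp.EM (exists p q : R, (p, q) != (0, 0) /\
    rank2_data (fun x y => p * al x y + q * be x y)).
  exists p, q, (- q), p; split; first exact: det0.
  apply: (rank2_normal_form dimV (skew_comb alS beS p q) (skew_comb alS beS (- q) p)).
    by move=> x; apply: common.
  exact: r2.
have r4 p q : (p, q) != (0, 0) ->
    exists a, rank4_data (fun x y => p * al x y + q * be x y) a.
  move=> pq; have [h|h|//] := skew5_cases dimV (skew_comb alS beS p q).
    (* If a nonzero member were 0, a radical vector of the complementary member would be a common
       one. *)
    have [r r0 rr] := nonzero_radical dimV (skew_comb alS beS (- q) p).
    by case/eqP: r0; apply: common rr => // y; apply: h.
  by case: no2; exists p, q.
exists 1, 0, 0, 1; split; first by rewrite !mulr0 subr0 mulr1 oner_neq0.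
have -> : (fun x y => 1 * al x y + 0 * be x y) = al.
  by apply: boolp.funext => x; apply: boolp.funext => y; ring.
have -> : (fun x y => 0 * al x y + 1 * be x y) = be.
  by apply: boolp.funext => x; apply: boolp.funext => y; ring.
exact: rank4_normal_form.
Qed.

End PencilClassification.

(** * Classification by the dimension of the derived algebra *)

Section Classification.
Context {R : realType}.
Variable n : lieAlgebra R.
Hypothesis dim_n : \dim {:n} = 7%N.
Hypothesis n2 : two_step_nilpotent n.

(** If dim n' >= 4, a complement of the central subspace n' has dimension at most 3, so at most
    three brackets span n'. *)
Lemma dim_derived_le3 : (\dim (derived n) <= 3)%N.
Proof.
rewrite leqNgt; apply/negP => d4.
have [s es] := exists_span (derived n)^C; have [t et] := exists_span (derived n).
have s3 : (size s <= 3)%N.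
  by rewrite size_tuple dimv_compl dim_n leq_subLR (leq_add2r 3 4).
(* Positions beyond the end of [s] read as 0, which covers complements of dimension below 3. *)
move: (val s) s3 es => {}s s3 es; pose u i := s`_i.
pose U := <<[:: lie_br (u 0%N) (u 1%N); lie_br (u 0%N) (u 2%N);
  lie_br (u 1%N) (u 2%N)]>>%VS.
have u01 : lie_br (u 0%N) (u 1%N) \in U by rewrite memv_span // !inE eqxx.
have u02 : lie_br (u 0%N) (u 2%N) \in U by rewrite memv_span // !inE eqxx ?orbT.
have u12 : lie_br (u 1%N) (u 2%N) \in U by rewrite memv_span // !inE eqxx ?orbT.
have full : fullv = <<s ++ t>>%VS by rewrite span_cat -es -et addvC addv_complf.
have tc x y : y \in val t -> lie_br x y = 0.
  by move=> yt; apply: (derived_central n2); rewrite et memv_span.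
have brU x y : lie_br x y \in U.
  apply: (@lie_br_in_span _ n (s ++ t) (s ++ t)); rewrite -?full ?memvf //.
  move=> {}x {}y; rewrite !mem_cat => /orP[xs|xt]; last first.
    by rewrite lie_br_anti tc // oppr0 mem0v.
  case/orP=> [ys|yt]; last by rewrite tc // mem0v.
  have inv i j : lie_br (u i) (u j) \in U -> lie_br (u j) (u i) \in U.
    by rewrite (lie_br_anti (u j)) memvN.
  have [i i3 ->] : exists2 i, (i < 3)%N & x = u i.
    exists (index x s); last by rewrite /u nth_index.
    by apply: leq_trans s3; rewrite index_mem.
  have [j j3 ->] : exists2 j, (j < 3)%N & y = u j.
    exists (index y s); last by rewrite /u nth_index.
    by apply: leq_trans s3; rewrite index_mem.
  by case: i i3 => [|[|[|i]]] // _; case: j j3 => [|[|[|j]]] // _;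
    rewrite ?lie_br_alt ?mem0v //; apply: inv.
have : (derived n <= U)%VS.
  by apply/span_subvP => _ /allpairsP[[x y] /= [_ _ ->]].
by move/dimvS => /leq_trans/(_ (dim_span _)) /= /(leq_trans d4).
Qed.

Lemma lie_iso_of_normal_form (e : 7.-tuple n) (f g : n -> n -> R) :
  basis_of fullv e -> skew f -> skew g ->
  (forall x y, lie_br x y = - f x y *: e`_5 - g x y *: e`_6) ->
  (forall x j, (4 < j < 7)%N -> lie_br x e`_j = 0) ->
  pencil_normal_form f g e`_0 e`_1 e`_2 e`_3 e`_4 ->
  lie_iso n (n72A R) \/ lie_iso n (n72B R).
Proof.
move=> eB fS gS brE cen.
have ext F G : skew F -> skew G ->
    (forall i j, (i < 5)%N -> (j < 5)%N -> (i < j)%N ->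
       f e`_i e`_j = F e`_i e`_j /\ g e`_i e`_j = G e`_i e`_j) ->
    (forall i j, (4 < j < 7)%N -> F e`_i e`_j = 0 /\ G e`_i e`_j = 0) ->
    forall u v, lie_br u v = - F u v *: e`_5 - G u v *: e`_6.
  move=> FS GS low high u v; rewrite -scaleNr -[- F u v]mulN1r -[- G u v]mulN1r.
  apply: (lie_br_ext eB (skewZ (-1) FS) (skewZ (-1) GS)) => i j /andP[ij j7].
  rewrite !mulN1r; have [j5|j5] := ltnP j 5.
    have [<- <-] := low i j (ltn_trans ij j5) j5 ij.
    by rewrite brE -[- (g _ _ *: _)]scaleNr.
  have j57 : (4 < j < 7)%N by rewrite j5.
  by have [-> ->] := high i j j57; rewrite cen // oppr0 !scale0r addr0.
have minor2 i j k m : skew (fun u v => crd e i u * crd e j v - crd e i v * crd e j u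
   + (crd e k u * crd e m v - crd e k v * crd e m u)).
  by apply: skewD; apply: skew_minor.
case=> -[[f1 f2 f3 f4 f5 f6 f7 f8 f9 f10] [g1 g2 g3 g4 g5 g6 g7 g8 g9 g10]].
  left; apply/iso_n72AP => //; exists e => //.
  apply: ext => [||i j i5 j5 ij|i j /andP[j4 j7]]; try exact: skew_minor.
  - exact: minor2.
  - rewrite !(crdE eB) //.
    case: i j i5 j5 ij => [|[|[|[|[|i]]]]] [|[|[|[|[|j]]]]] // _ _ _;
      rewrite ?f1 ?f2 ?f3 ?f4 ?f5 ?f6 ?f7 ?f8 ?f9 ?f10 ?g1 ?g2 ?g3 ?g4 ?g5 ?g6 ?g7 ?g8
        ?g9 ?g10 /=; split; ring.
  rewrite !(crdE eB) //; case: j j4 j7 => [|[|[|[|[|j]]]]] // _ _.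
  by rewrite /= !(mulr0, mul0r, subr0, addr0).
right; apply/iso_n72BP => //; exists e => //.
apply: ext => [||i j i5 j5 ij|i j /andP[j4 j7]]; try exact: minor2.
  rewrite !(crdE eB) //.
  case: i j i5 j5 ij => [|[|[|[|[|i]]]]] [|[|[|[|[|j]]]]] // _ _ _;
    rewrite ?f1 ?f2 ?f3 ?f4 ?f5 ?f6 ?f7 ?f8 ?f9 ?f10 ?g1 ?g2 ?g3 ?g4 ?g5 ?g6 ?g7 ?g8
      ?g9 ?g10 /=; split; ring.
rewrite !(crdE eB) //; case: j j4 j7 => [|[|[|[|[|j]]]]] // _ _.
by rewrite /= !(mulr0, mul0r, subr0, addr0).
Qed.

Lemma classification_plane : \dim (derived n) = 2%N ->
  (forall c : n, (forall x, lie_br x c = 0) -> c \in derived n) ->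
  lie_iso n (n72A R) \/ lie_iso n (n72B R).
Proof.
move=> d2 cen.
have [s es] := exists_span (derived n).
have s2 : size s = 2%N by rewrite size_tuple d2.
have sF : free s by rewrite /free -es size_tuple.
case: {s} (val s) s2 es sF => [|z1 [|z2 []]] // _ es sF.
pose al x y := coord [tuple z1; z2] ord0 (lie_br x y).
pose be x y := coord [tuple z1; z2] (lift ord0 ord0) (lie_br x y).
have brE x y : lie_br x y = al x y *: z1 + be x y *: z2.
  have : lie_br x y \in <<[tuple z1; z2]>>%VS by rewrite -es lie_br_derived.
  by move/coord_span; rewrite big_ord_recl big_ord1.
have alS : skew al.
  split=> [y c u v|x y]; first by rewrite /al lie_brDl lie_brZl linearP.
  by rewrite /al lie_br_anti linearN.
have beS : skew be.
  split=> [y c u v|x y]; first by rewrite /be lie_brDl lie_brZl linearP.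
  by rewrite /be lie_br_anti linearN.
(* The two forms descend to n / n', represented by a complement W; a common radical vector there
   would be central and so lie in n'. *)
pose W := (derived n)^C%VS; pose L : vectType R := subvs_of W.
have dL : \dim {:L} = 5%N.
  by rewrite dimvf; change (\dim W = 5%N); rewrite dimv_compl dim_n d2.
pose al' (u v : L) := al (vsval u) (vsval v).
pose be' (u v : L) := be (vsval u) (vsval v).
have alS' : skew al'.
  by split=> [y c u v|x y];
    rewrite /al' ?linearP ?(skewDl alS) ?(skewZl alS) ?(skewC alS (vsval x)).
have beS' : skew be'.
  by split=> [y c u v|x y];
    rewrite /be' ?linearP ?(skewDl beS) ?(skewZl beS) ?(skewC beS (vsval x)).
have fullWD : fullv = (W + derived n)%VS by rewrite addvC addv_complf.
have nc (u : L) : radical al' u -> radical be' u -> u = 0.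
  move=> ru ru'; apply: val_inj => /=.
  have uD : vsval u \in derived n.
    apply: cen => x; have : x \in fullv by apply: memvf.
    rewrite fullWD => /memv_addP[w wW [z zD ->]].
    rewrite lie_br_anti lie_brDr (derived_central n2 _ zD) addr0 brE.
    have -> : w = vsval (vsproj W w) by rewrite vsprojK.
    by rewrite -/(al' _ _) -/(be' _ _) ru ru' !scale0r addr0 oppr0.
  have : vsval u \in (derived n :&: W)%VS by rewrite memv_cap uD subvsP.
  by rewrite capv_compl memv0 => /eqP.
have [p [q [r [t [det [a [b [c [d [e nf]]]]]]]]]] :=
  pencil_classification dL alS' beS' nc.
have full5 := normal_form_full dL (skew_comb alS' beS' p q) (skew_comb alS' beS' r t) nf.
pose D := p * t - q * r; rewrite -/D in det.
(* The basis of n' that compensates the change of the two forms, so that the bracket becomes f y1 +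
   g y2. *)
pose y1 := D^-1 *: (t *: z1 - r *: z2).
pose y2 := D^-1 *: (p *: z2 - q *: z1).
have Dy1 : D *: y1 = t *: z1 - r *: z2 := scalerKV det _.
have Dy2 : D *: y2 = p *: z2 - q *: z1 := scalerKV det _.
have Dlin k m : D *: (k *: y1 + m *: y2) =
    k *: (t *: z1 - r *: z2) + m *: (p *: z2 - q *: z1).
  by rewrite -Dy1 -Dy2 scalerDr !scalerA ![D * _]mulrC.
have z1E : z1 = p *: y1 + r *: y2.
  apply: (scalerI det); rewrite Dlin !scalerBr !scalerA.
  by rewrite [r * p]mulrC addrA subrK -scalerBl [r * q]mulrC.
have z2E : z2 = q *: y1 + t *: y2.
  apply: (scalerI det); rewrite Dlin !scalerBr !scalerA.
  by rewrite [q * t]mulrC addrC addrA subrK -scalerBl [t * p]mulrC.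
pose f x y := p * al x y + q * be x y; pose g x y := r * al x y + t * be x y.
have brE' x y : lie_br x y = f x y *: y1 + g x y *: y2.
  rewrite brE z1E z2E !scalerDr !scalerA addrACA -!scalerDl.
  by congr (_ *: _ + _ *: _); rewrite /f /g; ring.
have yD : y1 \in derived n /\ y2 \in derived n.
  have [m1 m2] : z1 \in derived n /\ z2 \in derived n.
    by rewrite es !memv_span // !inE eqxx ?orbT.
  by split; apply/memvZ/memvB; apply: memvZ.
have [y1D y2D] := yD.
pose l := [:: vsval a; vsval b; vsval c; vsval d; vsval e; - y1; - y2].
have full : (fullv <= <<l>>)%VS.
  rewrite fullWD subv_add; apply/andP; split.
    apply/subvP => x xW; rewrite -(vsprojK xW).
    have : vsproj W x \in <<[:: a; b; c; d; e]>>%VS.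
      exact: (subvP full5 _ (memvf _)).
    apply: (@span_ind _ _ (fun u : L => vsval u \in <<l>>%VS)).
    - by rewrite linear0 mem0v.
    - by move=> k u v hu hv; rewrite linearP memvD // memvZ.
    move=> u us; apply: memv_span; move: us; rewrite !inE.
    by case/or4P => [/eqP->|/eqP->|/eqP->|/orP[]/eqP->]; rewrite eqxx ?orbT.
  have m1 : y1 \in <<l>>%VS by rewrite -memvN memv_span // !inE eqxx !orbT.
  have m2 : y2 \in <<l>>%VS by rewrite -memvN memv_span // !inE eqxx !orbT.
  rewrite es; apply/span_subvP => z; rewrite !inE => /orP[]/eqP->.
    by rewrite z1E memvD // memvZ.
  by rewrite z2E memvD // memvZ.
have [E [eE EB]] := basis_of_span (s := l) dim_n erefl full.
have Ei i : E`_i = l`_i by rewrite eE.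
have [E5 E6] : E`_5 = - y1 /\ E`_6 = - y2 by rewrite !Ei.
apply: (lie_iso_of_normal_form EB (skew_comb alS beS p q) (skew_comb alS beS r t)).
- by move=> x y; rewrite E5 E6 brE' !scalerN !scaleNr !opprK.
- move=> x [|[|[|[|[|[|[|j]]]]]]] // _; rewrite (derived_central n2) //;
  by rewrite ?E5 ?E6 memvN.
by rewrite !Ei; exact: nf.
Qed.

End Classification.

Theorem theorem1p4 (R : realType) (n : lieAlgebra R)
    (dim_n : \dim {: n} = 7%N) (n_2step : two_step_nilpotent n) :
  (exists phi : kfun n 3, purely_coclosed_G2 phi) <->
  [/\ ~ lie_iso n (h3R4 R), ~ lie_iso n (n72A R) & ~ lie_iso n (n72B R)].
Proof.
split=> [[phi phiP]|[not_h not_A not_B]].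
  split=> iso.
  - exact: h3R4_no_purely_coclosed iso phiP.
  - exact: n72A_no_purely_coclosed iso phiP.
  - exact: n72B_no_purely_coclosed iso phiP.
have d0 := derived_neq0 n_2step; have d3 := dim_derived_le3 dim_n n_2step.
case d: (\dim (derived n)) d0 d3 => [|[|[|[|m]]]] // _ _.
- have [s es] := exists_span (derived n).
  have s1 : size s = 1%N by rewrite size_tuple d.
  case: {s} (val s) s1 es => [|z []] // _; rewrite span_seq1 => es.
  have z0 : z != 0.
    by apply: contra_eq_neq d => z0; rewrite es z0 dim_vline eqxx.
  by case: (classification_line dim_n n_2step z0 es).
- have [cen|] := boolp.EM (forall c : n, (forall x, lie_br x c = 0) -> c \in derived n).
    by case: (classification_plane dim_n n_2step d cen).
  (* A central vector outside n' completes it to a central 3-space. *)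
  case/boolp.existsNP=> c /boolp.not_implyP[cc /negP cD].
  apply: (classification_central dim_n n_2step (Z := (derived n + <[c]>)%VS)).
  + rewrite dimv_disjoint_sum ?d ?dim_vline; first by case: eqP cD => // ->; rewrite mem0v.
    apply/eqP; rewrite -subv0; apply/subvP => u /memv_capP[uD /vlineP[k uk]].
    rewrite memv0 uk scaler_eq0; apply: contraNT cD; rewrite negb_or => /andP[k0 _].
    by rewrite -(scalerK k0 c) memvZ // -uk.
  + exact: addvSl.
  + move=> x u /memv_addP[v vD [_ /vlineP[k ->] ->]].
    by rewrite lie_brDr lie_brZr cc (derived_central n_2step) // scaler0 addr0.
  by rewrite d.
apply: (classification_central dim_n n_2step (Z := derived n)); rewrite ?d //.
by move=> x u; apply: derived_central.
Qed.
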